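(* Let $(X,d_X,\mu_X)$ and $(Y,d_Y,\mu_Y)$ be metric measure spaces (in the sense of the context) such that $(X,d_X)$ and $(Y,d_Y)$ are length spaces, and let $1\le p<\infty$. Suppose that $\varphi:X\to[0,\infty)$ is a continuous function for which at least one of the following two conditions holds: (i) $\inf_{x\in X}\varphi(x)>0$, (ii) $\mu_Y(Y)<\infty$ and $\varphi(x)>0$ for $\mu_X$-a.e. $x\in X$. Moreover, suppose that all of the following conditions hold. 1. $X$ is a $(p,p)$-Sobolev--Poincaré space with constant $C_X$, and $\mu_X(X)=\infty$. 2. $Y$ is an $\infty$-weak local $(p,p)$-Poincaré space. 3. There exists a measurable set $E\subset X$ with $\mu_X(E)>0$ and $\varphi^{-p}\in L^\infty(E,\mu_X)$ and $\varphi^{-p}\notin L^1(E,\mu_X)$. Then $(X\times_\varphi Y,d_\varphi,\mu_\varphi)$ is a $(p,p)$-Sobolev--Poincaré space with constant $C_X$, and therefore $$D^{1,p}(X\times_\varphi Y)=N^{1,p}(X\times_\varphi Y)+\mathbb{R}.$$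
   Context: **Metric measure spaces.** A metric measure space is a triple $(Z,d_Z,\mu_Z)$ where $(Z,d_Z)$ is a non-empty separable metric space, $\mu_Z$ is a Borel regular outer measure on $Z$ (defined on all subsets; measurable sets are those satisfying Carathéodory's criterion; Borel sets are measurable; $\mu_Z(A)=\inf\{\mu_Z(F): F\supset A \text{ Borel}\}$ for all $A\subset Z$), and $0<\mu_Z(B)<\infty$ for all (open) balls $B\subset Z$. Write $u_B$ for the $\mu_Z$-average of $u$ over $B$. **Paths.** A path in a (pseudo)metric space $(Z,d_Z)$ is a continuous map $\gamma:[a,b]\to Z$; $\operatorname{len}_{d_Z}(\gamma)$ is the supremum of $\sum_i d_Z(\gamma(t_{i-1}),\gamma(t_i))$ over partitions; $\gamma$ is rectifiable if this is finite, and a rectifiable $\gamma$ is absolutely continuous if $t\mapsto \operatorname{len}_{d_Z}(\gamma|_{[a,t]})$ is absolutely continuous. The metric speed is $|\gamma'(t)|=\lim_{u\to t} d_Z(\gamma(u),\gamma(t))/|u-t|$, which exists for a.e. $t$ if $\gamma$ is absolutely continuous. For Borel $\rho\ge 0$, $\int_\gamma\rho\,ds=\int\rho(\tilde\gamma(t))|\tilde\gamma'(t)|\,dt$ for any absolutely continuous reparametrization $\tilde\gamma$ of $\gamma$. $(Z,d_Z)$ is a length space if any two points are joined by a rectifiable path and $d_Z(x,y)$ is the infimum of lengths of rectifiable paths from $x$ to $y$. **Function spaces.** For measurable $u:Z\to[-\infty,\infty]$, a Borel function $g:Z\to[0,\infty]$ is an upper gradient of $u$ if $|u(\gamma(b))-u(\gamma(a))|\le\int_\gamma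 g\,ds$ for each non-constant absolutely continuous curve $\gamma:[a,b]\to Z$. A function is integrable over balls if it is in $L^1(B,\mu_Z)$ for every ball $B$. $D^{1,p}(Z)$ is the set of measurable $u:Z\to[-\infty,\infty]$ that are integrable over balls and have an upper gradient $g\in L^p(Z,\mu_Z)$. $N^{1,p}(Z)$ is the set of $u\in D^{1,p}(Z)$ with $\int_Z|u|^p\,d\mu_Z<\infty$. $N^{1,p}(Z)+\mathbb{R}$ is the set of functions $v+c$ with $v\in N^{1,p}(Z)$, $c\in\mathbb{R}$ constant. **Poincaré conditions.** $Z$ is a $(p,q)$-Sobolev--Poincaré space with constant $C>0$ if for all $u\in D^{1,q}(Z)$ and all upper gradients $g\in L^q(Z)$ of $u$ there is $c_u\in\mathbb{R}$ with $\|u-c_u\|_{L^p(Z,\mu_Z)}\le C\|g\|_{L^q(Z,\mu_Z)}$. $Z$ is an $\infty$-weak local $(p,q)$-Poincaré space if for every $x\in Z$ there are $C_x,r_x>0$ such that for every $u$ that is integrable over balls and every upper gradient $g$ of $u$ on $Z$, $\|u-u_{B_Z(x,r_x)}\|_{L^p(B_Z(x,r_x),\mu_Z)}\le C_x\|g\|_{L^q(Z,\mu_Z)}$. **Warped products.** Fix a norm $\|\cdot\|$ on $\mathbb{R}^2$ that is unitary ($\|(1,0)\|=\|(0,1)\|=1$) and coordinate-increasing ($\|(a,c)\|\le\|(b,d)\|$ whenever $0\le a\le b$, $0\le c\le d$); the choice is arbitrary. For length spaces $X,Y$ and continuous $\varphi:X\to[0,\infty)$, and for a path $\gamma=(\gamma_X,\gamma_Y):[a,b]\to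 X\times Y$ absolutely continuous with respect to the $\ell^1$-product metric, set $\ell_\varphi(\gamma)=\int_a^b\|(|\gamma_X'(t)|,\varphi(\gamma_X(t))|\gamma_Y'(t)|)\|\,dt$. Let $d_\varphi((x,y),(x',y'))=\inf_\gamma\ell_\varphi(\gamma)$ over absolutely continuous paths from $(x,y)$ to $(x',y')$ (a pseudometric). $X\times_\varphi Y$ is the quotient of $X\times Y$ identifying points at $d_\varphi$-distance $0$, with the induced metric $d_\varphi$, and $P_\varphi:X\times Y\to X\times_\varphi Y$ is the projection. The measure on $X\times_\varphi Y$ is $\mu_\varphi(A)=(\mu_X\times\mu_Y)(P_\varphi^{-1}(A))$, where $\mu_X\times\mu_Y$ is the product outer measure. *)

(* Defs.v *)
From HB Require Import structures.
From Stdlib Require Import Relation_Operators Operators_Properties.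
From mathcomp Require Import all_boot all_order all_algebra.
From mathcomp Require Import generic_quotient.
From mathcomp Require Import all_classical all_reals all_analysis.
From mathcomp Require Import metric_structure measurable_realfun ess_sup_inf.

Set Implicit Arguments.
Unset Strict Implicit.
Unset Printing Implicit Defensive.
Import Order.TTheory GRing.Theory Num.Theory.
Import numFieldNormedType.Exports.

Local Open Scope classical_set_scope.
Local Open Scope ring_scope.

(* A pointed type is a non-empty one. *)
#[short(type="pmetricType")]
HB.structure Definition PointedMetric (R : numDomainType) :=
  {M of Metric R M & Pointed M}.

(* The notions below are stated for a bare distance function d, because they  *)
(* are used for metric spaces (d := mdist), for the l^1 product and for the   *)
(* warped product, which is a metric space only when the factors are length   *)
(* spaces.                                                                    *)
Section Paths.
Context {R : realType} {T : Type}.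
Implicit Types (d : T -> T -> R) (g : R -> T) (a b t : R).

(* A path [a, b] -> T is a function R -> T of which only the values on [a, b] *)
(* are used.                                                                  *)
Definition is_path d g a b := a <= b /\
  forall t, t \in `[a, b] -> forall e, 0 < e ->
    exists2 r, 0 < r &
      forall u, u \in `[a, b] -> `|u - t| < r -> d (g t) (g u) < e.

Definition path_sum d g a b (s : seq R) : R :=
  let F := g \o nth b (a :: s) in \sum_(0 <= n < size s) d (F n) (F n.+1).

Definition path_length d g a b : \bar R :=
  ereal_sup [set (path_sum d g a b s)%:E | s in itv_partition a b].

Definition rectifiable d g a b :=
  is_path d g a b /\ (path_length d g a b < +oo)%E.

Definition abs_continuous_fun (f : R -> R) a b :=
  forall e, 0 < e -> exists2 r, 0 < r &
    forall n (l u : 'I_n -> R),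
      (forall i, [/\ a <= l i, l i <= u i & u i <= b]) ->
      (forall i j, i != j -> u i <= l j \/ u j <= l i) ->
      \sum_(i < n) (u i - l i) < r ->
      \sum_(i < n) `|f (u i) - f (l i)| < e.

Definition abs_continuous_path d g a b :=
  rectifiable d g a b /\
  abs_continuous_fun (fun t => fine (path_length d g a t)) a b.

(* By convention 0 where the limit does not exist. At the endpoints of [a, b] *)
(* it may depend on values of g outside [a, b]; this does not affect          *)
(* integrals.                                                                 *)
Definition metric_speed d g t : R :=
  lim (d (g u) (g t) / `|u - t| @[u --> t^']).

Definition length_space d := forall x y,
  let joins g a b := [/\ rectifiable d g a b, g a = x & g b = y] in
  (exists g a b, joins g a b) /\
  (d x y)%:E = ereal_inf
    [set l | exists g a b, joins g a b /\ l = path_length d g a b].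

(* The integral of rho along an absolutely continuous path. *)
Definition path_integral d g a b (rho : T -> \bar R) : \bar R :=
  (\int[lebesgue_measure]_(t in `[a, b]) (rho (g t) * (metric_speed d g t)%:E))%E.

End Paths.

Section MetricMeasure.
Context {R : realType} {T : pointedType}.
Variables (d : T -> T -> R) (mu : {outer_measure set T -> \bar R}).
Implicit Types (u g : T -> \bar R) (p q C : R).

Definition dball (x : T) (r : R) : set T := [set y | d x y < r].

Definition dopen (U : set T) :=
  forall x, U x -> exists2 r, 0 < r & dball x r `<=` U.

Definition borel_type := g_sigma_algebraType dopen.

(* mu, restricted to its Caratheodory measurable sets. *)
Definition cmeasure : {measure set (caratheodory_type mu) -> \bar R} :=
  (mu : set (caratheodory_type mu) -> \bar R).

Definition measurable_function u :=
  measurable_fun [set: caratheodory_type mu] u.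

Definition metric_measure_space := [/\
  exists2 S : set T, countable S &
    forall x e, 0 < e -> exists2 s, S s & d x s < e,
  forall B : set T, <<s dopen >> B -> mu.-caratheodory B,
  forall A : set T,
    mu A = ereal_inf [set mu B | B in [set B | <<s dopen >> B /\ A `<=` B]] &
  forall x r, 0 < r -> (0 < mu (dball x r) < +oo)%E].

(* In \bar R, |oo - oo| = +oo: the left-hand side below is +oo as soon as one *)
(* of the two values of u is infinite.                                        *)
Definition upper_gradient u g := [/\
  measurable_fun [set: borel_type] g,
  forall x, (0 <= g x)%E &
  forall c a b, abs_continuous_path d c a b ->
    (exists2 t, t \in `[a, b] & c t <> c a) ->
    (`|u (c b) - u (c a)| <= path_integral d c a b g)%E].

Definition integrable_over_balls u :=
  forall x r, 0 < r -> cmeasure.-integrable (dball x r) u.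

Definition finite_Lnorm p u := ('N[cmeasure]_p%:E[u] < +oo)%E.

Definition D1 p : set (T -> \bar R) := [set u |
  [/\ measurable_function u, integrable_over_balls u &
      exists2 g, upper_gradient u g & finite_Lnorm p g]].

Definition N1 p : set (T -> \bar R) :=
  [set u | D1 p u /\ (\int[cmeasure]_x (`|u x| `^ p) < +oo)%E].

Definition N1_plus_constants p : set (T -> \bar R) :=
  [set u | exists2 v, N1 p v & exists c : R, u = (v \+ cst c%:E)%E].

Definition sobolev_poincare p q C := 0 < C /\
  forall u g, D1 q u -> upper_gradient u g -> finite_Lnorm q g ->
    exists c : R,
      ('N[cmeasure]_p%:E[u \- cst c%:E] <= C%:E * 'N[cmeasure]_q%:E[g])%E.

Definition average u (B : set T) : R :=
  fine (\int[cmeasure]_(x in B) u x)%E / fine (mu B).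

Definition inf_weak_local_poincare p q :=
  forall x, exists C r, [/\ 0 < C, 0 < r &
    forall u g, measurable_function u -> integrable_over_balls u ->
      upper_gradient u g ->
      let B := dball x r in
      ('N[cmeasure]_p%:E[(u \- cst (average u B)%:E) \_ B] <=
       C%:E * 'N[cmeasure]_q%:E[g])%E].

End MetricMeasure.

Lemma dball_mdist (R : realType) (X : pmetricType R) :
  dball (@mdist R X) = @ball R X.
Proof. by apply/funext => x; apply/funext => r; rewrite ballEmdist. Qed.

Lemma dopen_mdist (R : realType) (X : pmetricType R) :
  dopen (@mdist R X) = @open X.
Proof.
apply/funext => U; apply/propext; rewrite openE; split => + x Ux => /(_ x Ux).
  by move=> [r r0 rU]; apply/nbhs_ballP; exists r => //; rewrite -dball_mdist.
by move=> /nbhs_ballP[r /= r0 rU]; exists r => //; rewrite dball_mdist.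
Qed.

Section ProductOuterMeasure.
Local Open Scope ereal_scope.
Context {R : realType} {X Y : pointedType}.
Variables (muX : {outer_measure set X -> \bar R})
          (muY : {outer_measure set Y -> \bar R}).

Definition rectangle_cover (A : set (X * Y)) :
    set ((set X)^nat * (set Y)^nat) := [set EF |
  (forall k, muX.-caratheodory (EF.1 k) /\ muY.-caratheodory (EF.2 k)) /\
  A `<=` \bigcup_k (EF.1 k `*` EF.2 k)].

Definition prod_outer (A : set (X * Y)) : \bar R :=
  ereal_inf [set \sum_(k <oo) (muX (EF.1 k) * muY (EF.2 k))
            | EF in rectangle_cover A].

Let isrect (S : set (X * Y)) := exists EF : set X * set Y,
  [/\ muX.-caratheodory EF.1, muY.-caratheodory EF.2 & S = EF.1 `*` EF.2].

Let nu (S : set (g_sigma_algebraType [set: set (X * Y)])) : \bar R :=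
  if `[< isrect S >] then muX (fst @` S) * muY (snd @` S) else +oo.

Let nu_ge0 S : 0 <= nu S.
Proof. by rewrite /nu; case: ifP => // _; rewrite mule_ge0// outer_measure_ge0. Qed.

Let rect_images S : isrect S -> [/\ muX.-caratheodory (fst @` S),
  muY.-caratheodory (snd @` S) & S = (fst @` S) `*` (snd @` S)].
Proof.
move=> [[E F] /= [cE cF ->]].
have [->|/set0P[x Ex]] := eqVneq E set0.
  rewrite set0X !image_set0 set0X.
  by split => //; exact: caratheodory_measurable_set0.
have [->|/set0P[y Fy]] := eqVneq F set0.
  rewrite setX0 !image_set0 setX0.
  by split => //; exact: caratheodory_measurable_set0.
have -> : fst @` (E `*` F) = E.
  by apply/seteqP; split => [_ [[? ?] [? ?] <-]//|z Ez]; exists (z, y).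
have -> : snd @` (E `*` F) = F.
  by apply/seteqP; split => [_ [[? ?] [? ?] <-]//|z Ez]; exists (x, z).
by [].
Qed.

Let nu0 : nu set0 = 0.
Proof.
rewrite /nu ifT ?image_set0 ?outer_measure0 ?mule0//; apply/asboolP.
exists (set0, set0); rewrite /= set0X.
by split => //; exact: caratheodory_measurable_set0.
Qed.

Let prod_outerE : prod_outer = mu_ext nu.
Proof.
apply/funext => A; apply/eqP; rewrite eq_le; apply/andP; split.
  apply: le_ereal_inf_tmp => _ [S [_ AS] <-].
  have [rS|/existsNP[k nrS]] := pselect (forall k, isrect (S k)); last first.
    rewrite (@eseries_pinfty _ _ _ k) ?leey//.
      by move=> n _; rewrite gt_eqF// (lt_le_trans _ (nu_ge0 _)).
    by rewrite /nu ifF//; apply/asboolP.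
  apply: ereal_inf_lbound.
  exists (fun k => fst @` S k, fun k => snd @` S k) => /=; last first.
    by apply: eq_eseriesr => k _; rewrite /nu ifT//; exact/asboolP.
  split=> [k|]; first by have [] := rect_images (rS k).
  by move=> z /AS[k _ Sz]; exists k => //; have [_ _ <-] := rect_images (rS k).
apply: le_ereal_inf_tmp => _ [[E F] /= [cEF AEF] <-].
apply: (@le_trans _ _ (\sum_(k <oo) nu (E k `*` F k))).
  apply: ereal_inf_lbound; exists (fun k => E k `*` F k) => //.
  by split => // k; exact: sub_sigma_algebra.
apply: lee_nneseries => k // _.
have [/= cE cF] := cEF k.
rewrite /nu ifT; last by apply/asboolP; exists (E k, F k).
apply: lee_pmul; rewrite ?outer_measure_ge0//; apply: le_outer_measure.
  by move=> _ [[? ?] [? ?] <-].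
by move=> _ [[? ?] [? ?] <-].
Qed.

Let prod_outer0 : prod_outer set0 = 0.
Proof. by rewrite prod_outerE; exact: mu_ext0. Qed.

Let prod_outer_ge0 A : 0 <= prod_outer A.
Proof. by rewrite prod_outerE; exact: mu_ext_ge0. Qed.

Let le_prod_outer : {homo prod_outer : A B / A `<=` B >-> A <= B}.
Proof. by rewrite prod_outerE => A B; exact: (le_mu_ext nu). Qed.

Let prod_outer_sigma_subadditive : sigma_subadditive prod_outer.
Proof. by rewrite prod_outerE; exact: (mu_ext_sigma_subadditive nu_ge0). Qed.

HB.instance Definition _ := isOuterMeasure.Build R _ prod_outer
  prod_outer0 prod_outer_ge0 le_prod_outer prod_outer_sigma_subadditive.

End ProductOuterMeasure.

Section PushforwardOuterMeasure.
Local Open Scope ereal_scope.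
Context {R : realType} {T Q : Type}.
Variables (f : T -> Q) (mu : {outer_measure set T -> \bar R}).

Definition pushforward_outer (A : set Q) : \bar R := mu (f @^-1` A).

Let pushforward_outer0 : pushforward_outer set0 = 0.
Proof. by rewrite /pushforward_outer preimage_set0 outer_measure0. Qed.

Let pushforward_outer_ge0 A : 0 <= pushforward_outer A.
Proof. exact: outer_measure_ge0. Qed.

Let le_pushforward_outer : {homo pushforward_outer : A B / A `<=` B >-> A <= B}.
Proof. by move=> A B AB; apply: le_outer_measure => x; exact: AB. Qed.

Let pushforward_outer_sigma_subadditive : sigma_subadditive pushforward_outer.
Proof.
move=> F; rewrite /pushforward_outer preimage_bigcup.
exact: outer_measure_sigma_subadditive.
Qed.

HB.instance Definition _ := isOuterMeasure.Build R _ pushforward_outer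
  pushforward_outer0 pushforward_outer_ge0 le_pushforward_outer
  pushforward_outer_sigma_subadditive.

End PushforwardOuterMeasure.

Section PlaneNorm.
Context {R : realType}.
Variable N : R * R -> R.

Definition is_norm := [/\
  forall a b, N (a, b) = 0 -> a = 0 /\ b = 0,
  forall k a b, N (k * a, k * b) = `|k| * N (a, b) &
  forall a b c d, N (a + c, b + d) <= N (a, b) + N (c, d)].

Definition unitary := N (1, 0) = 1 /\ N (0, 1) = 1.

Definition coordinate_increasing :=
  forall a b c d, 0 <= a <= b -> 0 <= c <= d -> N (a, c) <= N (b, d).

End PlaneNorm.

Section WarpedProduct.
Context {R : realType} {X Y : pmetricType R}.
Variables (N : R * R -> R) (phi : X -> R).

Definition l1_dist (z w : X * Y) : R := mdist z.1 w.1 + mdist z.2 w.2.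

Definition warped_length (g : R -> X * Y) (a b : R) : \bar R :=
  (\int[lebesgue_measure]_(t in `[a, b])
    (N (metric_speed (@mdist R X) (fst \o g) t,
        phi (g t).1 * metric_speed (@mdist R Y) (snd \o g) t))%:E)%E.

Definition warped_pseudodist (z w : X * Y) : \bar R :=
  ereal_inf [set l | exists g a b,
    [/\ abs_continuous_path l1_dist g a b, g a = z, g b = w &
        l = warped_length g a b]].

(* When warped_pseudodist satisfies the triangle inequality, this is just     *)
(* warped_pseudodist z w = 0.                                                 *)
Definition warped_equiv (z w : X * Y) : bool :=
  `[< clos_refl_sym_trans _ (fun z w => warped_pseudodist z w = 0%E) z w >].

Let warped_equiv_refl : reflexive warped_equiv.
Proof. by move=> z; apply/asboolP; exact: rst_refl. Qed.

Let warped_equiv_sym : symmetric warped_equiv.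
Proof.
by move=> z w; apply/asboolP/asboolP; exact: rst_sym.
Qed.

Let warped_equiv_trans : transitive warped_equiv.
Proof.
move=> w z v /asboolP zw /asboolP wv; apply/asboolP; exact: rst_trans zw wv.
Qed.

Canonical warped_equiv_rel := EquivRel warped_equiv
  warped_equiv_refl warped_equiv_sym warped_equiv_trans.

Definition warped_product := {eq_quot warped_equiv_rel}%qT.

HB.instance Definition _ := Choice.on warped_product.
HB.instance Definition _ := EqQuotient.on warped_product.
HB.instance Definition _ :=
  isPointed.Build warped_product (\pi_warped_product point)%qT.

Definition warped_proj (z : X * Y) : warped_product :=
  (\pi_warped_product z)%qT.

(* warped_pseudodist is finite when X and Y are length spaces. *)
Definition warped_dist (P Q : warped_product) : R :=
  fine (warped_pseudodist (repr P) (repr Q)).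

Definition warped_measure (muX : {outer_measure set X -> \bar R})
    (muY : {outer_measure set Y -> \bar R}) :
    {outer_measure set warped_product -> \bar R} :=
  pushforward_outer warped_proj (prod_outer muX muY).

End WarpedProduct.

(* phi ^ -p, with value +oo where phi vanishes. *)
Definition inv_pow (R : realType) (X : Type) (phi : X -> R) (p : R) (x : X) :
  \bar R := ((phi x `^ p)%:E^-1)%E.

(* Main.v *)
From HB Require Import structures.
Require Import Defs.
From mathcomp Require Import all_boot all_order all_algebra.
From mathcomp Require Import all_classical all_reals all_analysis.
From mathcomp Require Import metric_structure measurable_realfun ess_sup_inf.
From mathcomp Require Import lra ring.
Import Order.TTheory GRing.Theory Num.Theory.
Import numFieldNormedType.Exports.
Local Open Scope classical_set_scope.
Local Open Scope ring_scope.
Set Implicit Arguments. Unset Strict Implicit. Unset Printing Implicit Defensive.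

(** Let P be the projection of the product onto the warped product, and let u
have the p-integrable upper gradient g there.  A horizontal slice P(., y) is an
isometric copy of X, so g(P(., y)) is an upper gradient of u(P(., y)), and the
inequality on X yields a constant c(y) such that
  int_X |u(P(x, y)) - c(y)|^p dx <= CX^p int_X g(P(x, y))^p dx
for almost every y (horizontal_sobolev_poincare).  As soon as c is almost
everywhere equal to one number k, integration in y gives the inequality on the
warped product with the same constant CX (horizontal_constants_glue).

The constants are compared through the vertical slices.  Where phi(x) > 0, the
function phi(x) g(P(x, .)) is an upper gradient of u(P(x, .)), so the weak local
inequality on Y gives, on a ball B of Y and with A(x) the average of u(P(x, .))
over B,
  int_B |u(P(x, y)) - A(x)|^p dy <= C^p phi(x)^p int_Y g(P(x, y))^p dy
(vertical_poincare).  Take w = phi^-p on E and w = 0 elsewhere.  Multiplication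
by w(x) cancels phi(x)^p, so w(x) |u(P(x, y)) - A(x)|^p is integrable over
X * B; and since w is bounded, w(x) |u(P(x, y)) - c(y)|^p is integrable in x for
almost every y.  Hence w |A - c(y)|^p is integrable for almost every y in B.  If
c took different values at two such points y and y', then w |c(y) - c(y')|^p
would be integrable as well, whereas the integral of w is infinite
(weighted_constant_unique).  So c is almost everywhere constant on small balls
of Y (constants_locally_ae_constant), hence almost everywhere constant, because
a length space is connected and Y is separable (locally_ae_constant).

Two bodies of facts make this rigorous.

The geometry of the warped distance: it is at most
dX x x1 + phi x1 * dY y y' + dX x1 x' for every intermediate point x1
(warped_dist_le), because points of a length space are joined by 1-Lipschitz
curves defined on intervals hardly longer than their distance
(lipschitz_curve); and it dominates the distance of X.  The latter, and the
comparison of path integrals along vertical curves, need that an absolutely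
continuous curve has a speed almost everywhere whose integral bounds its
increments (metric_derivative), which is derived from the Radon--Nikodym theorem
applied to the length function of the curve.

The measure theory of the projection: a function that is Caratheodory measurable
for the product outer measure agrees, off a product measurable null set, with a
product measurable function (measurable_fun_product_equivalent), and P is
injective over the points where phi > 0, which have full measure.  Integrals over
the warped product therefore become integrals over the product measure
(integral_warped), to which Tonelli's theorem applies. *)

(** * Lengths of paths and absolute continuity *)

Section PathLength.
Context {R : realType} {T : Type}.
Variables (d : T -> T -> R) (g : R -> T).
Implicit Types (a b c t : R) (s : seq R) (w : R -> R).

(** Structural recursion on the subdivision makes the splitting and
concatenation of subdivisions easy, unlike the indexed sum of [path_sum]. *)
Fixpoint polygon_length a s : R :=
  if s is t :: s' then d (g a) (g t) + polygon_length t s' else 0.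

Lemma path_sumE a b s : path_sum d g a b s = polygon_length a s.
Proof.
rewrite /path_sum; elim: s a => [|t s IHs] a; first by rewrite big_nil.
by rewrite big_nat_recl//= -IHs.
Qed.

Lemma polygon_length_cat a s1 s2 :
  polygon_length a (s1 ++ s2) = polygon_length a s1 + polygon_length (last a s1) s2.
Proof. by elim: s1 a => [|t s1 IHs] a /=; rewrite ?add0r// IHs addrA. Qed.

Lemma polygon_length_le_path_length a b s :
  itv_partition a b s -> ((polygon_length a s)%:E <= path_length d g a b)%E.
Proof.
by move=> abs; apply: ereal_sup_ubound; exists s => //=; rewrite path_sumE.
Qed.

Lemma path_length_le a b (M : \bar R) :
  (forall s, itv_partition a b s -> ((polygon_length a s)%:E <= M)%E) ->
  (path_length d g a b <= M)%E.
Proof.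
by move=> H; apply: ge_ereal_sup => _ [s abs <-]; rewrite path_sumE; exact: H.
Qed.

(** The increments of w telescope along every subdivision. *)
Lemma majorant_path_length a b w :
  (forall t u, a <= t -> t <= u -> u <= b -> d (g t) (g u) <= w u - w t) ->
  (path_length d g a b <= (w b - w a)%:E)%E.
Proof.
move=> dw; apply: path_length_le => s [+ /eqP]; rewrite lee_fin.
elim: s a dw => [|t s IHs] a dw /=; first by move=> _ ->; rewrite subrr.
move=> /andP[at_ ts] tb.
have tleb : t <= b by apply: (@itv_partition_le _ _ _ _ s); split => //; apply/eqP.
have -> : w b - w a = (w t - w a) + (w b - w t) by ring.
apply: lerD; first exact: (dw _ _ _ (ltW at_)).
by apply: IHs => // u v tu; apply: dw; rewrite (le_trans (ltW at_)).
Qed.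

Hypotheses (d0 : forall x, d x x = 0) (d_ge0 : forall x y, 0 <= d x y)
  (d_triangle : forall x y z, d x z <= d x y + d y z).

Lemma dist_le_path_length a b : a <= b ->
  ((d (g a) (g b))%:E <= path_length d g a b)%E.
Proof.
rewrite le_eqVlt => /predU1P[<-|ab].
  by rewrite d0; apply: (@polygon_length_le_path_length a a [::]); split.
have := polygon_length_le_path_length (itv_partition1 ab).
by rewrite /= addr0.
Qed.

Lemma path_length_ge0 a b : a <= b -> (0 <= path_length d g a b)%E.
Proof. by move=> ab; apply: le_trans (dist_le_path_length ab); rewrite lee_fin. Qed.

(** The point c is inserted into the subdivision; by the triangle inequality
this does not shorten the polygon. *)
Lemma polygon_length_split a b c s : itv_partition a b s -> a <= c -> c <= b ->
  exists s1 s2, [/\ itv_partition a c s1, itv_partition c b s2 &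
    polygon_length a s <= polygon_length a s1 + polygon_length c s2].
Proof.
elim: s a => [|t s IHs] a.
  move=> /itv_partition_nil <- ac ca.
  have -> : c = a by apply/eqP; rewrite eq_le ac ca.
  by exists [::], [::]; split => //=; rewrite addr0.
move=> abts; have := abts => -[/= /andP[at_ ts] lb] ac cb.
have [ct|tc] := ltP c t; last first.
  have [//|s1 [s2 [[p1 l1] p2 le12]]] := IHs _ (itv_partition_cons abts) tc.
  exists (t :: s1), s2; split => //=; last by rewrite -addrA lerD2l.
  by split => //=; rewrite at_.
move: ac; rewrite le_eqVlt => /predU1P[<-|ac].
  by exists [::], (t :: s); split => //=; rewrite ?add0r//; split.
exists [:: c], (t :: s); split => /=.
- exact: itv_partition1.
- by split => //=; rewrite ct.
- by rewrite addr0 addrA lerD2r.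
Qed.

Lemma path_lengthD a b c : a <= c -> c <= b ->
  path_length d g a b = (path_length d g a c + path_length d g c b)%E.
Proof.
move=> ac cb; apply/eqP; rewrite eq_le; apply/andP; split.
  apply: path_length_le => s abs.
  have [s1 [s2 [p1 p2]]] := polygon_length_split abs ac cb.
  rewrite -lee_fin => /le_trans; apply; rewrite EFinD.
  by apply: leeD; exact: polygon_length_le_path_length.
have key s1 : itv_partition a c s1 ->
    ((polygon_length a s1)%:E + path_length d g c b <= path_length d g a b)%E.
  move=> p1; rewrite addeC -leeBrDr//; apply: path_length_le => s2 p2.
  rewrite leeBrDr// addeC -EFinD.
  have <- : polygon_length a (s1 ++ s2) = polygon_length a s1 + polygon_length c s2.
    by rewrite polygon_length_cat; case: p1 => _ /eqP ->.
  exact/polygon_length_le_path_length/(itv_partition_cat p1 p2).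
have [->|] := eqVneq (path_length d g a b) +oo%E; first exact: leey.
rewrite -ltey => abfin.
have cbfin : path_length d g c b \is a fin_num.
  rewrite ge0_fin_numE ?path_length_ge0//.
  have ac1 : exists s1, itv_partition a c s1.
    move: ac; rewrite le_eqVlt => /predU1P[<-|ac]; first by exists [::]; split.
    by exists [:: c]; exact: itv_partition1.
  have [s1 p1] := ac1.
  have := key _ p1; rewrite addeC -leeBrDr// => /le_lt_trans; apply.
  by rewrite lteBlDr// (lt_le_trans abfin)// leey.
rewrite -leeBrDr//; apply: path_length_le => s1 p1.
by rewrite leeBrDr//; exact: key.
Qed.

Lemma fine_path_lengthB a b t u : (path_length d g a b < +oo)%E ->
  a <= t -> t <= u -> u <= b ->
  [/\ path_length d g a t \is a fin_num, path_length d g t u \is a fin_num &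
      fine (path_length d g a u) - fine (path_length d g a t) =
      fine (path_length d g t u)].
Proof.
move=> abfin at_ tu ub.
have au := le_trans at_ tu.
have fau : path_length d g a u \is a fin_num.
  rewrite ge0_fin_numE ?path_length_ge0//; apply: le_lt_trans abfin.
  by rewrite (path_lengthD au ub) leeDl// path_length_ge0.
have auE := path_lengthD at_ tu.
have fat : path_length d g a t \is a fin_num.
  rewrite ge0_fin_numE ?path_length_ge0//; move: fau.
  rewrite ge0_fin_numE ?path_length_ge0//; apply: le_lt_trans.
  by rewrite auE leeDl// path_length_ge0.
have ftu : path_length d g t u \is a fin_num.
  rewrite ge0_fin_numE ?path_length_ge0//; move: fau.
  rewrite ge0_fin_numE ?path_length_ge0//; apply: le_lt_trans.
  by rewrite auE leeDr// path_length_ge0.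
split => //; rewrite auE fineD//; ring.
Qed.

Lemma dist_le_length_increment a b t u : (path_length d g a b < +oo)%E ->
  a <= t -> t <= u -> u <= b ->
  d (g t) (g u) <= fine (path_length d g a u) - fine (path_length d g a t).
Proof.
move=> abfin at_ tu ub; have [_ ftu ->] := fine_path_lengthB abfin at_ tu ub.
by rewrite -lee_fin fineK// dist_le_path_length.
Qed.

Lemma length_increment_le a b t u w : (path_length d g a b < +oo)%E ->
  (forall t u, a <= t -> t <= u -> u <= b -> d (g t) (g u) <= w u - w t) ->
  a <= t -> t <= u -> u <= b ->
  0 <= fine (path_length d g a u) - fine (path_length d g a t) <= w u - w t.
Proof.
move=> abfin dw at_ tu ub; have [_ ftu ->] := fine_path_lengthB abfin at_ tu ub.
rewrite fine_ge0 ?path_length_ge0//= -lee_fin fineK//.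
apply: majorant_path_length => p q tp pq qu.
by apply: dw => //; [exact: le_trans at_ tp|exact: le_trans qu ub].
Qed.

Lemma abs_continuous_fun_dominated a b (f w : R -> R) (K : R) : 0 <= K ->
  (forall t u, a <= t -> t <= u -> u <= b -> `|f u - f t| <= K * `|w u - w t|) ->
  abs_continuous_fun w a b -> abs_continuous_fun f a b.
Proof.
move=> K0 fw acw e e0; have K1 : 0 < K + 1 by rewrite ltr_wpDl.
have [|r r0 H] := acw (e / (K + 1)); first exact: divr_gt0.
exists r => // n l u lu disj lur.
have := H n l u lu disj lur; rewrite ltr_pdivlMr// => /(le_lt_trans _); apply.
rewrite mulr_suml; apply: ler_sum => i _; have [al lui ub] := lu i.
rewrite (le_trans (fw _ _ al lui ub))// mulrC ler_wpM2l// lerDl//.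
Qed.

Lemma abs_continuous_fun_continuous a b w : abs_continuous_fun w a b ->
  forall t, t \in `[a, b] -> forall e, 0 < e -> exists2 r, 0 < r &
    forall u, u \in `[a, b] -> `|u - t| < r -> `|w u - w t| < e.
Proof.
move=> acw t; rewrite in_itv/= => /andP[at_ tb] e e0.
have [r r0 H] := acw e e0; exists r => // u; rewrite in_itv/= => /andP[au ub] utr.
wlog tu : t u at_ tb au ub utr / t <= u => [WH|].
  case: (leP t u) => [|/ltW] tu; first exact: WH.
  by rewrite distrC; apply: WH => //; rewrite distrC.
have := H 1%N (fun=> t) (fun=> u); rewrite !big_ord1; apply => //.
  by move=> i j; rewrite (ord1 i) (ord1 j) eqxx.
by rewrite -(ger0_norm (_ : 0 <= u - t))// subr_ge0.
Qed.

(** Together with [majorant_abs_continuous_path], this reduces absolute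
continuity of paths to the existence of an absolutely continuous real function
whose increments dominate the distances; the length function is such a
majorant. *)
Lemma abs_continuous_path_majorant a b : abs_continuous_path d g a b ->
  let w t := fine (path_length d g a t) in
  [/\ a <= b, abs_continuous_fun w a b &
    forall t u, a <= t -> t <= u -> u <= b -> d (g t) (g u) <= w u - w t].
Proof.
move=> [[[ab _] abfin] acw] w; split => // t u at_ tu ub.
exact: dist_le_length_increment abfin at_ tu ub.
Qed.

Lemma majorant_abs_continuous_path a b w : a <= b ->
  abs_continuous_fun w a b ->
  (forall t u, a <= t -> t <= u -> u <= b ->
    d (g t) (g u) <= w u - w t /\ d (g u) (g t) <= w u - w t) ->
  abs_continuous_path d g a b.
Proof.
move=> ab acw dw.
have abfin : (path_length d g a b < +oo)%E.
  apply: le_lt_trans (ltry (w b - w a)); apply: majorant_path_length => t u at_ tu ub.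
  by have [] := dw t u at_ tu ub.
split; last first.
  apply: (@abs_continuous_fun_dominated _ _ _ w 1) => // t u at_ tu ub.
  rewrite mul1r.
  have /andP[l0 lw] : 0 <= fine (path_length d g a u) - fine (path_length d g a t) <= w u - w t.
    apply: length_increment_le abfin _ at_ tu ub => p q ap pq qb.
    by have [] := dw p q ap pq qb.
  by rewrite !ger0_norm// (le_trans l0).
split=> //; split => // t tab e e0.
have [r r0 H] := abs_continuous_fun_continuous acw tab e0.
exists r => // u uab utr; have := H u uab utr; apply: le_lt_trans.
move: tab uab; rewrite !in_itv/= => /andP[at_ tb] /andP[au ub].
have [tu|/ltW ut] := leP t u.
  by rewrite (le_trans _ (ler_norm _))//; have [] := dw t u at_ tu ub.
by rewrite distrC (le_trans _ (ler_norm _))//; have [] := dw u t au ut tb.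
Qed.

End PathLength.

(** * Densities and the metric derivative *)

Section FiniteMeasure.
Context d (T : measurableType d) (R : realType).
Variables (mu : {measure set T -> \bar R}) (finmu : fin_num_fun mu).

(** A carrier for the finite measure structure, since finiteness is only known
from a proof. *)
Definition as_finite_measure of fin_num_fun mu : set T -> \bar R := mu.

HB.instance Definition _ := Measure.on (as_finite_measure finmu).
HB.instance Definition _ :=
  Measure_isFinite.Build _ _ _ (as_finite_measure finmu) finmu.

End FiniteMeasure.

Section AbsContinuousDensity.
Context {R : realType}.
Local Notation mu := (@lebesgue_measure R).
Implicit Types (W f h : R -> R).

(** Absolute continuity on the whole line for nondecreasing functions, hence
without absolute values. *)
Definition globally_abs_continuous W := forall e, 0 < e -> exists2 r, 0 < r &
  forall n (l u : 'I_n -> R), (forall i, l i <= u i) ->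
    (forall i j, i != j -> u i <= l j \/ u j <= l i) ->
    \sum_(i < n) (u i - l i) < r -> \sum_(i < n) (W (u i) - W (l i)) < e.

Lemma globally_abs_continuous_continuous W : {homo W : s t / s <= t} ->
  globally_abs_continuous W -> continuous W.
Proof.
move=> ndW acW x; apply/cvgrPdist_lt => e e0.
have [r r0 H] := acW e e0.
near=> t.
have xt : `|x - t| < r by near: t; apply: cvgr_dist_lt => //; exact: cvg_id.
have key u v : u <= v -> v - u < r -> W v - W u < e.
  move=> uv vur.
  have := H 1%N (fun=> u) (fun=> v); rewrite !big_ord1; apply => //.
  by move=> i j; rewrite (ord1 i) (ord1 j) eqxx.
have [tx|/ltW xt'] := leP t x.
  rewrite ger0_norm ?subr_ge0 ?ndW//; apply: key => //.
  by rewrite (le_lt_trans _ xt)// ler_norm.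
rewrite distrC ger0_norm ?subr_ge0 ?ndW//; apply: key => //.
by rewrite (le_lt_trans _ xt)// distrC ler_norm.
Unshelve. all: by end_near. Qed.

Lemma stieltjes_oc (W : cumulative R R) a b : a <= b ->
  lebesgue_stieltjes_measure W `]a, b]%classic = (W b - W a)%:E.
Proof.
move=> ab; rewrite /lebesgue_stieltjes_measure/= /measure_extension.
by rewrite measurable_mu_extE/= ?wlength_itv_bnd//; exact: is_ocitv.
Qed.

(** The total mass is the limit of the increments of W over the intervals ]-n,
n]. *)
Lemma stieltjes_finite (W : cumulative R R) B : (forall s t, W t - W s <= B) ->
  fin_num_fun (lebesgue_stieltjes_measure W).
Proof.
move=> WB A mA; rewrite ge0_fin_numE ?measure_ge0//.
apply: (@le_lt_trans _ _ B%:E); last exact: ltry.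
apply: (@le_trans _ _ (lebesgue_stieltjes_measure W setT)).
  by apply: le_measure; rewrite ?inE.
rewrite -(bigcup_itvT false false).
pose I n : set R := `]- (n%:R), n%:R]%classic.
have H : (lebesgue_stieltjes_measure W \o I) n @[n --> \oo] --> lebesgue_stieltjes_measure W (\bigcup_n I n).
  apply: nondecreasing_cvg_mu; rewrite /I//; first exact: bigcup_measurable.
  by move=> *; apply/subsetPset/subset_itv; rewrite leBSide/= ?lerN2 ler_nat.
rewrite -(cvg_lim _ H)//; apply: lime_le; first by apply/cvg_ex; exists (lebesgue_stieltjes_measure W (\bigcup_n I n)).
by apply: nearW => n; rewrite /= /I stieltjes_oc ?lee_fin// ge0_cp.
Qed.

(** Finite measure forces boundedness: subintervals of I have length at most
r. *)
Lemma open_interval_bounded (I : set R) (r : R) : open I -> is_interval I ->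
  (mu I < r%:E)%E -> I = `]inf I, sup I[%classic.
Proof.
move=> oI iI Ir.
have [->|/set0P[x Ix]] := eqVneq I set0; first by rewrite inf0 sup0 set_itv_ge// bnd_simp ltxx.
have r0 : 0 < r by rewrite -lte_fin (le_lt_trans _ Ir).
have mI : measurable I by exact: open_measurable.
have key y z : I y -> I z -> y <= z -> z - y <= r.
  move=> Iy Iz yz; rewrite -lee_fin (le_trans _ (ltW Ir))//.
  have -> : (z - y)%:E = mu (`]y, z[%classic).
    rewrite lebesgue_measure_itv/= lte_fin; case: ltgtP yz => //= -> _.
    by rewrite subrr.
  apply: le_measure; rewrite ?inE//.
  by move=> w; rewrite /= in_itv/= => /andP[yw wz]; apply: (iI y z) => //; rewrite (ltW yw) (ltW wz).
have lb : has_lbound I.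
  exists (x - r) => y Iy; have [xy|/ltW yx] := leP x y.
    by rewrite (le_trans _ xy)// gerBl ltW.
  by have := key _ _ Iy Ix yx; lra.
have ub : has_ubound I.
  exists (x + r) => y Iy; have [xy|/ltW yx] := leP x y.
    by have := key _ _ Ix Iy xy; lra.
  by rewrite (le_trans yx)// lerDl ltW.
have := interval_bounded_interior iI lb ub.
by rewrite (interior_id I).1// => {1}->; apply/seteqP; split => t /=; rewrite in_itv.
Qed.

(** A Lebesgue null set lies in an open set of small measure; the definition
of absolute continuity, applied to finitely many components of the open set,
bounds the Stieltjes measure of their union, and this bound passes to the
limit. *)
Lemma stieltjes_dominated (W : cumulative R R) : globally_abs_continuous W ->
  lebesgue_stieltjes_measure W `<< mu.
Proof.
move=> acW; apply/null_content_dominatesP => A mA A0.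
apply/eqP; rewrite eq_le measure_ge0 andbT.
apply/lee_addgt0Pr => e e0; rewrite add0e.
have [r r0 H] := acW e e0.
have [|U [oU AU UAr]] := lebesgue_regularity_outer mA _ r0; first by rewrite A0.
have mU : measurable U by exact: open_measurable.
have {UAr}Ur : (mu U < r%:E)%E.
  apply: le_lt_trans UAr; rewrite -[leRHS]add0e -A0.
  rewrite -{1}(setDUK AU); apply: measureU2 => //; exact: measurableD.
apply: (@le_trans _ _ (lebesgue_stieltjes_measure W U)).
  by apply: le_measure; rewrite ?inE.
pose I := open_disjoint_itv oU.
have oI k : open (I k) by exact: open_disjoint_itv_open.
have mI k : measurable (I k) by exact: open_measurable.
have IU k : I k `<=` U.
  by rewrite [X in _ `<=` X](open_disjoint_itv_bigcup oU); exact: bigcup_sup.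
have tI : trivIset setT I by exact: open_disjoint_itv_trivIset.
have IE k : I k = `]inf (I k), sup (I k)[%classic.
  apply: (@open_interval_bounded _ r) => //; first exact: open_disjoint_itv_is_interval.
  by apply: le_lt_trans Ur; apply: le_measure; rewrite ?inE//; exact: mI.
have UE : U = \bigcup_k I k by exact: open_disjoint_itv_bigcup.
rewrite UE measure_bigcup//; last by move=> k _; exact: mI.
apply: lime_le; first exact: is_cvg_nneseries.
apply: nearW => n; rewrite big_mkord (eq_bigl xpredT); last by move=> i; rewrite in_setT.
(* Empty components have no meaningful endpoints: they become degenerate
   intervals at M, to the right of all the others. *)
pose M : R := \sum_(i < n) `|sup (I i)|.
pose l (i : 'I_n) : R := if I i == set0 then M else inf (I i).
pose u (i : 'I_n) : R := if I i == set0 then M else sup (I i).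
have ne (i : 'I_n) : I i != set0 -> inf (I i) < sup (I i).
  move=> /set0P[x]; rewrite {1}IE/= in_itv/= => /andP[]; exact: lt_trans.
have uM i : u i <= M.
  rewrite /u; case: ifP => // _; rewrite (le_trans (ler_norm _))//.
  by rewrite /M (bigD1 i)//= lerDl sumr_ge0.
have lu i : l i <= u i by rewrite /l /u; case: ifPn => // /ne/ltW.
have dis i j : i != j -> u i <= l j \/ u j <= l i.
  move=> ij; have [Ij|Ij] := eqVneq (I j) set0; first by left; rewrite (le_trans (uM i))// /l Ij eqxx.
  have [Ii|Ii] := eqVneq (I i) set0; first by right; rewrite (le_trans (uM j))// /l Ii eqxx.
  apply/orP; rewrite -[_ || _]negbK negb_or -!ltNge /l /u (negbTE Ii) (negbTE Ij).
  apply/negP => /andP[ji ij'].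
  have : (I i `&` I j) !=set0.
    pose a := Num.max (inf (I i)) (inf (I j)); pose b := Num.min (sup (I i)) (sup (I j)).
    have ab : a < b.
      by rewrite /a /b gt_max !lt_min ne//= ne//= ji ij'.
    exists ((a + b) / 2).
    have [] := midf_lt ab; move: ((a + b) / 2) => c.
    rewrite /a /b gt_max !lt_min => /andP[a1 a2] /andP[b1 b2].
    by split; rewrite IE/= in_itv/= ?a1 ?a2 ?b1 ?b2.
  by move=> /(tI _ _ Logic.I Logic.I)/val_inj/eqP; rewrite (negPf ij).
have muI (i : 'I_n) : mu (I i) = (u i - l i)%:E.
  rewrite /u /l; have [->|/[dup] Ii /ne iI] := eqVneq (I i) set0; first by rewrite measure0 subrr.
  by rewrite {1}IE lebesgue_measure_itv/= lte_fin iI.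
have nuI (i : 'I_n) : (lebesgue_stieltjes_measure W (I i) <= (W (u i) - W (l i))%:E)%E.
  rewrite /u /l; have [->|/[dup] Ii /ne iI] := eqVneq (I i) set0; first by rewrite measure0 subrr.
  rewrite -stieltjes_oc ?(ltW iI)//; apply: le_measure; rewrite ?inE//=; first exact: mI.
  by rewrite {1}IE; apply: subset_itvl; rewrite bnd_simp.
have ulr : \sum_(i < n) (u i - l i) < r.
  rewrite -lte_fin; apply: le_lt_trans Ur; rewrite -sumEFin.
  rewrite -(eq_bigr _ (fun i _ => muI i)).
  have <- : mu (\big[setU/set0]_(i < n) I i) = (\sum_(i < n) mu (I i))%E.
    apply: measure_semi_additive => //.
    by apply: bigsetU_measurable => i _; exact: mI.
  apply: le_measure; rewrite ?inE//.
    by apply: bigsetU_measurable => i _; exact: mI.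
  by rewrite -bigcup_mkord; apply: bigcup_sub => k _; exact: IU.
apply: (@le_trans _ _ (\sum_(i < n) (W (u i) - W (l i)))%:E).
  by rewrite -sumEFin; apply: lee_sum => i _; exact: nuI.
by rewrite lee_fin ltW// H.
Qed.

(** The density is the Radon--Nikodym derivative of the Stieltjes measure of
W. *)
Lemma nondecreasing_density W B : {homo W : s t / s <= t} ->
  (forall s t, W t - W s <= B) -> globally_abs_continuous W ->
  exists h, [/\ forall x, 0 <= h x, mu.-integrable setT (EFin \o h) &
    forall s t, s <= t -> W t - W s = \int[mu]_(x in `]s, t]) h x].
Proof.
move=> ndW WB acW.
have cW := globally_abs_continuous_continuous ndW acW.
pose Wc : cumulative R R := HB.pack W (isCumulative.Build R _ R W ndW (right_continuousW cW)).
have finW := @stieltjes_finite Wc B WB.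
pose nu : {finite_measure set (measurableTypeR R) -> \bar R} := as_finite_measure finW.
have [|h0 [h0_ge0 h0_fin inth0 h0E]] := @radon_nikodym_sigma_finite _ _ _ mu nu.
  by exact: (@stieltjes_dominated Wc).
exists (fine \o h0); split => [x| |s t st].
- by rewrite /= fine_ge0.
- by apply: eq_integrable inth0 => // x _; rewrite /= fineK.
- apply: EFin_inj; rewrite -(@stieltjes_oc Wc)// [LHS]h0E//.
  rewrite /Rintegral fineK.
    by apply: eq_integral => x _; rewrite /= fineK.
  rewrite integrable_fin_num//=.
  apply: (@integrableS _ _ _ _ setT) => //.
  by apply: eq_integrable inth0 => // x _; rewrite /= fineK.
Qed.

(** Both W and f + W are nondecreasing, and f is their difference. *)
Lemma dominated_density W f B : (forall s t, s <= t -> `|f t - f s| <= W t - W s) ->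
  (forall s t, W t - W s <= B) -> globally_abs_continuous W ->
  exists h, mu.-integrable setT (EFin \o h) /\
    forall s t, s <= t -> f t - f s = \int[mu]_(x in `]s, t]) h x.
Proof.
move=> fW WB acW.
have ndW : {homo W : s t / s <= t}.
  by move=> s t st; rewrite -subr_ge0 (le_trans _ (fW _ _ st)).
have [h [_ inth hE]] := nondecreasing_density ndW WB acW.
have [|s t||h1 [_ inth1 h1E]] := @nondecreasing_density (fun x => f x + W x) (2 * B).
- by move=> s t st; have := fW _ _ st; rewrite ler_norml => /andP[]; lra.
- have [st|/ltW ts] := leP s t.
    have := fW _ _ st; have := WB s t; rewrite ler_norml => + /andP[]; lra.
  have := fW _ _ ts; have := WB t s; have := WB t t.
  rewrite ler_norml => + + /andP[]; lra.
- move=> e e0; have [|r r0 H] := acW (e / 2); first by rewrite divr_gt0.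
  exists r => // n l u lu disj lur.
  have := H n l u lu disj lur; rewrite ltr_pdivlMr// => /(le_lt_trans _); apply.
  rewrite mulr_suml; apply: ler_sum => i _.
  by have := fW _ _ (lu i); rewrite ler_norml => /andP[]; lra.
exists (fun x => h1 x - h x); split.
  by rewrite (_ : _ \o _ = (EFin \o h1) \- (EFin \o h))%E//; exact: integrableB.
move=> s t st; rewrite RintegralB//; last 2 first.
  exact: integrableS inth1.
  exact: integrableS inth.
by rewrite -h1E// -hE//; ring.
Qed.

Lemma primitive_increment h s t : mu.-integrable setT (EFin \o h) -> s <= t ->
  \int[mu]_(x in `]-oo, t]) h x - \int[mu]_(x in `]-oo, s]) h x =
  \int[mu]_(x in `]s, t]) h x.
Proof.
move=> inth st; rewrite (@itv_bndbnd_setU _ _ -oo%O (BRight s) (BRight t))//.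
rewrite Rintegral_setU//=; first by rewrite addrAC subrr add0r.
- by apply: (integrableS _ _ _ inth) => //; exact: measurableU.
- rewrite disj_set2E; apply/eqP; apply/seteqP; split => // x /=; rewrite !in_itv/=.
  by move=> [xu /andP[]]; rewrite ltNge xu.
Qed.

(** Lebesgue differentiation; only the increments of f matter, so f may be
replaced by the primitive of h vanishing at -oo. *)
Lemma density_derivative f h : mu.-integrable setT (EFin \o h) ->
  (forall s t, s <= t -> f t - f s = \int[mu]_(x in `]s, t]) h x) ->
  {ae mu, forall x, (f u - f x) / (u - x) @[u --> x^'] --> h x}.
Proof.
move=> inth fE.
have loch : locally_integrable [set: R] h.
  by apply: open_integrable_locally => //; exact: openT.
pose F x := \int[mu]_(t in `]-oo, x]) h t.
have FfE u v : F v - F u = f v - f u.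
  wlog uv : u v / u <= v => [WH|].
    case: (leP u v) => [|/ltW]; first exact: WH.
    by move=> /WH H; rewrite -opprB H opprB.
  by rewrite fE// primitive_increment.
have intNy (y : R) : mu.-integrable `]-oo, y] (EFin \o h) by exact: integrableS inth.
have := FTC1Ny intNy loch.
apply: filterS; first exact: (ae_filter_ringOfSetsType mu).
move=> x [dF F'x].
have {}dF : h0^-1 *: ((F \o shift x) (h0 *: (1 : R)) - F x) @[h0 --> 0^'] --> h x.
  by rewrite -F'x derive1E; exact: dF.
apply/cvgrPdist_lt => e e0; move/cvgrPdist_lt : dF => /(_ e e0).
move=> [r /= r0 H]; exists r => //= u /= xu ux.
have := H (u - x); rewrite /ball_/= sub0r normrN distrC => /(_ xu).
rewrite subr_eq0 => /(_ ux).
by rewrite /= [_ *: 1]mulr1 subrK FfE mulrC.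
Qed.

(** The distances f n to the points g(q n), with q n dense in the line, are
dominated by W, so they have densities h n; the speed is the supremum m of the
|h n|. It bounds the increments of g because d (g s) (g t) is a limit of
increments of the f n, and the difference quotients of g lie between those of
the f n, whose derivatives approach m, and those of the primitive of m, whose
derivative is m almost everywhere. *)
Lemma metric_derivative (T : Type) (d : T -> T -> R) (g : R -> T) W B :
  (forall x, d x x = 0) -> (forall x y, d x y = d y x) ->
  (forall x y z, d x z <= d x y + d y z) ->
  (forall s t, s <= t -> d (g s) (g t) <= W t - W s) ->
  (forall s t, W t - W s <= B) -> globally_abs_continuous W ->
  exists m, [/\ forall x, 0 <= m x, mu.-integrable setT (EFin \o m),
    {ae mu, forall x, d (g u) (g x) / `|u - x| @[u --> x^'] --> m x} &
    forall s t, s <= t -> d (g s) (g t) <= \int[mu]_(x in `]s, t]) m x].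
Proof.
move=> d0 dC dD dW WB acW.
have d_ge0 x y : 0 <= d x y by have := dD x y x; rewrite d0 (dC y x); lra.
have ndW : {homo W : s t / s <= t}.
  by move=> s t st; rewrite -subr_ge0 (le_trans _ (dW _ _ st)).
have cW := globally_abs_continuous_continuous ndW acW.
have [hW [hW_ge0 inthW hWE]] := nondecreasing_density ndW WB acW.
pose q n : R := if @unpickle rat n is Some r then ratr r else 0.
pose f n t := d (g t) (g (q n)).
have fd n s t : `|f n t - f n s| <= d (g s) (g t).
  have := dD (g t) (g s) (g (q n)); have := dD (g s) (g t) (g (q n)).
  rewrite ler_norml /f (dC (g t) (g s)) => H1 H2; apply/andP; split; lra.
have fW n s t : s <= t -> `|f n t - f n s| <= W t - W s.
  by move=> st; rewrite (le_trans (fd n s t))// dW.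
have /choice[h hP] n := dominated_density (fW n) WB acW.
have inth n : mu.-integrable setT (EFin \o h n) by have [] := hP n.
have hE n s t : s <= t -> f n t - f n s = \int[mu]_(x in `]s, t]) h n x.
  by have [_] := hP n; apply.
(* The truncation at hW makes the supremum finite everywhere; it is inactive
   almost everywhere, by hn below. *)
pose k n x := Num.min `|h n x| (hW x).
have k_ge0 n x : 0 <= k n x by rewrite /k le_min normr_ge0 hW_ge0.
pose m x := sups (k ^~ x) 0.
have kub x : has_ubound (range (k ^~ x)).
  by exists (hW x) => _ [n _ <-]; rewrite /k ge_min lexx orbT.
have mE x : m x = sup (range (k ^~ x)).
  rewrite /m /sups /sdrop; congr sup; apply/seteqP; split => [_ [n _ <-]|_ [n _ <-]].
    by exists n.
  by exists n.
have km n x : k n x <= m x.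
  by rewrite mE; apply: ub_le_sup => //; exists n.
have m_ge0 x : 0 <= m x by rewrite (le_trans _ (km 0%N x)).
have mhW x : m x <= hW x.
  rewrite mE; apply: ge_sup; first by exists (k 0%N x), 0%N.
  by move=> _ [n _ <-]; rewrite /k ge_min lexx orbT.
have mk n : measurable_fun setT (k n).
  apply: measurable_minr; last by have /integrableP[/measurable_EFinP] := inthW.
  by apply: measurableT_comp => //; have /integrableP[/measurable_EFinP] := inth n.
have mm : measurable_fun setT m by exact: measurable_fun_sups.
have intm : mu.-integrable setT (EFin \o m).
  apply: le_integrable inthW => //; first exact/measurable_EFinP.
  by move=> x _; rewrite /= lee_fin !ger0_norm// mhW.
have AE := ae_filter_ringOfSetsType mu.
have DW := density_derivative inthW hWE.
have Dh : {ae mu, forall x n, (f n u - f n x) / (u - x) @[u --> x^'] --> h n x}.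
  by apply: ae_foralln => n; apply: density_derivative => //; exact: hE.
have hn : {ae mu, forall x n, k n x = `|h n x|}.
  apply: filterS2 DW Dh => x Wx hx n; apply/min_idPl.
  have /= := hx n => /cvg_norm /ler_cvg_to; apply; first exact: Wx.
  near=> u; rewrite normrM.
  have : u != x by near: u; exact: nbhs_dnbhs_neq.
  rewrite neq_lt => /orP[ux|xu].
    rewrite normfV distrC (ltr0_norm (_ : u - x < 0)) ?subr_lt0//.
    rewrite -[leRHS]mulrNN -invrN ler_wpM2r//; first by rewrite invr_ge0; lra.
    by rewrite opprB fW// ltW.
  rewrite normfV (gtr0_norm (_ : 0 < u - x)) ?subr_gt0//.
  by rewrite ler_wpM2r ?fW ?invr_ge0 ?subr_ge0 ?ltW.
have dm s t : s <= t -> d (g s) (g t) <= \int[mu]_(x in `]s, t]) m x.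
  move=> st; apply/ler_addgt0Pr => e e0.
  have [n tn] : exists n, d (g t) (g (q n)) < e / 2.
    have e20 : 0 < e / 2 by rewrite divr_gt0.
    have /cvgrPdist_lt/(_ _ e20)[r /= r0 H] := cW t.
    have [|x] := @rat_in_itvoo R t (t + r); first by rewrite ltrDl.
    rewrite in_itv/= => /andP[tx xtr].
    exists (pickle x); rewrite /q pickleK.
    rewrite (le_lt_trans (dW _ _ (ltW tx)))// (le_lt_trans (ler_norm _))// distrC.
    by apply: H; rewrite /ball_/= distrC gtr0_norm ?subr_gt0// ltrBlDl.
  have fst : f n s - f n t <= \int[mu]_(x in `]s, t]) m x.
    rewrite (le_trans (ler_norm _))// distrC hE//.
    have inths : mu.-integrable `]s, t] (EFin \o h n) by exact: integrableS (inth n).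
    have intms : mu.-integrable `]s, t] (EFin \o m) by exact: integrableS intm.
    rewrite (le_trans (le_normr_Rintegral _ inths))// /Rintegral fine_le//.
    - by rewrite integrable_fin_num//; exact: integrable_norm.
    - by rewrite integrable_fin_num.
    - apply: ae_ge0_le_integral => //.
      + by apply/measurable_EFinP/measurableT_comp => //; have /integrableP[/measurable_EFinP] := inths.
      + by move=> x _; rewrite lee_fin.
      + by have /integrableP[] := intms.
      + by apply: filterS hn => x hx _; rewrite lee_fin -hx.
  have := dD (g s) (g (q n)) (g t).
  by rewrite (dC (g (q n))) => dst; move: fst tn; rewrite /f; lra.
exists m; split => //.
pose M x := \int[mu]_(t in `]-oo, x]) m t.
have ME s t : s <= t -> M t - M s = \int[mu]_(x in `]s, t]) m x.
  by move=> st; rewrite primitive_increment.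
have := density_derivative intm ME.
apply: filterS3 Dh hn => x Dhx hnx DMx.
apply/cvgrPdist_lt => e e0; have e20 : 0 < e / 2 by rewrite divr_gt0.
(* The distance to g (q n) nearly realizes the speed at x. *)
have [n hnm] : exists n, m x - e / 2 < k n x.
  have [|_ [n _ <-]] := @sup_adherent _ (range (k ^~ x)) _ e20; last by rewrite -mE; exists n.
  by split; [exists (k 0%N x), 0%N|].
near=> u.
have ux : u != x by near: u; exact: nbhs_dnbhs_neq.
have ux0 : 0 < `|u - x| by rewrite normr_gt0 subr_eq0.
have Mu : `|m x - (M u - M x) / (u - x)| < e by near: u; exact: cvgr_dist_lt.
have Hu : `|h n x - (f n u - f n x) / (u - x)| < e / 2 by near: u; exact: cvgr_dist_lt.
have up : d (g u) (g x) / `|u - x| <= (M u - M x) / (u - x).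
  move: ux; rewrite neq_lt => /orP[ux|xu].
    rewrite ltr0_norm ?subr_lt0// -[leRHS]mulrNN -invrN ler_wpM2r ?invr_ge0//.
      by rewrite opprB subr_ge0 ltW.
    by rewrite opprB ME ?dm ?ltW.
  rewrite gtr0_norm ?subr_gt0// ler_wpM2r ?invr_ge0 ?subr_ge0 ?(ltW xu)//.
  by rewrite ME ?(ltW xu)// dC dm// ltW.
have lo : `|(f n u - f n x) / (u - x)| <= d (g u) (g x) / `|u - x|.
  by rewrite normrM normfV ler_wpM2r ?invr_ge0// dC fd.
have := ler_distD 0 (h n x) ((f n u - f n x) / (u - x)).
have : `|h n x| <= `|(f n u - f n x) / (u - x)| + `|h n x - (f n u - f n x) / (u - x)|.
  by rewrite -lerBlDl; exact: lerB_dist.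
rewrite -hnx => Hn _.
move: Mu; rewrite !ltr_norml => /andP[Mu1 Mu2]; apply/andP; split; last first.
  by rewrite ltrBlDl; move: Hn Hu hnm lo; lra.
move: up Mu1; lra.
Unshelve. all: by end_near. Qed.

End AbsContinuousDensity.

(** * Integrals of possibly non-measurable functions *)

(** The integral of a nonnegative function is the supremum of the integrals of
the simple functions below it, whether or not the function is measurable. The
integrands of [path_integral] and [warped_length] are not known to be
measurable, so only the properties of this lower integral may be used for
them. *)
Section LowerIntegral.
Local Open Scope ereal_scope.
Context d (T : measurableType d) (R : realType).
Variable mu : {measure set T -> \bar R}.
Implicit Types (D A B : set T) (f g : T -> \bar R).

Import HBNNSimple.

Lemma lower_integral_le D f M : (forall x, D x -> 0 <= f x) ->
  (forall h : T -> R, measurable_fun setT h -> (forall x, (0 <= h x)%R) ->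
    (forall x, (h x)%:E <= (f \_ D) x) -> \int[mu]_x (h x)%:E <= M) ->
  \int[mu]_(x in D) f x <= M.
Proof.
move=> f0 H; rewrite ge0_integralE//.
apply: ge_ereal_sup => _ [h /= hf <-].
have := H h; rewrite integral_nnsfun// patch_setT; apply => //.
Qed.

Lemma le_lower_integral D f (h : T -> R) : (forall x, D x -> 0 <= f x) ->
  (forall x, (0 <= h x)%R) -> (forall x, (h x)%:E <= (f \_ D) x) ->
  \int[mu]_x (h x)%:E <= \int[mu]_(x in D) f x.
Proof.
move=> f0 h0 hf; rewrite (ge0_integralE _ f0) ge0_integralTE//.
apply: ereal_sup_le => _ [k /= kh <-]; exists k => //= x.
exact: le_trans (kh x) (hf x).
Qed.

Lemma ae_le_lower_integral D f g : (forall x, D x -> 0 <= f x) ->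
  (forall x, D x -> 0 <= g x) -> {ae mu, forall x, D x -> f x <= g x} ->
  \int[mu]_(x in D) f x <= \int[mu]_(x in D) g x.
Proof.
move=> f0 g0 [N [mN N0 subN]]; apply: lower_integral_le => // h mh h0 hf.
have mNC : measurable (~` N) by exact: measurableC.
have -> : \int[mu]_x (h x)%:E = \int[mu]_x ((h \_ (~` N)) x)%:E.
  apply: ae_eq_integral => //; first exact/measurable_EFinP.
    by apply/measurable_EFinP/(measurable_restrictT _ mNC); exact: measurable_funTS.
  exists N; split => // x /= /not_implyP[_]; apply: contra_notP => Nx.
  by rewrite patchE mem_set.
apply: le_lower_integral => // x; first by rewrite patchE; case: ifP.
rewrite patchE; case: ifPn => [|_]; last first.
  by rewrite patchE; case: ifPn => // /set_mem; exact: g0.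
move=> /set_mem Nx; apply: le_trans (hf x) _.
rewrite !patchE; case: ifPn => // /set_mem Dx.
by apply: contrapT => fg; apply: Nx; apply: subN => /= /(_ Dx).
Qed.

(** A measurable minorant on the union splits into minorants on the two parts,
the second one being restricted to the complement of A. *)
Lemma lower_integral_setU A B f : measurable A -> measurable B ->
  (forall x, (A `|` B) x -> 0 <= f x) ->
  \int[mu]_(x in A `|` B) f x <= \int[mu]_(x in A) f x + \int[mu]_(x in B) f x.
Proof.
move=> mA mB f0; apply: lower_integral_le => // h mh h0 hf.
have mh' : measurable_fun setT (EFin \o h) by exact/measurable_EFinP.
have mAC : measurable (~` A) by exact: measurableC.
rewrite -(setUv A) ge0_integral_setU//; last 3 first.
- by rewrite setUv.
- by move=> x _; rewrite lee_fin.
- by rewrite disj_set2E setICr.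
rewrite integral_mkcond [X in _ + X]integral_mkcond restrict_EFin restrict_EFin.
apply: leeD.
  apply: le_lower_integral => x; first by move=> Ax; apply: f0; left.
    by rewrite patchE; case: ifP.
  rewrite !patchE; case: ifPn => // /set_mem Ax.
  by have := hf x; rewrite patchE mem_set//; left.
apply: le_lower_integral => x; first by move=> Ax; apply: f0; right.
  by rewrite patchE; case: ifP.
have fB0 : 0 <= (f \_ B) x by apply: erestrict_ge0 => y By; apply: f0; right.
rewrite [leLHS]fun_if patchE; case: ifPn => // /set_mem Ax.
have := hf x; rewrite !patchE; case: ifPn => [/set_mem[//|Bx]|_].
  by rewrite mem_set.
by move=> /le_trans; apply; move: fB0; rewrite patchE.
Qed.

End LowerIntegral.

Section LebesgueShift.
Context {R : realType}.
Local Notation mu := (@lebesgue_measure R).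

Lemma integral_shift (f : R -> \bar R) (c : R) :
  measurable_fun setT f -> (forall x, 0 <= f x)%E ->
  (\int[mu]_x f (x + c)%R = \int[mu]_x f x)%E.
Proof.
move=> mf f0.
have mc : measurable_fun [set: measurableTypeR R] (fun x : R => x + c : measurableTypeR R).
  exact: measurable_funD.
pose shift_c := (fun x => x + c) : R -> measurableTypeR R.
transitivity (\int[pushforward mu shift_c]_x f x)%E.
  by rewrite (ge0_integral_pushforward mc).
apply: eq_measure_integral => A mA _.
apply/esym/lebesgue_measure_unique => // X.
move=> [[a b] _ <-].
have shiftE : shift_c @^-1` `]a, b] = `](a - c), (b - c)]%classic.
  by apply/seteqP; split => x /=; rewrite /shift_c !in_itv/= ltrBlDr lerBrDr.
transitivity (mu `](a - c), (b - c)]%classic); last by rewrite -shiftE.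
by rewrite !lebesgue_measure_itv/= !lte_fin ltrD2r; case: ifP => // _; rewrite -!EFinD; congr EFin; ring.
Qed.

(** The minorants are measurable, so translation invariance applies to
them. *)
Lemma lower_integral_shift (f : R -> \bar R) (a b c : R) :
  (forall x, 0 <= f x)%E ->
  (\int[mu]_(x in `[(a + c)%R, (b + c)%R]) f (x - c)%R <= \int[mu]_(x in `[a, b]) f x)%E.
Proof.
move=> f0; apply: lower_integral_le => // h mh h0 hf.
have mh' : measurable_fun setT (EFin \o h) by exact/measurable_EFinP.
rewrite -(integral_shift c mh')//.
apply: le_lower_integral => // x.
have := hf (x + c); rewrite !patchE addrK.
suff -> : (x + c \in `[a + c, b + c]%classic) = (x \in `[a, b]%classic) by [].
by rewrite !mem_setE !in_itv/= !lerD2r.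
Qed.

End LebesgueShift.

(** * Speed of absolutely continuous paths *)

Section Clamp.
Context {R : realType}.
Implicit Types a b s t : R.

(** Precomposition with it extends a function from [a, b] to the whole line by
its values at the endpoints. *)
Definition clamp a b t := Num.max a (Num.min t b).

Lemma clamp_itv a b t : a <= b -> a <= clamp a b t <= b.
Proof. by move=> ab; rewrite /clamp le_max lexx/= ge_max ab ge_min lexx orbT. Qed.

Lemma clamp_id a b t : a <= t -> t <= b -> clamp a b t = t.
Proof. by move=> at_ tb; rewrite /clamp min_l// max_r. Qed.

Lemma clamp_nondecreasing a b s t : s <= t -> clamp a b s <= clamp a b t.
Proof.
move=> st; rewrite /clamp ge_max !le_max lexx/=.
by rewrite (le_trans _ (_ : Num.min s b <= Num.min t b)) ?orbT// le_min !ge_min lexx st !orbT.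
Qed.

Lemma clamp_increment a b s t : s <= t -> clamp a b t - clamp a b s <= t - s.
Proof.
move=> st; rewrite /clamp /Num.max /Num.min.
by case: (ltP t b); case: (ltP s b) => ? ?; do ?case: ltP => ?; lra.
Qed.

Lemma clamp_globally_abs_continuous a b w : a <= b ->
  (forall s t, a <= s -> s <= t -> t <= b -> w s <= w t) ->
  abs_continuous_fun w a b -> globally_abs_continuous (w \o clamp a b).
Proof.
move=> ab ndw acw e e0; have [r r0 H] := acw e e0; exists r => // n l u lu disj lur.
have := H n (clamp a b \o l) (clamp a b \o u).
have luc i : clamp a b (l i) <= clamp a b (u i) by exact: clamp_nondecreasing.
move=> {}H; apply: le_lt_trans (H _ _ _).
- by apply: ler_sum => i _; exact: ler_norm.
- by move=> i /=; have /andP[-> _] := clamp_itv (l i) ab; have /andP[_ ->] := clamp_itv (u i) ab.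
- by move=> i j /disj[]; [left|right]; exact: clamp_nondecreasing.
- apply: le_lt_trans lur; apply: ler_sum => i _; exact: clamp_increment.
Qed.

End Clamp.

Section MetricSpeed.
Context {R : realType} {T : Type}.
Variable d : T -> T -> R.
Local Notation mu := (@lebesgue_measure R).
Implicit Types (g : R -> T) (a b s t : R).

Lemma metric_speed_ge0 g t : (forall x y, 0 <= d x y) -> 0 <= metric_speed d g t.
Proof.
move=> d_ge0; rewrite /metric_speed.
have [cv|/dvgP ->//] := pselect (cvg (d (g u) (g t) / `|u - t| @[u --> t^'])).
by apply: limr_ge => //; near=> u; rewrite divr_ge0.
Unshelve. all: by end_near. Qed.

Lemma metric_speed_near g g' t : (\forall u \near t, g u = g' u) ->
  metric_speed d g t = metric_speed d g' t.
Proof.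
move=> gg'; rewrite /metric_speed; congr (lim _).
have gt : g t = g' t by exact: nbhs_singleton gg'.
apply/funext => A; apply/propext; rewrite /fmap/= gt.
have gg'2 : \forall u \near t^', g u = g' u by exact: cvg_within gg'.
by split; rewrite !near_simpl; apply: filterS2 gg'2 => u /= ->.
Qed.

Lemma metric_speed_cst x t : (forall x, d x x = 0) -> metric_speed d (fun=> x) t = 0.
Proof.
move=> d0; rewrite /metric_speed; under eq_fun do rewrite d0 mul0r.
exact: lim_cst.
Qed.

Lemma metric_speedE g t (l : R) : d (g u) (g t) / `|u - t| @[u --> t^'] --> l ->
  metric_speed d g t = l.
Proof. by move=> gl; apply/cvg_lim => //; exact: Rhausdorff. Qed.

(** If the limit defining the speed does not exist, the speed is 0 by
convention, so K must be nonnegative. *)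
Lemma metric_speed_lipschitz g t (K : R) : 0 <= K ->
  (forall u, d (g u) (g t) <= K * `|u - t|) -> metric_speed d g t <= K.
Proof.
move=> K0 gK; rewrite /metric_speed.
have [cv|/dvgP ->//] := pselect (cvg (d (g u) (g t) / `|u - t| @[u --> t^'])).
apply: limr_le => //; near=> u.
rewrite ler_pdivrMr// normr_gt0 subr_eq0.
by near: u; exact: nbhs_dnbhs_neq.
Unshelve. all: by end_near. Qed.

Hypotheses (d0 : forall x, d x x = 0) (dC : forall x y, d x y = d y x)
  (dD : forall x y z, d x z <= d x y + d y z).

(** The metric derivative of the path extended to the line by constants; at
the endpoints of [a, b] the extension may have a different speed, hence the
strict inequalities. *)
Lemma abs_continuous_path_speed g a b : abs_continuous_path d g a b ->
  exists m : R -> R, [/\ forall x, 0 <= m x, mu.-integrable setT (EFin \o m),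
    {ae mu, forall t, a < t < b -> d (g u) (g t) / `|u - t| @[u --> t^'] --> m t} &
    forall s t, a <= s -> s <= t -> t <= b ->
      d (g s) (g t) <= \int[mu]_(x in `]s, t]) m x].
Proof.
have d_ge0 x y : 0 <= d x y by have := dD x y x; rewrite d0 (dC y x); lra.
move=> /(abs_continuous_path_majorant d0 d_ge0 dD).
set w := fun t => _; move=> [ab acw dw].
have ndw s t : a <= s -> s <= t -> t <= b -> w s <= w t.
  by move=> as_ st tb; rewrite -subr_ge0 (le_trans _ (dw _ _ as_ st tb)).
have acW := clamp_globally_abs_continuous ab ndw acw.
have ca t : a <= clamp a b t by have /andP[] := clamp_itv t ab.
have cb t : clamp a b t <= b by have /andP[] := clamp_itv t ab.
have [||m [m0 intm cvgm dm]] := @metric_derivative _ _ d (g \o clamp a b) _ (w b - w a) d0 dC dD _ _ acW.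
- by move=> s t st; apply: dw => //; exact: clamp_nondecreasing.
- by move=> s t; rewrite lerB//= ndw.
exists m; split => //; last first.
  by move=> s t as_ st tb; have := dm _ _ st; rewrite /= !clamp_id// (le_trans as_, le_trans st).
have AE := ae_filter_ringOfSetsType mu.
apply: filterS cvgm => t + /andP[at_ tb].
have tE : clamp a b t = t by rewrite clamp_id// ltW.
rewrite /= tE; apply: cvg_trans; apply: near_eq_cvg.
have : \forall u \near t, u \in `]a, b[ by apply: near_in_itvoo; rewrite in_itv/= at_.
move=> H; have {}H : \forall u \near t^', u \in `]a, b[ by exact: cvg_within H.
apply: filterS H => u; rewrite in_itv/= => /andP[au ub].
by rewrite clamp_id// ltW.
Qed.

End MetricSpeed.

(** * Parametrization by arc length *)

Section ArcLength.
Context {R : realType} {T : Type}.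
Variable d : T -> T -> R.
Hypotheses (d0 : forall x, d x x = 0) (dC : forall x y, d x y = d y x)
  (dD : forall x y z, d x z <= d x y + d y z)
  (d_eq0 : forall x y, d x y = 0 -> x = y).

Let d_ge0 x y : 0 <= d x y.
Proof. by have := dD x y x; rewrite d0 (dC y x); lra. Qed.

Section Rectifiable.
Variables (g : R -> T) (a b : R).
Hypothesis gab : rectifiable d g a b.

Let v t := fine (path_length d g a t).

Let ab : a <= b. Proof. by have [[]] := gab. Qed.

Let abfin : (path_length d g a b < +oo)%E. Proof. by have [_] := gab. Qed.

Let v_incr t u : a <= t -> t <= u -> u <= b ->
  d (g t) (g u) <= v u - v t.
Proof. exact: dist_le_length_increment abfin. Qed.

Let dist_near t e : a <= t <= b -> 0 < e -> exists2 r, 0 < r &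
  forall u, a <= u <= b -> `|u - t| < r -> d (g t) (g u) < e.
Proof.
have [[_ cg] _] := gab; move=> tab e0.
have [|r r0 H] := cg t _ e e0; first by rewrite in_itv.
by exists r => // u uab; apply: H; rewrite in_itv.
Qed.

Let v_right_continuous t e : a <= t <= b -> 0 < e -> exists2 r, 0 < r &
  forall u, t <= u -> u <= b -> u - t < r -> v u - v t < e.
Proof.
move=> tab e0; have /andP[at_ tb] := tab.
move: tb; rewrite le_eqVlt => /predU1P[tb|tb].
  exists 1 => // u tu ub _; have -> : u = t by apply/eqP; rewrite eq_le tu tb ub.
  by rewrite subrr.
have e20 : 0 < e / 2 by rewrite divr_gt0.
have [_ ftb _] := fine_path_lengthB d0 d_ge0 dD abfin at_ (ltW tb) (lexx b).
have [_ [s tbs <-]] := ub_ereal_sup_adherent e20 ftb.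
rewrite -/(path_length d g t b) path_sumE; case: s tbs => [/itv_partition_nil tb'|t1 s tbs Hs].
  by move: tb; rewrite tb' ltxx.
have [/= /andP[tt1 t1s] lb] := tbs.
have [r r0 H] := dist_near tab e20.
exists (Num.min r (t1 - t)); first by rewrite lt_min r0 subr_gt0.
move=> u; rewrite le_eqVlt => /predU1P[<- _ _|tu ub]; first by rewrite subrr.
rewrite lt_min => /andP[utr]; rewrite ltrD2r => ut1.
have [_ ftu ->] := fine_path_lengthB d0 d_ge0 dD abfin at_ (ltW tu) ub.
have [_ fub _] := fine_path_lengthB d0 d_ge0 dD abfin (le_trans at_ (ltW tu)) ub (lexx b).
rewrite -lte_fin fineK// -(lteD2rE _ _ fub)//.
rewrite -(path_lengthD g d0 d_ge0 dD)// ?(ltW tu)//.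
move: Hs; rewrite lteBlDr// => /lt_le_trans; apply.
have ubs : itv_partition u b (t1 :: s) by split => //=; rewrite ut1.
have := polygon_length_le_path_length d g ubs => Hu.
rewrite [in leRHS](splitr e) (EFinD (e / 2)) addeAC leeD2r//.
apply: le_trans (leeD2l _ Hu); rewrite -EFinD lee_fin /= addrA lerD2r.
apply: (le_trans (dD _ (g u) _)); rewrite lerD2r ltW// H//.
  by rewrite (le_trans at_ (ltW tu)).
by rewrite gtr0_norm// subr_gt0.
Qed.

Let v_left_continuous t e : a <= t <= b -> 0 < e -> exists2 r, 0 < r &
  forall u, a <= u -> u <= t -> t - u < r -> v t - v u < e.
Proof.
move=> tab e0; have /andP[at_ tb] := tab.
move: at_; rewrite le_eqVlt => /predU1P[at_|at_].
  exists 1 => // u tu ub _; have -> : u = t by apply/eqP; rewrite eq_le ub -at_ tu.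
  by rewrite subrr.
have e20 : 0 < e / 2 by rewrite divr_gt0.
have [_ fat _] := fine_path_lengthB d0 d_ge0 dD abfin (lexx a) (ltW at_) tb.
have [_ [s ats <-]] := ub_ereal_sup_adherent e20 fat.
rewrite -/(path_length d g a t) path_sumE; case/lastP: s ats => [/itv_partition_nil tb'|s t1].
  by move: at_; rewrite tb' ltxx.
move=> [/=]; rewrite rcons_path last_rcons => /andP[as_ st1] /eqP t1t Hs; subst t1.
have [r r0 H] := dist_near tab e20.
exists (Num.min r (t - last a s)); first by rewrite lt_min r0 subr_gt0.
move=> u au; rewrite le_eqVlt => /predU1P[-> _|ut]; first by rewrite subrr.
rewrite lt_min => /andP[utr]; rewrite ltrD2l ltrN2 => su.
have [fau fut ->] := fine_path_lengthB d0 d_ge0 dD abfin au (ltW ut) tb.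
rewrite -lte_fin fineK// -(lteD2lE _ _ fau)//.
rewrite -(path_lengthD g d0 d_ge0 dD)// ?(ltW ut)//.
move: Hs; rewrite EFinN lteBlDr// => /lt_le_trans; apply.
have aus : itv_partition a u (rcons s u).
  by split => /=; rewrite ?rcons_path ?last_rcons// as_.
have := polygon_length_le_path_length d g aus => Hu.
rewrite [in leRHS](splitr e) (EFinD (e / 2)) addeA leeD2r//.
apply: le_trans (leeD2r _ Hu); rewrite -EFinD lee_fin /=.
rewrite -!cats1 !polygon_length_cat /= !addr0 -addrA lerD2l.
apply: (le_trans (dD _ (g u) _)); rewrite lerD2l dC ltW// H//.
  by rewrite au (le_trans (ltW ut)).
by rewrite distrC gtr0_norm// subr_gt0.
Qed.

Let v_clamp_continuous : continuous (v \o clamp a b).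
Proof.
move=> x; apply/cvgrPdist_lt => e e0.
have cab := clamp_itv x ab.
have [r1 r10 H1] := v_right_continuous cab e0.
have [r2 r20 H2] := v_left_continuous cab e0.
near=> y.
have xy1 : `|x - y| < r1 by near: y; apply: cvgr_dist_lt => //; exact: cvg_id.
have xy2 : `|x - y| < r2 by near: y; apply: cvgr_dist_lt => //; exact: cvg_id.
have /andP[ax xb] := cab; have /andP[ay yb] := clamp_itv y ab.
have vn s t : a <= s -> s <= t -> t <= b -> 0 <= v t - v s.
  by move=> as_ st tb; rewrite (le_trans _ (v_incr as_ st tb)).
rewrite /=; have [xy|/ltW yx] := leP x y.
  have cxy := clamp_nondecreasing a b xy.
  rewrite distrC ger0_norm ?vn// H1// (le_lt_trans (clamp_increment _ _ xy))//.
  by rewrite (le_lt_trans _ xy1)// distrC ler_norm.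
have cxy := clamp_nondecreasing a b yx.
rewrite ger0_norm ?vn// H2// (le_lt_trans (clamp_increment _ _ yx))//.
by rewrite (le_lt_trans _ xy2)// ler_norm.
Unshelve. all: by end_near. Qed.

(** The length function v of the path is continuous, so by the intermediate
value theorem each s in [0, v b] is the length of the path up to some time tau
s; then g \o tau is 1-Lipschitz, since distances are at most increments of
v. *)
Lemma arc_length_parametrization : exists c L, [/\ 0 <= L,
  L%:E = path_length d g a b, c 0 = g a, c L = g b &
  forall s t, d (c s) (c t) <= `|s - t|].
Proof.
have vE : (v b)%:E = path_length d g a b.
  by rewrite /v fineK// ge0_fin_numE// path_length_ge0.
have va : v a = 0.
  have [_ _] := fine_path_lengthB d0 d_ge0 dD abfin (lexx a) (lexx a) ab.
  by rewrite subrr.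
have L0 : 0 <= v b by rewrite -va -subr_ge0 (le_trans _ (v_incr _ ab _)).
have /choice[tau tauP] s : exists t, (a <= t <= b) /\ v t = clamp 0 (v b) s.
  have [||t tab vt] := @IVT R (v \o clamp a b) a b (clamp 0 (v b) s) ab.
  - exact: continuous_subspaceT.
  - have -> : (v \o clamp a b) a = 0 by rewrite /= clamp_id.
    have -> : (v \o clamp a b) b = v b by rewrite /= clamp_id.
    have /andP[c0 cL] := clamp_itv s L0.
    by rewrite ge_min c0/= le_max cL orbT.
  exists t; split; first by move: tab; rewrite in_itv.
  by move: tab vt; rewrite in_itv/= => /andP[at_ tb] <-; rewrite clamp_id.
exists (g \o tau), (v b); split => //.
- have [/andP[t0 tb]] := tauP 0; rewrite clamp_id// => vt0.
  apply/esym/d_eq0/eqP; rewrite eq_le d_ge0 andbT.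
  by rewrite (le_trans (v_incr _ t0 tb))// vt0 va subrr.
- have [/andP[t0 tb]] := tauP (v b); rewrite clamp_id// => vt0.
  apply/d_eq0/eqP; rewrite eq_le d_ge0 andbT.
  by rewrite (le_trans (v_incr _ tb _))// vt0 subrr.
- move=> s t; wlog st : s t / tau s <= tau t => [WH|].
    by case: (leP (tau s) (tau t)) => [|/ltW] st; [|rewrite /= dC distrC]; exact: WH.
  have [/andP[t1 t2] vs] := tauP s; have [/andP[t3 t4] vt] := tauP t.
  apply: (le_trans (v_incr _ st _)) => //; rewrite vs vt.
  have [st'|/ltW ts] := leP s t.
    by rewrite distrC (le_trans (clamp_increment _ _ st'))// ler_norm.
  have := clamp_nondecreasing 0 (v b) ts; rewrite -subr_le0 => /le_trans; apply.
  exact: normr_ge0.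
Qed.

End Rectifiable.

(** Working with 1-Lipschitz curves instead of rectifiable ones makes all
upper bounds for the warped distance elementary: such a curve is absolutely
continuous and its speed is at most 1. *)
Lemma lipschitz_curve x y e : length_space d -> 0 < e -> exists c L,
  [/\ 0 <= L, L < d x y + e, c 0 = x, c L = y &
    forall s t : R, d (c s) (c t) <= `|s - t|].
Proof.
move=> /(_ x y)[_ dxy] e0.
have : ((d x y)%:E < (d x y + e)%:E)%E by rewrite lte_fin ltrDl.
rewrite {1}dxy => /ereal_inf_lt[_ [g [a [b [[gab <- <-] ->]]]]] lt_e.
have [c [L [L0 LE c0 cL clip]]] := arc_length_parametrization gab.
by exists c, L; split => //; rewrite -lte_fin LE.
Qed.

End ArcLength.

(** * Concatenation of paths *)

Section AbsContinuousConcatenation.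
Context {R : realType}.
Local Notation mu := (@lebesgue_measure R).
Implicit Types (f w : R -> R) (a b c : R).

Lemma abs_continuous_fun_id a b : abs_continuous_fun (@idfun R) a b.
Proof.
move=> e e0; exists e => // n l u lu _; apply: le_lt_trans.
by apply: ler_sum => i _; have [_ lui _] := lu i; rewrite /= ger0_norm ?subr_ge0.
Qed.

Lemma lipschitz_abs_continuous_path (T : Type) (d : T -> T -> R) (g : R -> T) L :
  (forall x, d x x = 0) -> (forall x y, 0 <= d x y) ->
  (forall x y z, d x z <= d x y + d y z) -> 0 <= L ->
  (forall s t, d (g s) (g t) <= `|s - t|) -> abs_continuous_path d g 0 L.
Proof.
move=> d0 d_ge0 dD L0 glip.
apply: (majorant_abs_continuous_path d0 d_ge0 dD L0 (abs_continuous_fun_id 0 L)).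
move=> t u _ tu _; have := glip t u; have := glip u t.
by rewrite (distrC t u) ger0_norm ?subr_ge0.
Qed.

Lemma abs_continuous_fun_eq f f' a b : {in `[a, b], f =1 f'} ->
  abs_continuous_fun f a b -> abs_continuous_fun f' a b.
Proof.
move=> ff'; apply: (@abs_continuous_fun_dominated _ _ _ _ _ 1) => // t u at_ tu ub.
by rewrite mul1r !ff' // in_itv/= ?at_ ?ub ?(le_trans tu)// (le_trans at_).
Qed.

Lemma abs_continuous_fun_shift f a b c : abs_continuous_fun f a b ->
  abs_continuous_fun (fun t => f (t - c)) (a + c) (b + c).
Proof.
move=> acf e e0; have [r r0 H] := acf e e0; exists r => // n l u lu disj lur.
apply: (H n (fun i => l i - c) (fun i => u i - c)).
- by move=> i; have [? ? ?] := lu i; split; lra.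
- by move=> i j /disj; rewrite !lerD2r.
- by apply: le_lt_trans lur; apply: ler_sum => i _; rewrite opprB addrA subrK.
Qed.

(** Each interval is cut at b into two parts, one for each half; one of them
may be degenerate. *)
Lemma abs_continuous_fun_concat f a b c : a <= b -> b <= c ->
  abs_continuous_fun f a b -> abs_continuous_fun f b c ->
  abs_continuous_fun f a c.
Proof.
move=> ab bc ac1 ac2 e e0; have e20 : 0 < e / 2 by rewrite divr_gt0.
have [r1 r10 H1] := ac1 _ e20; have [r2 r20 H2] := ac2 _ e20.
exists (Num.min r1 r2) => [|n l u lu disj]; first by rewrite lt_min r10.
rewrite lt_min => /andP[lur1 lur2]; rewrite (splitr e).
have minE x y : x <= y -> Num.min y b - Num.min x b <= y - x.
  by move=> xy; rewrite /Num.min; case: (ltP y b); case: (ltP x b) => ? ?; lra.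
have maxE x y : x <= y -> Num.max y b - Num.max x b <= y - x.
  by move=> xy; rewrite /Num.max; case: (ltP y b); case: (ltP x b) => ? ?; lra.
have minn x y : x <= y -> Num.min x b <= Num.min y b.
  by move=> xy; rewrite le_min !ge_min lexx xy orbT.
have maxn x y : x <= y -> Num.max x b <= Num.max y b.
  by move=> xy; rewrite ge_max !le_max lexx xy orbT.
apply: (@le_lt_trans _ _ (\sum_(i < n) `|f (Num.min (u i) b) - f (Num.min (l i) b)| +
    \sum_(i < n) `|f (Num.max (u i) b) - f (Num.max (l i) b)|)).
  rewrite -big_split/=; apply: ler_sum => i _; have [al lui uc] := lu i.
  apply: le_trans (ler_normD _ _).
  rewrite le_eqVlt; apply/orP; left; apply/eqP; congr (`|_|).
  by case: (leP (u i) b); case: (leP (l i) b) => ? ?; ring.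
apply: ltrD.
  apply: H1 => [i|i j /disj[] ?|]; last 1 first.
  - by apply: le_lt_trans lur1; apply: ler_sum => i _; have [_ /minE] := lu i.
  - have [al lui uc] := lu i; split; [|exact: minn|by rewrite ge_min lexx orbT].
    by rewrite le_min al.
  - by left; exact: minn.
  - by right; exact: minn.
apply: H2 => [i|i j /disj[] ?|]; last 1 first.
- by apply: le_lt_trans lur2; apply: ler_sum => i _; have [_ /maxE] := lu i.
- have [al lui uc] := lu i; split; [by rewrite le_max lexx orbT|exact: maxn|].
  by rewrite ge_max uc.
- by left; exact: maxn.
- by right; exact: maxn.
Qed.

Section Concat.
Context {T : Type}.
Variable d : T -> T -> R.
Hypotheses (d0 : forall x, d x x = 0) (dC : forall x y, d x y = d y x)
  (dD : forall x y z, d x z <= d x y + d y z).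

(** The second path is translated in time, so that it starts at b instead of
c. *)
Definition concat_path (g1 g2 : R -> T) (b c t : R) : T :=
  if t <= b then g1 t else g2 (t - (b - c)).

(** The majorants of the two paths are joined continuously at b by adding a
constant to the second one. *)
Lemma abs_continuous_path_concat g1 g2 a b c e :
  abs_continuous_path d g1 a b -> abs_continuous_path d g2 c e -> g1 b = g2 c ->
  abs_continuous_path d (concat_path g1 g2 b c) a (e + (b - c)).
Proof.
have d_ge0 x y : 0 <= d x y by have := dD x y x; rewrite d0 (dC y x); lra.
move=> /(abs_continuous_path_majorant d0 d_ge0 dD); set w1 := fun t => _.
move=> [ab ac1 dw1].
move=> /(abs_continuous_path_majorant d0 d_ge0 dD); set w2 := fun t => _.
move=> [ce ac2 dw2] g12.
pose w t := if t <= b then w1 t else w1 b - w2 c + w2 (t - (b - c)).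
have be : b <= e + (b - c) by lra.
have wb : w1 b - w2 c + w2 (b - (b - c)) = w b.
  by rewrite /w lexx (_ : b - (b - c) = c); ring.
have wE t : b <= t -> w t = w1 b - w2 c + w2 (t - (b - c)).
  rewrite le_eqVlt => /predU1P[<-|bt]; first by rewrite wb.
  by rewrite /w leNgt bt.
have acw : abs_continuous_fun w a (e + (b - c)).
  apply: (@abs_continuous_fun_concat _ _ b) => //.
    apply: abs_continuous_fun_eq ac1 => t; rewrite in_itv/= => /andP[_ tb].
    by rewrite /w tb.
  have := @abs_continuous_fun_shift _ _ _ (b - c) ac2.
  rewrite (_ : c + (b - c) = b); last by ring.
  apply: (@abs_continuous_fun_dominated _ _ _ _ _ 1) => // t u bt tu ub.
  rewrite mul1r !wE ?(le_trans bt)//.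
  by rewrite le_eqVlt; apply/orP; left; apply/eqP; congr (`|_|); ring.
have dw t u : a <= t -> t <= u -> u <= e + (b - c) ->
    d (concat_path g1 g2 b c t) (concat_path g1 g2 b c u) <= w u - w t.
  move=> at_ tu ub; rewrite /concat_path.
  case: (leP u b) => bu.
    by rewrite (le_trans tu bu) /w bu (le_trans tu bu) dw1.
  have key v : b <= v -> v <= u -> d (g2 (v - (b - c))) (g2 (u - (b - c))) <= w u - w v.
    move=> bv vu; rewrite !wE ?(ltW bu)//.
    rewrite [leRHS](_ : _ = w2 (u - (b - c)) - w2 (v - (b - c))); last by ring.
    by apply: dw2; lra.
  case: (leP t b) => tb; last by apply: key => //; exact: ltW.
  have := key b (lexx _) (ltW bu).
  rewrite (_ : b - (b - c) = c); last by ring.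
  rewrite -g12 => H; apply: (le_trans (dD _ (g1 b) _)).
  have := dw1 t b at_ tb (lexx _).
  have -> : w t = w1 t by rewrite /w tb.
  by move: H; have -> : w b = w1 b by [rewrite /w lexx]; lra.
apply: (majorant_abs_continuous_path d0 d_ge0 dD _ acw) => [|t u at_ tu ub].
  exact: le_trans be.
by split; [|rewrite dC]; exact: dw.
Qed.

(** The limit is taken over a punctured neighbourhood, which is translated by
k. *)
Lemma metric_speed_shift (g : R -> T) k t :
  metric_speed d (fun t => g (t - k)) t = metric_speed d g (t - k).
Proof.
rewrite /metric_speed; congr (lim _); apply/funext => A; apply/propext.
rewrite /fmap/=; split => -[r /= r0 H]; exists r => //= u.
  rewrite /ball_/= => tu ut; have := H (u + k).
  rewrite /ball_/= addrK (_ : u + k - t = u - (t - k)); last by ring.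
  apply; first by rewrite (_ : t - (u + k) = t - k - u) //; ring.
  by apply: contra_neq ut => <-; rewrite addrK.
rewrite /ball_/= => tu ut; have := H (u - k).
rewrite /ball_/= (_ : u - k - (t - k) = u - t); last by ring.
apply; first by rewrite (_ : t - k - (u - k) = t - u) //; ring.
by apply: contra_neq ut => /addIr.
Qed.

Lemma metric_speed_concat_left g1 g2 b c t : t < b ->
  metric_speed d (concat_path g1 g2 b c) t = metric_speed d g1 t.
Proof.
move=> tb; apply: metric_speed_near.
have : \forall u \near t, u \in `]-oo, b[ by apply: near_in_itvNyo; rewrite in_itv.
by apply: filterS => u; rewrite in_itv/= /concat_path => /ltW ->.
Qed.

Lemma metric_speed_concat_right g1 g2 b c t : b < t ->
  metric_speed d (concat_path g1 g2 b c) t = metric_speed d g2 (t - (b - c)).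
Proof.
move=> bt; rewrite -metric_speed_shift; apply: metric_speed_near.
have : \forall u \near t, u \in `]b, +oo[ by apply: near_in_itvoy; rewrite in_itv/= bt.
by apply: filterS => u; rewrite in_itv/= andbT /concat_path leNgt => ->.
Qed.

End Concat.

Lemma ae_neq_lebesgue (a : R) : {ae mu, forall t, t != a}.
Proof.
exists [set a]; split => //; first exact: lebesgue_measure_set1.
by move=> t /= /negP; rewrite negbK => /eqP.
Qed.

(** The increments of the path are at most the integral of m, which is its
speed off the endpoints of [a, b]. As F need not be measurable, the comparison
with F is one of lower integrals. *)
Lemma speed_integral_ge (T : Type) (d : T -> T -> R) (g : R -> T) a b (F : R -> R) (K : R) :
  (forall x, d x x = 0) -> (forall x y, d x y = d y x) ->
  (forall x y z, d x z <= d x y + d y z) ->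
  abs_continuous_path d g a b -> 0 <= K -> (forall t, 0 <= F t) ->
  (forall t, a <= t <= b -> K * metric_speed d g t <= F t) ->
  forall s t, a <= s -> s <= t -> t <= b ->
  ((K * d (g s) (g t))%:E <= \int[mu]_(x in `[a, b]) (F x)%:E)%E.
Proof.
move=> d0 dC dD acg K0 F0 KF s t as_ st tb.
have [m [m0 intm cvgm dm]] := abs_continuous_path_speed d0 dC dD acg.
have intst : mu.-integrable `]s, t] (EFin \o m) by exact: integrableS intm.
apply: (@le_trans _ _ (\int[mu]_(x in `]s, t]) (K%:E * (m x)%:E))%E).
  rewrite ge0_integralZl//; last 2 first.
  - by have /integrableP[] := intst.
  - by move=> x _; rewrite lee_fin.
  rewrite EFinM; apply: lee_wpmul2l; first by rewrite lee_fin.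
  by have := dm _ _ as_ st tb; rewrite -lee_fin /Rintegral fineK// integrable_fin_num.
have sub : `]s, t]%classic `<=` `[a, b]%classic.
  by apply: subset_itv; rewrite bnd_simp.
rewrite -(setIidr sub) integral_mkcondr.
have AE := ae_filter_ringOfSetsType mu.
apply: ae_le_lower_integral => [x _|x _|].
- by apply: erestrict_ge0 => y _; rewrite mule_ge0 ?lee_fin.
- by rewrite lee_fin.
apply: filterS3 cvgm (ae_neq_lebesgue a) (ae_neq_lebesgue b) => x mx xa xb /=.
rewrite in_itv/= => /andP[ax xb'].
rewrite patchE; case: ifPn => _; last by rewrite lee_fin.
rewrite -EFinM lee_fin -(metric_speedE (mx _)); last first.
  by rewrite !lt_neqAle ax xb' xb eq_sym xa.
by rewrite KF// ax.
Qed.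

End AbsContinuousConcatenation.

(** * The warped distance *)

Section PlaneNormTheory.
Context {R : realType}.
Variable N : R * R -> R.
Hypotheses (normN : is_norm N) (unitN : unitary N) (incrN : coordinate_increasing N).
Implicit Types a b : R.

Lemma plane_norm0r a : 0 <= a -> N (a, 0) = a.
Proof.
move=> a0; have [_ /(_ a 1 0) + _] := normN; have [-> _] := unitN.
by rewrite !mulr1 mulr0 ger0_norm.
Qed.

Lemma plane_norm0l b : 0 <= b -> N (0, b) = b.
Proof.
move=> b0; have [_ /(_ b 0 1) + _] := normN; have [_ ->] := unitN.
by rewrite !mulr1 mulr0 ger0_norm.
Qed.

(** Coordinate monotonicity, compared with the norm of (a, 0). *)
Lemma plane_norm_ge_fst a b : 0 <= a -> 0 <= b -> a <= N (a, b).
Proof. by move=> a0 b0; rewrite -{1}(plane_norm0r a0); apply: incrN; rewrite lexx ?a0. Qed.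

Lemma plane_norm_ge_snd a b : 0 <= a -> 0 <= b -> b <= N (a, b).
Proof. by move=> a0 b0; rewrite -{1}(plane_norm0l b0); apply: incrN; rewrite lexx ?b0. Qed.

End PlaneNormTheory.

Section WarpedDistance.
Context {R : realType} {X Y : pmetricType R}.
Variables (N : R * R -> R) (phi : X -> R).
Hypotheses (lenX : length_space (@mdist R X)) (lenY : length_space (@mdist R Y)).
Hypotheses (normN : is_norm N) (unitN : unitary N) (incrN : coordinate_increasing N).
Hypotheses (phi_ge0 : forall x, 0 <= phi x) (phi_cont : continuous phi).
Local Notation mu := (@lebesgue_measure R).
Local Notation dX := (@mdist R X).
Local Notation dY := (@mdist R Y).
Local Notation l1 := (@l1_dist R X Y).
Local Notation wlen := (warped_length N phi).
Local Notation pd := (warped_pseudodist N phi).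
Implicit Types (g : R -> X * Y) (z w v : X * Y) (x : X) (y : Y) (a b c e s t : R).

Lemma l1_distxx z : l1 z z = 0. Proof. by rewrite /l1_dist !mdistxx addr0. Qed.

Lemma l1_distC z w : l1 z w = l1 w z.
Proof. by rewrite /l1_dist metric_sym (metric_sym z.2). Qed.

Lemma l1_distD z w v : l1 z v <= l1 z w + l1 w v.
Proof. by rewrite /l1_dist addrACA lerD// metric_triangle. Qed.

Lemma l1_dist_ge0 z w : 0 <= l1 z w.
Proof. by rewrite addr_ge0// mdist_ge0. Qed.

Lemma mdist_le_l1_fst z w : dX z.1 w.1 <= l1 z w.
Proof. by rewrite lerDl mdist_ge0. Qed.

Lemma mdist_le_l1_snd z w : dY z.2 w.2 <= l1 z w.
Proof. by rewrite lerDr mdist_ge0. Qed.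

Lemma abs_continuous_path_fst g a b : abs_continuous_path l1 g a b ->
  abs_continuous_path dX (fst \o g) a b.
Proof.
move=> /(abs_continuous_path_majorant l1_distxx l1_dist_ge0 l1_distD).
set w := fun t => _; move=> [ab acw dw].
apply: (majorant_abs_continuous_path (@mdistxx R X) (@mdist_ge0 R X) (@metric_triangle R X) ab acw).
move=> t u at_ tu ub; rewrite [mdist ((fst \o g) u) _]metric_sym.
by split; exact: le_trans (mdist_le_l1_fst _ _) (dw _ _ at_ tu ub).
Qed.

Lemma abs_continuous_path_snd g a b : abs_continuous_path l1 g a b ->
  abs_continuous_path dY (snd \o g) a b.
Proof.
move=> /(abs_continuous_path_majorant l1_distxx l1_dist_ge0 l1_distD).
set w := fun t => _; move=> [ab acw dw].
apply: (majorant_abs_continuous_path (@mdistxx R Y) (@mdist_ge0 R Y) (@metric_triangle R Y) ab acw).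
move=> t u at_ tu ub; rewrite [mdist ((snd \o g) u) _]metric_sym.
by split; exact: le_trans (mdist_le_l1_snd _ _) (dw _ _ at_ tu ub).
Qed.

Definition warped_speed g t := N (metric_speed dX (fst \o g) t,
  phi (g t).1 * metric_speed dY (snd \o g) t).

Let speedX_ge0 (g : R -> X) t : 0 <= metric_speed dX g t.
Proof. by apply: metric_speed_ge0 => *; exact: mdist_ge0. Qed.

Let speedY_ge0 (g : R -> Y) t : 0 <= metric_speed dY g t.
Proof. by apply: metric_speed_ge0 => *; exact: mdist_ge0. Qed.

Lemma warped_speed_ge0 g t : 0 <= warped_speed g t.
Proof.
apply: le_trans (plane_norm_ge_fst normN unitN incrN _ _) => //.
by rewrite mulr_ge0.
Qed.

Lemma warped_length_ge_fst g a b s t : abs_continuous_path l1 g a b ->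
  a <= s -> s <= t -> t <= b -> ((dX (g s).1 (g t).1)%:E <= wlen g a b)%E.
Proof.
move=> acg as_ st tb; rewrite -[dX _ _]mul1r.
apply: (@speed_integral_ge R X dX (fst \o g) a b (warped_speed g) 1) => //.
- exact: mdistxx.
- exact: metric_sym.
- exact: metric_triangle.
- exact: abs_continuous_path_fst.
- exact: warped_speed_ge0.
- by move=> u _; rewrite mul1r; apply: plane_norm_ge_fst => //; rewrite mulr_ge0.
Qed.

(** The vertical speed is weighted by phi, which is at least K along the
path. *)
Lemma warped_length_ge_snd g a b K : abs_continuous_path l1 g a b ->
  0 <= K -> (forall t, a <= t <= b -> K <= phi (g t).1) ->
  ((K * dY (g a).2 (g b).2)%:E <= wlen g a b)%E.
Proof.
move=> acg K0 Kphi; have [[[ab _] _] _] := acg.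
apply: (@speed_integral_ge R Y dY (snd \o g) a b (warped_speed g) K) => //.
- exact: mdistxx.
- exact: metric_sym.
- exact: metric_triangle.
- exact: abs_continuous_path_snd.
- exact: warped_speed_ge0.
- move=> u abu; apply: le_trans (plane_norm_ge_snd normN unitN incrN _ _) => //.
    by rewrite ler_wpM2r// Kphi.
  by rewrite mulr_ge0.
Qed.

Lemma warped_length_ge0 g a b : (0 <= wlen g a b)%E.
Proof. by apply: integral_ge0 => t _; rewrite lee_fin warped_speed_ge0. Qed.

Lemma warped_pseudodist_ge0 z w : (0 <= pd z w)%E.
Proof.
by apply: le_ereal_inf_tmp => _ [g [a [b [_ _ _ ->]]]]; exact: warped_length_ge0.
Qed.

Lemma warped_pseudodist_ge_fst z w : ((dX z.1 w.1)%:E <= pd z w)%E.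
Proof.
apply: le_ereal_inf_tmp => _ [g [a [b [acg <- <- ->]]]].
have [[[ab _] _] _] := acg.
exact: (warped_length_ge_fst acg).
Qed.

Lemma warped_pseudodist_ge_snd z w K : 0 <= K -> (forall x, K <= phi x) ->
  ((K * dY z.2 w.2)%:E <= pd z w)%E.
Proof.
move=> K0 Kphi; apply: le_ereal_inf_tmp => _ [g [a [b [acg <- <- ->]]]].
exact: (warped_length_ge_snd acg).
Qed.

(** Let r be such that phi is at least phi z.1 / 2 on the ball of radius r
around z.1. A path from z to w either leaves this ball and has length at least
r, or stays in it and has length at least phi z.1 / 2 times the distance of
the second coordinates. *)
Lemma warped_pseudodist_eq0 z w : 0 < phi z.1 -> pd z w = 0%E -> z = w.
Proof.
move=> phiz zw0.
have zw1 : z.1 = w.1.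
  apply: mdist_positivity; apply/eqP; rewrite eq_le mdist_ge0 andbT.
  by have := warped_pseudodist_ge_fst z w; rewrite zw0 lee_fin.
have phi2 : 0 < phi z.1 / 2 by rewrite divr_gt0.
have /cvgrPdist_lt/(_ _ phi2) := @phi_cont z.1.
rewrite -nbhs_ballE => -[r /= r0 Hr].
apply: contrapT => /eqP zw.
have zw2 : z.2 != w.2.
  by apply: contra_neq zw => zw2; case: z w zw1 zw2 {zw0 phiz phi2 Hr} => [? ?] [? ?] /= -> ->.
have d0 : 0 < dY z.2 w.2 by rewrite mdist_gt0.
(* A path either leaves the ball of radius r, or stays where phi is large. *)
pose m := Num.min r (phi z.1 / 2 * dY z.2 w.2).
have m0 : 0 < m by rewrite lt_min r0 mulr_gt0.
suff : (m%:E <= pd z w)%E by rewrite zw0 lee_fin leNgt m0.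
apply: le_ereal_inf_tmp => _ [g [a [b [acg ga gb ->]]]].
have [[[ab _] _] _] := acg.
have [[t [/andP[at_ tb] dt]]|far] := pselect (exists t, (a <= t <= b) /\ r <= dX z.1 (g t).1).
  apply: le_trans (warped_length_ge_fst acg (lexx a) at_ tb).
  by rewrite ga lee_fin ge_min dt.
apply: le_trans (warped_length_ge_snd acg (ltW phi2) _).
  by rewrite ga gb lee_fin ge_min lexx orbT.
move=> t abt; have : ball z.1 r (g t).1.
  by rewrite ballEmdist/= ltNge; apply/negP => H; apply: far; exists t.
by move/Hr => /=; rewrite ltr_norml => /andP[_]; lra.
Qed.

(** The integrands need not be measurable, so the interval is split by
subadditivity of the lower integral. *)
Lemma warped_length_concat g1 g2 a b c e :
  abs_continuous_path l1 g1 a b -> abs_continuous_path l1 g2 c e ->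
  (wlen (concat_path g1 g2 b c) a (e + (b - c)) <= wlen g1 a b + wlen g2 c e)%E.
Proof.
move=> [[[ab _] _] _] [[[ce _] _] _].
pose G := concat_path g1 g2 b c.
have AE := ae_filter_ringOfSetsType mu.
have be : b <= e + (b - c) by lra.
rewrite /warped_length (_ : `[a, e + (b - c)]%classic = `[a, b]%classic `|` `[b, e + (b - c)]%classic); last first.
  apply/seteqP; split => t /=; rewrite !in_itv/=.
    by move=> /andP[-> ->]; case: (leP t b) => [_|/ltW ->]; [left|right].
  by move=> [] /andP[H1 H2]; rewrite ?H1 ?H2 ?(le_trans H2)// (le_trans ab).
apply: le_trans (lower_integral_setU _ _ _ _) _ => //.
  by move=> t _; rewrite lee_fin; exact: warped_speed_ge0.
apply: leeD.
  apply: ae_le_lower_integral => [t _|t _|].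
  - by rewrite lee_fin; exact: warped_speed_ge0.
  - by rewrite lee_fin; exact: warped_speed_ge0.
  apply: filterS (ae_neq_lebesgue b) => t tb; rewrite /= in_itv/= => /andP[at_ tb'].
  have ltb : t < b by rewrite lt_neqAle tb.
  have fstE : fst \o G = concat_path (fst \o g1) (fst \o g2) b c.
    by apply/funext => u; rewrite /G /concat_path/=; case: ifP.
  have sndE : snd \o G = concat_path (snd \o g1) (snd \o g2) b c.
    by apply/funext => u; rewrite /G /concat_path/=; case: ifP.
  by rewrite -/G fstE sndE !metric_speed_concat_left// /G /concat_path tb'.
rewrite {1}(_ : b = c + (b - c)); last by ring.
apply: le_trans (lower_integral_shift c e (b - c) (f := fun t => (warped_speed g2 t)%:E) _); last first.
  by move=> t; rewrite lee_fin; exact: warped_speed_ge0.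
apply: ae_le_lower_integral => [t _|t _|].
- by rewrite lee_fin; exact: warped_speed_ge0.
- by rewrite lee_fin; exact: warped_speed_ge0.
apply: filterS (ae_neq_lebesgue b) => t tb; rewrite /= in_itv/= => /andP[bt te].
have ltb : b < t by rewrite lt_neqAle eq_sym tb; move: bt; rewrite addrC subrK.
have fstE : fst \o G = concat_path (fst \o g1) (fst \o g2) b c.
  by apply/funext => u; rewrite /G /concat_path/=; case: ifP.
have sndE : snd \o G = concat_path (snd \o g1) (snd \o g2) b c.
  by apply/funext => u; rewrite /G /concat_path/=; case: ifP.
by rewrite -/G fstE sndE !metric_speed_concat_right// /G /concat_path (leNgt t b) ltb.
Qed.

Lemma warped_pseudodist_triangle z w v : (pd z v <= pd z w + pd w v)%E.
Proof.
have [->|] := eqVneq (pd z w) +oo%E.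
  by rewrite addye ?leey// gt_eqF// (lt_le_trans _ (warped_pseudodist_ge0 _ _)).
rewrite -ltey -ge0_fin_numE ?warped_pseudodist_ge0// => zwfin.
have [->|] := eqVneq (pd w v) +oo%E.
  by rewrite addey ?leey// gt_eqF// (lt_le_trans _ (warped_pseudodist_ge0 _ _)).
rewrite -ltey -ge0_fin_numE ?warped_pseudodist_ge0// => wvfin.
apply/lee_addgt0Pr => e e0; have e20 : 0 < e / 2 by rewrite divr_gt0.
have [_ [g1 [a [b [ac1 g1a g1b ->]]]] lt1] := lb_ereal_inf_adherent e20 zwfin.
have [_ [g2 [c [e' [ac2 g2c g2e ->]]]] lt2] := lb_ereal_inf_adherent e20 wvfin.
apply: (@le_trans _ _ (wlen (concat_path g1 g2 b c) a (e' + (b - c)))).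
  apply: ereal_inf_lbound; exists (concat_path g1 g2 b c), a, (e' + (b - c)); split => //.
  - by apply: abs_continuous_path_concat; rewrite ?g1b//; [exact: l1_distxx|exact: l1_distC|exact: l1_distD].
  - by have [[[ab _] _] _] := ac1; rewrite /concat_path ab.
  - have [[[ce _] _] _] := ac2; rewrite /concat_path.
    rewrite (_ : e' + (b - c) - (b - c) = e'); last by ring.
    case: leP => // eb; have ec : e' = c by lra.
    by rewrite ec (_ : c + (b - c) = b) ?g1b -?g2c -?g2e ?ec//; ring.
apply: (le_trans (warped_length_concat ac1 ac2)).
apply: le_trans (leeD (ltW lt1) (ltW lt2)) _.
by rewrite addeACA -EFinD -splitr.
Qed.

Lemma warped_pseudodist_lipschitz g L K : 0 <= L -> 0 <= K ->
  (forall s t, l1 (g s) (g t) <= `|s - t|) ->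
  (forall t, warped_speed g t <= K) -> (pd (g 0%R) (g L) <= (K * L)%:E)%E.
Proof.
move=> L0 K0 glip gK.
apply: (@le_trans _ _ (wlen g 0 L)).
  apply: ereal_inf_lbound; exists g, 0, L; split => //.
  exact: (lipschitz_abs_continuous_path l1_distxx l1_dist_ge0 l1_distD L0).
apply: (@le_trans _ _ (\int[mu]_(t in `[0%R, L]) K%:E)%E).
  apply: ae_le_lower_integral => [t _|t _|].
  - by rewrite lee_fin; exact: warped_speed_ge0.
  - by rewrite lee_fin.
  - by apply: aeW => t _; rewrite lee_fin; exact: gK.
rewrite integral_cst//= lebesgue_measure_itv/= lte_fin.
by case: ifPn => _; rewrite ?sube0// mule0 lee_fin mulr_ge0.
Qed.

Lemma warped_pseudodist_horizontal x x' y : (pd (x, y) (x', y) <= (dX x x')%:E)%E.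
Proof.
apply/lee_addgt0Pr => e e0; rewrite -EFinD.
have [c [L [L0 Le c0 cL clip]]] := lipschitz_curve (@mdistxx R X) (@metric_sym R X)
  (@metric_triangle R X) (@mdist_positivity R X) x x' lenX e0.
have := @warped_pseudodist_lipschitz (fun t => (c t, y)) L 1 L0 ler01.
rewrite /= c0 cL mul1r => H; apply: le_trans (H _ _) _.
- by move=> s t; rewrite /l1_dist/= mdistxx addr0.
- move=> t; rewrite /warped_speed (metric_speed_cst y t (@mdistxx R Y)) mulr0.
  rewrite plane_norm0r//; apply: metric_speed_lipschitz => // u.
  by rewrite mul1r.
- by rewrite lee_fin ltW.
Qed.

Lemma warped_pseudodist_vertical x y y' :
  (pd (x, y) (x, y') <= (phi x * dY y y')%:E)%E.
Proof.
apply/lee_addgt0Pr => e e0; rewrite -EFinD.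
have e'0 : 0 < e / (phi x + 1) by rewrite divr_gt0// ltr_wpDl.
have [c [L [L0 Le c0 cL clip]]] := lipschitz_curve (@mdistxx R Y) (@metric_sym R Y)
  (@metric_triangle R Y) (@mdist_positivity R Y) y y' lenY e'0.
have := @warped_pseudodist_lipschitz (fun t => (x, c t)) L (phi x) L0 (phi_ge0 x).
rewrite /= c0 cL => H; apply: le_trans (H _ _) _.
- by move=> s t; rewrite /l1_dist/= mdistxx add0r.
- move=> t; rewrite /warped_speed (metric_speed_cst x t (@mdistxx R X)).
  rewrite plane_norm0l ?mulr_ge0// -[leRHS]mulr1 ler_wpM2l//.
  by apply: metric_speed_lipschitz => // u; rewrite mul1r.
- rewrite lee_fin (le_trans (ler_wpM2l (phi_ge0 x) (ltW Le)))// mulrDr lerD2l.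
  rewrite mulrA ler_pdivrMr ?ltr_wpDl// mulrC.
  by rewrite ler_pM2l// lerDl.
Qed.

(** Move horizontally to x1, then vertically, then horizontally to x'. *)
Lemma warped_pseudodist_le x x' x1 y y' :
  (pd (x, y) (x', y') <= (dX x x1 + phi x1 * dY y y' + dX x1 x')%:E)%E.
Proof.
apply: (le_trans (warped_pseudodist_triangle _ (x1, y) _)).
rewrite -addrA EFinD; apply: leeD; first exact: warped_pseudodist_horizontal.
apply: (le_trans (warped_pseudodist_triangle _ (x1, y') _)).
rewrite EFinD; apply: leeD; first exact: warped_pseudodist_vertical.
exact: warped_pseudodist_horizontal.
Qed.

Lemma warped_pseudodist_fin z w : pd z w \is a fin_num.
Proof.
rewrite ge0_fin_numE ?warped_pseudodist_ge0//.
case: z w => x y [x' y']; apply: le_lt_trans (warped_pseudodist_le x x' x y y') _.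
exact: ltry.
Qed.

Local Notation P := (@warped_proj R X Y N phi).
Local Notation wd := (@warped_dist R X Y N phi).

(** The equivalence is generated by pairs at pseudodistance 0; such pairs have
the same first coordinate, and are equal where phi is positive. Both
properties survive the closure. *)
Lemma warped_proj_eq z w : P z = P w -> z.1 = w.1 /\ (0 < phi z.1 -> z = w).
Proof.
move=> /eqmodP/asboolP; elim => {z w}[z w zw0|z|z w _ [zw1 zw]|z w v _ [zw1 zw] _ [wv1 wv]].
- split; last by move=> phiz; exact: warped_pseudodist_eq0.
  apply: mdist_positivity; apply/eqP; rewrite eq_le mdist_ge0 andbT.
  by have := warped_pseudodist_ge_fst z w; rewrite zw0 lee_fin.
- by [].
- by split => // phiw; rewrite zw// zw1.
- split=> [|phiz]; first by rewrite zw1.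
  by rewrite zw// wv// -zw1.
Qed.

Lemma repr_warped_proj z : (repr (P z)).1 = z.1 /\ (0 < phi z.1 -> repr (P z) = z).
Proof.
have [e1 e2] := @warped_proj_eq z (repr (P z)) (esym (reprK _)).
by split => // /e2.
Qed.

Lemma warped_proj_surj (Q : warped_product N phi) : exists z, Q = P z.
Proof. by exists (repr Q); rewrite /warped_proj reprK. Qed.

(** Representatives are unique where phi is positive, so no choice is
involved. *)
Lemma warped_distE z w : 0 < phi z.1 -> 0 < phi w.1 -> wd (P z) (P w) = fine (pd z w).
Proof.
by move=> /(repr_warped_proj z).2 zE /(repr_warped_proj w).2 wE; rewrite /warped_dist zE wE.
Qed.

Lemma warped_dist_triangle Q1 Q2 Q3 : wd Q1 Q3 <= wd Q1 Q2 + wd Q2 Q3.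
Proof.
rewrite /warped_dist -fineD ?warped_pseudodist_fin// fine_le ?warped_pseudodist_fin//.
  by rewrite fin_numD !warped_pseudodist_fin.
exact: warped_pseudodist_triangle.
Qed.

Lemma warped_dist_ge0 Q1 Q2 : 0 <= wd Q1 Q2.
Proof. by rewrite fine_ge0// warped_pseudodist_ge0. Qed.

(** The first coordinate does not depend on the representative. *)
Lemma warped_dist_ge_fst z w : dX z.1 w.1 <= wd (P z) (P w).
Proof.
rewrite -(repr_warped_proj z).1 -(repr_warped_proj w).1 -lee_fin fineK ?warped_pseudodist_fin//.
exact: warped_pseudodist_ge_fst.
Qed.

(** The distance is computed at chosen representatives of the classes, which
keep the first coordinate but may change the second one where phi vanishes;
there the vertical distance is irrelevant, since vertical moves are free. *)
Lemma warped_dist_le x x' x1 y y' :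
  wd (P (x, y)) (P (x', y')) <= dX x x1 + phi x1 * dY y y' + dX x1 x'.
Proof.
have zero x0 x0' y0 y0' : phi x0 = 0 \/ phi x0' = 0 ->
    (pd (x0, y0) (x0', y0') <= (dX x0 x0')%:E)%E.
  move=> [p0|p0].
    by have := warped_pseudodist_le x0 x0' x0 y0 y0'; rewrite p0 mul0r mdistxx !add0r.
  by have := warped_pseudodist_le x0 x0' x0' y0 y0'; rewrite p0 mul0r mdistxx !addr0.
have [e1 e2] := repr_warped_proj (x, y); have [e1' e2'] := repr_warped_proj (x', y').
rewrite -lee_fin fineK ?warped_pseudodist_fin//.
move: (repr _) (repr _) e1 e2 e1' e2' => [a b] [a' b'] /= -> e2 -> e2'.
have [p0|p0] := eqVneq (phi x) 0.
  apply: le_trans (zero _ _ _ _ (or_introl p0)) _; rewrite lee_fin.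
  apply: (le_trans (metric_triangle _ x1 _)).
  by rewrite lerD2r lerDl mulr_ge0 ?mdist_ge0.
have [p0'|p0'] := eqVneq (phi x') 0.
  apply: le_trans (zero _ _ _ _ (or_intror p0')) _; rewrite lee_fin.
  apply: (le_trans (metric_triangle _ x1 _)).
  by rewrite lerD2r lerDl mulr_ge0 ?mdist_ge0.
rewrite (e2 _) ?(e2' _) ?lt0r ?p0 ?p0' ?phi_ge0//.
exact: warped_pseudodist_le.
Qed.

(** The lower bound is the projection to X, the upper bound the horizontal
curves. *)
Lemma warped_dist_horizontal x x' y : wd (P (x, y)) (P (x', y)) = dX x x'.
Proof.
apply/eqP; rewrite eq_le; apply/andP; split; last exact: (warped_dist_ge_fst (x, y) (x', y)).
by have := warped_dist_le x x' x y y; rewrite !mdistxx mulr0 !add0r.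
Qed.

Lemma warped_dist_vertical x y y' : wd (P (x, y)) (P (x, y')) <= phi x * dY y y'.
Proof. by have := warped_dist_le x x x y y'; rewrite !mdistxx add0r addr0. Qed.

Lemma warped_dist_ge_snd z w K : 0 < K -> (forall x, K <= phi x) ->
  K * dY z.2 w.2 <= wd (P z) (P w).
Proof.
move=> K0 Kphi; rewrite warped_distE ?(lt_le_trans K0)//.
rewrite -lee_fin fineK ?warped_pseudodist_fin//.
by apply: warped_pseudodist_ge_snd => //; exact: ltW.
Qed.

End WarpedDistance.

(** * Upper gradients of slices *)

Section BorelType.
Context {R : realType} {T : pointedType}.
Variable d : T -> T -> R.

Lemma measurable_to_borel_type disp (S : measurableType disp) (f : S -> borel_type d) :
  (forall U, dopen d U -> measurable (f @^-1` U)) -> measurable_fun setT f.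
Proof.
move=> H; apply: (@measurability _ _ _ _ setT f (dopen d)) => //.
by move=> _ [U oU <-]; rewrite setTI; exact: H.
Qed.

Lemma dopen_borel U : dopen d U -> measurable (U : set (borel_type d)).
Proof. by move=> oU; exact: sub_sigma_algebra. Qed.

End BorelType.

Section LipschitzImage.
Context {R : realType} {T T' : Type}.
Variables (d : T -> T -> R) (d' : T' -> T' -> R).
Hypotheses (d0 : forall x, d x x = 0) (dC : forall x y, d x y = d y x)
  (dD : forall x y z, d x z <= d x y + d y z).
Hypotheses (d'0 : forall x, d' x x = 0) (d'_ge0 : forall x y, 0 <= d' x y)
  (d'D : forall x y z, d' x z <= d' x y + d' y z).

(** K times a majorant of g is a majorant of g'. *)
Lemma abs_continuous_path_lipschitz_image (g : R -> T) (g' : R -> T') a b K :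
  0 <= K -> (forall s t, d' (g' s) (g' t) <= K * d (g s) (g t)) ->
  abs_continuous_path d g a b -> abs_continuous_path d' g' a b.
Proof.
have d_ge0 x y : 0 <= d x y by have := dD x y x; rewrite d0 (dC y x); lra.
move=> K0 lip /(abs_continuous_path_majorant d0 d_ge0 dD).
set w := fun t => _; move=> [ab acw dw].
apply: (@majorant_abs_continuous_path _ _ _ _ d'0 d'_ge0 d'D _ _ (fun t => K * w t)) => //.
  apply: (abs_continuous_fun_dominated K0 _ acw) => t u _ _ _.
  by rewrite -mulrBr normrM ger0_norm.
move=> t u at_ tu ub; rewrite -mulrBr.
by split; apply: (le_trans (lip _ _)); apply: ler_wpM2l => //; [|rewrite dC]; exact: dw.
Qed.

(** The existence of the speed m of g does not imply that of g'; where it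
fails, the convention gives the value 0. *)
Lemma metric_speed_lipschitz_image (g : R -> T) (g' : R -> T') (K t m : R) :
  0 <= K -> 0 <= m -> (forall s t, d' (g' s) (g' t) <= K * d (g s) (g t)) ->
  d (g u) (g t) / `|u - t| @[u --> t^'] --> m -> metric_speed d' g' t <= K * m.
Proof.
move=> K0 m0 lip gm; rewrite /metric_speed.
have [cv|/dvgP ->] := pselect (cvg (d' (g' u) (g' t) / `|u - t| @[u --> t^']));
  last exact: mulr_ge0.
have Kcv : K * (d (g u) (g t) / `|u - t|) @[u --> t^'] --> K * m by exact: cvgMl_tmp.
apply: (ler_cvg_to cv Kcv).
by near=> u; rewrite mulrA ler_wpM2r ?invr_ge0.
Unshelve. all: by end_near. Qed.

End LipschitzImage.

Section SectionUpperGradients.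
Context {R : realType} {X Y : pmetricType R}.
Variables (N : R * R -> R) (phi : X -> R).
Hypotheses (lenX : length_space (@mdist R X)) (lenY : length_space (@mdist R Y)).
Hypotheses (normN : is_norm N) (unitN : unitary N) (incrN : coordinate_increasing N).
Hypotheses (phi_ge0 : forall x, 0 <= phi x) (phi_cont : continuous phi).
Local Notation mu := (@lebesgue_measure R).
Local Notation dX := (@mdist R X).
Local Notation dY := (@mdist R Y).
Local Notation P := (@warped_proj R X Y N phi).
Local Notation wd := (@warped_dist R X Y N phi).
Implicit Types (x : X) (y : Y) (u g : @warped_product R X Y N phi -> \bar R).

Let wdH x x' y : wd (P (x, y)) (P (x', y)) = dX x x' :=
  warped_dist_horizontal lenX lenY normN unitN incrN phi_ge0 phi_cont x x' y.

Let wdV x y y' : wd (P (x, y)) (P (x, y')) <= phi x * dY y y' :=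
  warped_dist_vertical lenX lenY normN unitN incrN phi_ge0 phi_cont x y y'.

Lemma warped_distxx Q : wd Q Q = 0.
Proof. by have [[x y] ->] := warped_proj_surj Q; rewrite wdH mdistxx. Qed.

Let wd_ge0 Q1 Q2 : 0 <= wd Q1 Q2 :=
  warped_dist_ge0 normN unitN incrN phi_ge0 Q1 Q2.

Let wdD Q1 Q2 Q3 : wd Q1 Q3 <= wd Q1 Q2 + wd Q2 Q3 :=
  warped_dist_triangle lenX lenY normN unitN incrN phi_ge0 Q1 Q2 Q3.

Lemma dopen_preimage_horizontal U y : dopen wd U -> dopen dX ((fun x => P (x, y)) @^-1` U).
Proof.
move=> oU x /= /oU[r r0 rU]; exists r => // x' xx'; apply: rU.
by rewrite /dball/= wdH.
Qed.

(** The slice is phi x-Lipschitz; 1 is added to avoid a division by 0. *)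
Lemma dopen_preimage_vertical U x : dopen wd U -> dopen dY ((fun y => P (x, y)) @^-1` U).
Proof.
move=> oU y /= /oU[r r0 rU].
have p0 : 0 < phi x + 1 by rewrite ltr_wpDl.
exists (r / (phi x + 1)); first by rewrite divr_gt0.
move=> y' /= yy'; apply: rU.
rewrite /dball/= (le_lt_trans (wdV _ _ _))//.
move: yy'; rewrite /dball/= ltr_pdivlMr//; apply: le_lt_trans.
by rewrite mulrC ler_wpM2l ?mdist_ge0// lerDl.
Qed.

(** The horizontal slice is an isometric embedding, so it preserves absolute
continuity and speed. *)
Lemma upper_gradient_horizontal u g y : upper_gradient wd u g ->
  upper_gradient dX (fun x => u (P (x, y))) (fun x => g (P (x, y))).
Proof.
move=> [mg g0 ug]; split => [|x|c a b acc [t tab ct]]; last 1 first.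
- have ccE s t' : wd (P (c s, y)) (P (c t', y)) = dX (c s) (c t') by exact: wdH.
  have := ug (fun t => P (c t, y)) a b.
  have -> : path_integral wd (fun t => P (c t, y)) a b g =
      path_integral dX c a b (fun x => g (P (x, y))).
    apply: eq_integral => s _; rewrite /metric_speed.
    by under eq_fun do rewrite ccE.
  apply; last first.
    exists t => // /(warped_proj_eq normN unitN incrN phi_ge0 phi_cont)[/= ctE _].
    exact: ct.
  apply: (abs_continuous_path_lipschitz_image _ _ _ warped_distxx wd_ge0 wdD ler01 _ acc).
  + exact: mdistxx.
  + exact: metric_sym.
  + exact: metric_triangle.
  + by move=> s t'; rewrite mul1r ccE.
- pose f : borel_type dX -> borel_type wd := fun x => P (x, y).
  have mf : measurable_fun setT f.
    apply: measurable_to_borel_type => U oU.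
    exact: (dopen_borel (dopen_preimage_horizontal (y := y) oU)).
  exact: (measurableT_comp mg mf).
- exact: g0.
Qed.

(** The vertical slice is phi x-Lipschitz, so it multiplies speeds by at most
phi x; positivity of phi x makes the slice injective, so that non-constant
curves remain non-constant. *)
Lemma upper_gradient_vertical u g x : 0 < phi x -> upper_gradient wd u g ->
  upper_gradient dY (fun y => u (P (x, y))) (fun y => (phi x)%:E * g (P (x, y)))%E.
Proof.
move=> phix [mg g0 ug]; split => [|y|c a b acc [t tab ct]]; last 1 first.
- have lip s t' : wd (P (x, c s)) (P (x, c t')) <= phi x * dY (c s) (c t') by exact: wdV.
  apply: le_trans (ug (fun t => P (x, c t)) a b _ _) _.
  + apply: (abs_continuous_path_lipschitz_image _ _ _ warped_distxx wd_ge0 wdD (phi_ge0 x) _ acc) => //.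
    * exact: mdistxx.
    * exact: metric_sym.
    * exact: metric_triangle.
  + exists t => // /(warped_proj_eq normN unitN incrN phi_ge0 phi_cont)[_ /(_ phix)[]].
    exact: ct.
  have [m [m0 _ cvgm _]] := abs_continuous_path_speed (@mdistxx R Y) (@metric_sym R Y) (@metric_triangle R Y) acc.
  have AE := ae_filter_ringOfSetsType mu.
  apply: ae_le_lower_integral => [s _|s _|].
  + by rewrite mule_ge0// lee_fin metric_speed_ge0.
  + rewrite !mule_ge0// lee_fin// metric_speed_ge0// => *; exact: mdist_ge0.
  apply: filterS3 cvgm (ae_neq_lebesgue a) (ae_neq_lebesgue b) => s ms sa sb /=.
  rewrite in_itv/= => /andP[as_ sb'].
  have {}ms := ms _; rewrite !lt_neqAle as_ sb' sb eq_sym sa in ms.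
  have {}ms := ms isT.
  rewrite (metric_speedE ms) muleAC -EFinM muleC lee_wpmul2r// lee_fin.
  exact: (metric_speed_lipschitz_image (phi_ge0 x) (m0 s) lip ms).
- pose f : borel_type dY -> borel_type wd := fun y => P (x, y).
  apply: measurable_funeM.
  have mf : measurable_fun setT f.
    apply: measurable_to_borel_type => U oU.
    exact: (dopen_borel (dopen_preimage_vertical (x := x) oU)).
  exact: (measurableT_comp mg mf).
- by rewrite mule_ge0// lee_fin.
Qed.

End SectionUpperGradients.

(** * The product outer measure and the product measure *)

Section SigmaFiniteMeasure.
Context d (T : measurableType d) (R : realType).
Variables (mu : {measure set T -> \bar R}) (sfmu : sigma_finite setT mu).

(** A carrier for the sigma-finite structure, since sigma-finiteness is only
known from a proof. *)
Definition as_sigma_finite_measure of sigma_finite setT mu : set T -> \bar R := mu.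

HB.instance Definition _ := Measure.on (as_sigma_finite_measure sfmu).
HB.instance Definition _ :=
  Measure_isSigmaFinite.Build _ _ _ (as_sigma_finite_measure sfmu) sfmu.

End SigmaFiniteMeasure.

Section EReal.
Local Open Scope ereal_scope.
Context {R : realType}.
Implicit Types a b : \bar R.

Lemma adde_eq_self a b : a \is a fin_num -> 0 <= b -> a + b = a -> b = 0.
Proof.
case: a b => [a| |] [b| |] //= _ _ [] /eqP.
by rewrite -subr_eq0 addrAC subrr add0r => /eqP ->.
Qed.

Lemma ereal_rat_between a b : a < b -> exists q : rat, a < (ratr q)%:E < b.
Proof.
have between (x y : R) : (x < y)%R -> exists q : rat, (x < ratr q < y)%R.
  by move=> /rat_in_itvoo[q]; rewrite in_itv/=; exists q.
case: a b => [a| |] [b| |] //=.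
- by rewrite lte_fin => /between[q]; exists q; rewrite !lte_fin.
- move=> _; have [|q /andP[aq _]] := between a (a + 1)%R; first by rewrite ltrDl.
  by exists q; rewrite lte_fin aq ltry.
- move=> _; have [|q /andP[_ qb]] := between (b - 1)%R b; first by rewrite ltrBlDr ltrDl.
  by exists q; rewrite lte_fin qb ltNyr.
- by move=> _; exists 0%Q; rewrite ltNyr ltry.
Qed.

End EReal.

Section ProductMeasure.
Local Open Scope ereal_scope.
Context {R : realType} {X Y : pointedType}.
Variables (muX : {outer_measure set X -> \bar R})
          (muY : {outer_measure set Y -> \bar R}).
Local Notation nu := (prod_outer muX muY).
Local Notation TX := (caratheodory_type muX).
Local Notation TY := (caratheodory_type muY).
Local Notation TP := (caratheodory_type nu).

Lemma prod_outer_cover (A : set (X * Y)) (E : (set X)^nat) (F : (set Y)^nat) :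
  (forall k, muX.-caratheodory (E k)) -> (forall k, muY.-caratheodory (F k)) ->
  A `<=` \bigcup_k (E k `*` F k) ->
  nu A <= \sum_(k <oo) (muX (E k) * muY (F k)).
Proof.
move=> cE cF AEF; apply: ereal_inf_lbound; exists (E, F) => //.
Qed.

Lemma prod_outer_rectangle_le E F : muX.-caratheodory E -> muY.-caratheodory F ->
  nu (E `*` F) <= muX E * muY F.
Proof.
move=> cE cF.
pose E' k := if k is 0%N then E else set0; pose F' k := if k is 0%N then F else set0.
apply: le_trans (@prod_outer_cover _ E' F' _ _ _) _ => [[//|k]|[//|k]|z zEF|].
- exact: caratheodory_measurable_set0.
- exact: caratheodory_measurable_set0.
- by exists 0%N.
- rewrite nneseries_recl//; last by move=> k _; rewrite mule_ge0// outer_measure_ge0.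
  by rewrite eseries0 ?adde0// => -[//|k] _ _; rewrite /= !outer_measure0 mule0.
Qed.

(** Each rectangle A * B of a covering of W is cut into its part in E * F, its
part over the complement of E, and its part in E times the complement of F;
the measures of the three parts add up to the measure of A * B. *)
Lemma caratheodory_rectangle E F : muX.-caratheodory E -> muY.-caratheodory F ->
  nu.-caratheodory (E `*` F).
Proof.
move=> cE cF; apply: le_caratheodory_measurable => W.
apply: le_ereal_inf_tmp => _ [[A B] /= [cAB WAB] <-].
have cA k : muX.-caratheodory (A k) by have [] := cAB k.
have cB k : muY.-caratheodory (B k) by have [] := cAB k.
have cEC := caratheodory_measurable_setC cE.
have cFC := caratheodory_measurable_setC cF.
have le1 : nu (W `&` (E `*` F)) <= \sum_(k <oo) (muX (A k `&` E) * muY (B k `&` F)).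
  apply: prod_outer_cover => [k|k|[x y] [/WAB[k _ [/= Ax By]] [Ex Fy]]].
  - exact: caratheodory_measurable_setI.
  - exact: caratheodory_measurable_setI.
  - by exists k.
have le2 : nu (W `&` (~` E `*` setT)) <= \sum_(k <oo) (muX (A k `&` ~` E) * muY (B k)).
  apply: prod_outer_cover => [k|k|[x y] [/WAB[k _ [/= Ax By]] [Ex Fy]]].
  - exact: caratheodory_measurable_setI.
  - exact: cB.
  - by exists k.
have le3 : nu (W `&` (E `*` ~` F)) <= \sum_(k <oo) (muX (A k `&` E) * muY (B k `&` ~` F)).
  apply: prod_outer_cover => [k|k|[x y] [/WAB[k _ [/= Ax By]] [Ex Fy]]].
  - exact: caratheodory_measurable_setI.
  - exact: caratheodory_measurable_setI.
  - by exists k.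
have le4 : nu (W `&` ~` (E `*` F)) <=
    nu (W `&` (~` E `*` setT)) + nu (W `&` (E `*` ~` F)).
  apply: le_trans (outer_measureU2 _ _ _); apply: le_outer_measure => -[x y] [Wz nEF].
  have [Ex|nEx] := pselect (E x); last by left.
  by right; split => //; split => //= Fy; apply: nEF.
have pos (C D : nat -> set X) (G H : nat -> set Y) k :
    0 <= muX (C k `&` D k) * muY (G k `&` H k).
  by rewrite mule_ge0// outer_measure_ge0.
apply: (le_trans (leeD le1 (le_trans le4 (leeD le2 le3)))).
rewrite -!nneseriesD; do ?by move=> k _ _; rewrite ?adde_ge0 ?mule_ge0 ?outer_measure_ge0.
apply: lee_nneseries => [k _|k _]; first by rewrite !adde_ge0 ?mule_ge0 ?outer_measure_ge0.
rewrite [in leRHS](cE (A k)) ge0_muleDl ?outer_measure_ge0//.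
by rewrite addeCA -ge0_muleDr ?outer_measure_ge0// -cF addeC.
Qed.

Lemma measurable_caratheodory_prod (S : set (TX * TY)) :
  measurable S -> nu.-caratheodory S.
Proof.
rewrite measurable_prod_measurableType; apply: smallest_sub.
  exact: (sigma_algebra_measurable TP).
by move=> _ [E cE [F cF <-]]; exact: caratheodory_rectangle.
Qed.

(** The identity, seen as a map from the Caratheodory sigma-algebra to the
coarser product sigma-algebra. *)
Definition prod_id : TP -> TX * TY := id.

Lemma measurable_prod_id : measurable_fun setT prod_id.
Proof. by move=> _ S mS; rewrite setTI; exact: measurable_caratheodory_prod. Qed.

Variables (m1 : {sigma_finite_measure set TX -> \bar R})
          (m2 : {sigma_finite_measure set TY -> \bar R}).
Hypotheses (m1E : forall A, m1 A = muX A) (m2E : forall B, m2 B = muY B).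

(** The product measure is countably subadditive and has the expected value on
rectangles. *)
Lemma product_measure_le_prod_outer (S : set (TX * TY)) : measurable S ->
  (m1 \x m2)%E S <= nu S.
Proof.
move=> mS; apply: le_ereal_inf_tmp => _ [[A B] /= [cAB WAB] <-].
have cA k : muX.-caratheodory (A k) by have [] := cAB k.
have cB k : muY.-caratheodory (B k) by have [] := cAB k.
have mAB k : measurable (A k `*` B k : set (TX * TY)).
  by apply: measurableX; [exact: cA|exact: cB].
apply: le_trans (measure_sigma_subadditive (m1 \x m2) mAB mS WAB) _.
apply: lee_nneseries => // k _.
have E1 : (m1 \x m2)%E (A k `*` B k) = m1 (A k) * m2 (B k) by apply: product_measure1E; [exact: cA|exact: cB].
by rewrite -m1E -m2E -E1; exact: lexx.
Qed.

(** Uniqueness of the product measure, since both sides agree on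
rectangles. *)
Lemma prod_outerE (S : set (TX * TY)) : measurable S -> nu S = (m1 \x m2)%E S.
Proof.
move=> mS; apply/esym.
apply: (@product_measure_unique _ _ _ _ _ m1 m2 (pushforward (cmeasure nu) prod_id)) => //.
  exact: measurable_prod_id.
move=> mid E F mE mF; apply/eqP; rewrite eq_le; apply/andP; split.
  by rewrite m1E m2E; exact: prod_outer_rectangle_le.
apply: le_trans (product_measure_le_prod_outer _); last exact: measurableX.
by rewrite product_measure1E.
Qed.

Lemma integral_prod_outer (f : TX * TY -> \bar R) : measurable_fun setT f ->
  (forall z, 0 <= f z) -> \int[cmeasure nu]_z f z = \int[(m1 \x m2)%E]_z f z.
Proof.
move=> mf f0.
transitivity (\int[pushforward (cmeasure nu) prod_id]_z f z).
  by rewrite (ge0_integral_pushforward measurable_prod_id).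
apply: eq_measure_integral => [|mid S mS _]; first exact: measurable_prod_id.
exact: prod_outerE.
Qed.

(** Equality off a null set of the product measure that is itself product
measurable, so that its sections are measurable. *)
Definition product_equivalent (T : Type) (f f0 : X * Y -> T) :=
  exists M : set (TX * TY), [/\ measurable M, (m1 \x m2)%E M = 0 &
    forall z, ~ M z -> f z = f0 z].

(** The intersection of coverings by rectangles whose sums approach the outer
measure. *)
Lemma measurable_hull A : nu A < +oo ->
  exists G : set (TX * TY), [/\ measurable G, A `<=` G & nu G = nu A].
Proof.
move=> Afin.
have Afin' : nu A \is a fin_num by rewrite ge0_fin_numE// outer_measure_ge0.
have /choice[G HG] : forall n : nat, exists G : set (TX * TY),
    [/\ measurable G, A `<=` G & nu G <= nu A + n.+1%:R^-1%:E].
  move=> n; have n0 : (0 < n.+1%:R^-1 :> R)%R by rewrite invr_gt0.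
  have [_ [[E F] /= [cEF AEF] <-] ltA] := lb_ereal_inf_adherent n0 Afin'.
  have cE k : muX.-caratheodory (E k) by have [] := cEF k.
  have cF k : muY.-caratheodory (F k) by have [] := cEF k.
  exists (\bigcup_k (E k `*` F k)); split => //.
    by apply: bigcup_measurable => k _; apply: measurableX; [exact: cE|exact: cF].
  by apply: le_trans (ltW ltA); apply: prod_outer_cover.
exists (\bigcap_n G n); split.
- by apply: bigcap_measurable => [|n _]; [exists 0%N|have [] := HG n].
- by move=> z Az n _; have [_ + _] := HG n; exact.
- apply/eqP; rewrite eq_le; apply/andP; split; last first.
    by apply: le_outer_measure => z Az n _; have [_ + _] := HG n; exact.
  apply/lee_addgt0Pr => e e0.
  have [n ne] : exists n : nat, (n.+1%:R^-1 <= e :> R)%R.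
    exists (Num.truncn e^-1); rewrite -[leRHS]invrK lef_pV2 ?posrE ?invr_gt0//.
    by rewrite ltW// truncnS_gt.
  have [_ _ Gn] := HG n.
  apply: (@le_trans _ _ (nu (G n))); first by apply: le_outer_measure => z; exact.
  by apply: (le_trans Gn); rewrite leeD2l// lee_fin.
Qed.

Lemma null_hull A : nu A = 0 ->
  exists G : set (TX * TY), [/\ measurable G, A `<=` G & (m1 \x m2)%E G = 0].
Proof.
move=> A0; have [|G [mG AG GA]] := @measurable_hull A; first by rewrite A0.
by exists G; split => //; rewrite -prod_outerE// GA.
Qed.

Lemma finite_rectangles : exists Q : nat -> set (TX * TY),
  [/\ forall n, measurable (Q n), \bigcup_n Q n = setT & forall n, nu (Q n) < +oo].
Proof.
have /sigma_finiteP[F [TF ndF Foo]] := sigma_finiteT m1.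
have /sigma_finiteP[G [TG ndG Goo]] := sigma_finiteT m2.
exists (fun n => F n `*` G n); split => [n||n].
- by have [? _] := Foo n; have [? _] := Goo n; exact: measurableX.
- apply/seteqP; split => // -[x y] _.
  have [n _ Fx] : (\bigcup_i F i) x by rewrite -TF.
  have [k _ Gy] : (\bigcup_i G i) y by rewrite -TG.
  exists (maxn n k) => //; split.
    by move: (x) Fx; exact/subsetPset/ndF/leq_maxl.
  by move: (y) Gy; exact/subsetPset/ndG/leq_maxr.
- have [mF Fn] := Foo n; have [mG Gn] := Goo n.
  apply: le_lt_trans (prod_outer_rectangle_le mF mG) _.
  by rewrite -m1E -m2E lte_mul_pinfty// ge0_fin_numE.
Qed.

(** In each rectangle Q n of finite measure, A has a measurable hull G n of
the same measure as A there, and the Caratheodory property makes the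
difference null. *)
Lemma caratheodory_product_equivalent A : nu.-caratheodory A ->
  exists2 A0 : set (TX * TY), measurable A0 & product_equivalent A A0.
Proof.
move=> cA; have [Q [mQ QT Qfin]] := finite_rectangles.
have cQ n : nu.-caratheodory (Q n) by exact: measurable_caratheodory_prod.
have AQfin n : nu (A `&` Q n) < +oo.
  by apply: le_lt_trans (Qfin n); apply: le_outer_measure; exact: subIsetr.
have /choice[G HG] := fun n => measurable_hull (AQfin n).
have /choice[M HM] : forall n, exists M : set (TX * TY),
    [/\ measurable M, G n `\` (A `&` Q n) `<=` M & (m1 \x m2)%E M = 0].
  move=> n; apply: null_hull; have [mG AG GA] := HG n.
  have cAQ : nu.-caratheodory (A `&` Q n) by exact: caratheodory_measurable_setI.
  have := cAQ (G n); rewrite (setIidr AG) GA -setDE => /esym/eqP.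
  move=> /eqP; apply: adde_eq_self; last exact: outer_measure_ge0.
  by rewrite ge0_fin_numE ?outer_measure_ge0.
exists (\bigcup_n G n).
  by apply: bigcup_measurable => n _; have [] := HG n.
exists (\bigcup_n M n); split.
- by apply: bigcup_measurable => n _; have [] := HM n.
- apply/eqP; rewrite eq_le measure_ge0 andbT.
  apply: (le_trans (measure_sigma_subadditive _ _ _ (@subset_refl _ _))).
  + by move=> n; have [] := HM n.
  + by apply: bigcup_measurable => n _; have [] := HM n.
  + by rewrite eseries0// => n _ _; have [] := HM n.
- move=> z nMz; apply/propext; split => [Az|[n _ Gz]].
    have [n _ Qz] : (\bigcup_n Q n) z by rewrite QT.
    by exists n => //; have [_ + _] := HG n; apply.
  by apply: contrapT => nAz; apply: nMz; exists n => //; have [_ + _] := HM n; apply; split => // -[].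
Qed.

(** The sets where f exceeds a rational are equivalent to product measurable
sets A0; f0 is rebuilt from these as the supremum of the rationals q with z in
A0 q. *)
Lemma measurable_fun_product_equivalent (f : X * Y -> \bar R) :
  measurable_fun [set: TP] f ->
  exists2 f0 : TX * TY -> \bar R, measurable_fun setT f0 & product_equivalent f f0.
Proof.
move=> mf.
(* An enumeration of the rationals; -oo is harmless in a supremum. *)
pose q n : \bar R := if @unpickle rat n is Some r then (ratr r)%:E else -oo.
pose A n := [set z | q n < f z].
have cA n : nu.-caratheodory (A n).
  have : measurable ([set: TP] `&` [set z | q n < f z]) by exact: emeasurable_fun_o_infty.
  by rewrite setTI.
have /choice[A0 HA0] : forall n, exists A0 : set (TX * TY), measurable A0 /\ product_equivalent (A n) A0.
  by move=> n; have [A0 ? ?] := caratheodory_product_equivalent (cA n); exists A0.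
have /choice[M HM] n : exists M : set (TX * TY), [/\ measurable M, (m1 \x m2)%E M = 0 &
    forall z, ~ M z -> A n z = A0 n z] by have [_] := HA0 n.
pose k n z := if z \in A0 n then q n else -oo.
exists (fun z => esups (k ^~ z) 0%N).
  apply: measurable_fun_esups => n.
  apply: measurable_fun_ifT => //; apply: (measurable_fun_bool true).
  rewrite setTI (_ : _ @^-1` _ = A0 n); first by have [] := HA0 n.
  by apply/seteqP; split => z /=; [move/set_mem|move/mem_set].
exists (\bigcup_n M n); split.
- by apply: bigcup_measurable => n _; have [] := HM n.
- apply/eqP; rewrite eq_le measure_ge0 andbT.
  apply: (le_trans (measure_sigma_subadditive _ _ _ (@subset_refl _ _))).
  + by move=> n; have [] := HM n.
  + by apply: bigcup_measurable => n _; have [] := HM n.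
  + by rewrite eseries0// => n _ _; have [] := HM n.
- move=> z nMz.
  have AA n : A n z = A0 n z.
    by have [_ _] := HM n; apply => Mz; apply: nMz; exists n.
  have kE n : k n z = if (q n < f z)%E then q n else -oo.
    rewrite /k; case: ifPn => [/set_mem|/negP zA].
      by rewrite -AA /A/= => ->.
    by case: ifPn => // qf; exfalso; apply: zA; apply/mem_set; rewrite -AA.
  apply/eqP; rewrite eq_le; apply/andP; split; last first.
    apply: ge_ereal_sup => _ [n _ <-]; rewrite kE.
    by case: ifPn => [/ltW//|_]; exact: leNye.
  rewrite leNgt; apply/negP => /ereal_rat_between[r /andP[sr rf]].
  move: sr; rewrite ltNge => /negP; apply; apply: ereal_sup_ubound.
  by exists (pickle r) => //; rewrite kE /q pickleK rf.
Qed.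

End ProductMeasure.

(** * Locally constant functions on metric measure spaces *)

Section OuterMeasureAlmostEverywhere.
Local Open Scope ereal_scope.
Context {R : realType} {T : pointedType}.
Variable mu : {outer_measure set T -> \bar R}.
Implicit Types A B : set T.

Lemma caratheodory_null A : mu A = 0 -> mu.-caratheodory A.
Proof.
move=> A0; apply: le_caratheodory_measurable => W.
have -> : mu (W `&` A) = 0.
  apply/eqP; rewrite eq_le outer_measure_ge0 andbT -A0.
  by apply: le_outer_measure; exact: subIsetr.
by rewrite add0e; apply: le_outer_measure; exact: subIsetl.
Qed.

(** Every set of outer measure zero is Caratheodory measurable, so the
exceptional set is itself measurable. *)
Lemma ae_cmeasureP (P : T -> Prop) :
  {ae cmeasure mu, forall x, P x} <-> mu [set x | ~ P x] = 0.
Proof.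
split=> [[N [_ N0 sub]]|P0].
  apply/eqP; rewrite eq_le outer_measure_ge0 andbT -N0.
  by apply: le_outer_measure; exact: sub.
by exists [set x | ~ P x]; split => //; exact: caratheodory_null.
Qed.

Lemma outer_measure_bigcup_null (F : nat -> set T) :
  (forall n, mu (F n) = 0) -> mu (\bigcup_n F n) = 0.
Proof.
move=> F0; apply/eqP; rewrite eq_le outer_measure_ge0 andbT.
apply: le_trans (outer_measure_sigma_subadditive mu F) _.
by rewrite eseries0.
Qed.

End OuterMeasureAlmostEverywhere.

Section MetricMeasureSpace.
Local Open Scope ereal_scope.
Context {R : realType} {T : pointedType}.
Variables (d : T -> T -> R) (mu : {outer_measure set T -> \bar R}).
Hypotheses (d0 : forall x, d x x = 0%R) (dC : forall x y, d x y = d y x)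
  (dD : forall x y z, (d x z <= d x y + d y z)%R).
Hypothesis mms : metric_measure_space d mu.

Lemma dopen_dball x r : dopen d (dball d x r).
Proof.
move=> y xy; exists (r - d x y)%R; first by rewrite subr_gt0.
by move=> z; rewrite /dball/= ltrBrDl; apply: le_lt_trans.
Qed.

Lemma caratheodory_dopen U : dopen d U -> mu.-caratheodory U.
Proof. by move=> oU; have [_ H _ _] := mms; apply: H; exact: sub_sigma_algebra. Qed.

Lemma caratheodory_dball x r : mu.-caratheodory (dball d x r).
Proof. exact/caratheodory_dopen/dopen_dball. Qed.

Lemma dball_fin x r : mu (dball d x r) < +oo.
Proof.
have [_ _ _ H] := mms; have r0 : (0 < Num.max r 1 :> R)%R by rewrite lt_max ltr01 orbT.
have /andP[_] := H x _ r0; apply: le_lt_trans; apply: le_outer_measure => y.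
by rewrite /dball/= => /lt_le_trans; apply; rewrite le_max lexx.
Qed.

Lemma dball_gt0 x r : (0 < r)%R -> 0 < mu (dball d x r).
Proof. by have [_ _ _ H] := mms; move=> /(H x) /andP[]. Qed.

Lemma bigcup_dball x : \bigcup_n dball d x n%:R = setT.
Proof.
apply/seteqP; split => // y _; exists (Num.truncn (d x y)).+1 => //.
by rewrite /dball/= truncnS_gt.
Qed.

Lemma sigma_finite_cmeasure : sigma_finite setT (cmeasure mu).
Proof.
exists (fun n => dball d point n%:R); first by rewrite bigcup_dball.
by move=> n; split; [exact: caratheodory_dball|exact: dball_fin].
Qed.

Lemma separable_sequence : exists q : nat -> T,
  forall x e, (0 < e)%R -> exists n, (d x (q n) < e)%R.
Proof.
have [[S /countable_injP[f finj] dense] _ _ _] := mms.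
exists (fun n => xget point [set s | S s /\ f s = n]) => x e e0.
have [s Ss xs] := dense x e e0; exists (f s).
case: xgetP => [s' _ [Ss' ff]|/(_ s)]; last by move=> H; exfalso; apply: H.
by rewrite (finj s' s)// inE.
Qed.

(** Lindelof: countably many balls with centers in a dense sequence and radii
1 / (j + 1) cover the space, and those that meet A in a null set suffice. *)
Lemma locally_null A : (forall x, exists2 r, (0 < r)%R & mu (dball d x r `&` A) = 0) ->
  mu A = 0.
Proof.
move=> locA; have [q qdense] := separable_sequence.
(* Choosing the empty set for the balls that do not qualify makes the union
   over all i and j null. *)
pose F i j : set T :=
  let B := dball d (q i) j.+1%:R^-1 `&` A in if mu B == 0 then B else set0.
have F0 i j : mu (F i j) = 0.
  by rewrite /F; case: ifPn => [/eqP//|_]; rewrite outer_measure0.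
apply/eqP; rewrite eq_le outer_measure_ge0 andbT.
have <- : mu (\bigcup_i \bigcup_j F i j) = 0.
  by apply: outer_measure_bigcup_null => i; exact: outer_measure_bigcup_null.
apply: le_outer_measure => x Ax; have [r r0 r0A] := locA x.
pose j := Num.truncn (2 / r)%R.
have j0 : (0 < j.+1%:R^-1 :> R)%R by rewrite invr_gt0.
have jr : (j.+1%:R^-1 < r / 2 :> R)%R.
  rewrite -[ltRHS]invrK ltf_pV2 ?posrE ?invr_gt0 ?divr_gt0//.
  by rewrite invf_div truncnS_gt.
have [i xi] := qdense x _ j0.
exists i => //; exists j => //; rewrite /F ifT; first by split => //; rewrite /dball/= dC.
apply/eqP/eqP; rewrite eq_le outer_measure_ge0 andbT -r0A.
apply: le_outer_measure => z [qz Az]; split => //.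
apply: (le_lt_trans (dD x (q i) z)); rewrite (splitr r).
by apply: ltrD; [exact: lt_trans xi jr|exact: lt_trans qz jr].
Qed.

(** The indicator of the set where k differs from k x is locally constant
along a path, hence continuous, and cannot jump from 0 to 1. *)
Lemma locally_constant_const (k : T -> R) : length_space d ->
  (forall x, exists2 r, (0 < r)%R & forall y, (d x y < r)%R -> k y = k x) ->
  forall x y, k x = k y.
Proof.
move=> len lock x y; apply: contrapT => kxy.
have [[g [a [b [[[ab cg] _] gax gby]]]] _] := len x y.
(* The path is clamped to [a, b], outside of which it need not be continuous. *)
pose h t : R := if k (g (clamp a b t)) == k x then 0%R else 1%R.
have ch : continuous h.
  move=> t; have tab := clamp_itv t ab.
  have [r r0 rk] := lock (g (clamp a b t)).
  have [|s s0 sg] := cg (clamp a b t) _ r r0; first by rewrite in_itv.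
  apply/cvgrPdist_lt => e e0; near=> u.
  have tu : (`|t - u| < s)%R by near: u; apply: cvgr_dist_lt => //; exact: cvg_id.
  rewrite /h (rk (g (clamp a b u))) ?subrr ?normr0//; apply: sg; first by rewrite in_itv/= clamp_itv.
  apply: le_lt_trans tu; case: (leP t u) => [tu|/ltW ut].
    rewrite ger0_norm ?subr_ge0 ?clamp_nondecreasing// distrC ger0_norm ?subr_ge0//.
    exact: clamp_increment.
  rewrite distrC ger0_norm ?subr_ge0 ?clamp_nondecreasing// ger0_norm ?subr_ge0//.
  exact: clamp_increment.
have ha : h a = 0%R by rewrite /h clamp_id// gax eqxx.
have hb : h b = 1%R by rewrite /h clamp_id// gby; case: eqP => // /esym.
have [||t _] := @IVT R h a b 2^-1 ab.
- exact: continuous_subspaceT.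
- by rewrite ha hb min_l ?ler01// max_r ?ler01//; apply/andP; split; lra.
- by rewrite /h; case: ifP => _; lra.
Unshelve. all: by end_near. Qed.

(** The local values define a locally constant function: on overlapping balls
the two values agree, since otherwise c would be different from one of them
almost everywhere on a nonempty ball, which has positive measure. *)
Lemma locally_ae_constant (c : T -> R) : length_space d ->
  (forall x, exists r k, (0 < r)%R /\ mu (dball d x r `&` [set y | c y <> k]) = 0) ->
  exists k, mu [set y | c y <> k] = 0.
Proof.
move=> len /choice[r /choice[k rk]].
have kloc x : exists2 s, (0 < s)%R & forall y, (d x y < s)%R -> k y = k x.
  exists (r x); first by have [] := rk x.
  move=> y xy; apply: contrapT => kxy.
  have [ry0 ny] := rk y; have [rx0 nx] := rk x.
  (* The ball of radius s around y lies in both of the given balls. *)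
  pose s := Num.min (r y) (r x - d x y)%R.
  have s0 : (0 < s)%R by rewrite lt_min ry0 subr_gt0.
  have := dball_gt0 y s0; rewrite ltNge => /negP; apply.
  have <- : mu ((dball d x (r x) `&` [set y | c y <> k x]) `|`
                (dball d y (r y) `&` [set z | c z <> k y])) = 0.
    apply/eqP; rewrite eq_le outer_measure_ge0 andbT.
    by apply: le_trans (outer_measureU2 mu _ _) _; rewrite [X in X + _]nx ny adde0.
  apply: le_outer_measure => z; rewrite /dball/= /s lt_min => /andP[yz yxz].
  have [ck|ck] := pselect (c z = k x); [right|left]; split => //=.
    by rewrite ck => /esym.
  by rewrite /dball/=; have := dD x y z; lra.
have kconst := locally_constant_const len kloc.
exists (k point); apply: locally_null => x; have [rx0 nx] := rk x.
by exists (r x) => //; rewrite (kconst point x).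
Qed.

End MetricMeasureSpace.

(** * Norms as integrals *)

Section LnormIntegral.
Local Open Scope ereal_scope.
Context {R : realType}.
Context d (T : measurableType d).
Variables (mu : {measure set T -> \bar R}).
Implicit Types (f : T -> \bar R) (p : R).

Lemma Lnorm_lty p f : (1 <= p)%R ->
  ('N[mu]_p%:E[f] < +oo) <-> (\int[mu]_x (`|f x| `^ p) < +oo).
Proof.
move=> p1; have p0 : (0 < p)%R by exact: lt_le_trans p1.
rewrite -poweR_Lnorm ?gt_eqF//; split => H.
  by rewrite poweR_lty.
rewrite ltey; apply/eqP => Hoo; move: H; rewrite Hoo.
by rewrite /= gt_eqF// ltxx.
Qed.

End LnormIntegral.

Section LnormComparison.
Local Open Scope ereal_scope.
Context {R : realType}.
Context d d' (T : measurableType d) (T' : measurableType d').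
Variables (mu : {measure set T -> \bar R}) (mu' : {measure set T' -> \bar R}).
Implicit Types (f : T -> \bar R) (g : T' -> \bar R) (p C : R).

(** The p-th power is increasing on nonnegative extended reals. *)
Lemma Lnorm_le_integral p C f g : (1 <= p)%R -> (0 <= C)%R ->
  ('N[mu]_p%:E[f] <= C%:E * 'N[mu']_p%:E[g]) <->
  (\int[mu]_x (`|f x| `^ p) <= (C `^ p)%:E * \int[mu']_x (`|g x| `^ p)).
Proof.
move=> p1 C0; have p0 : (0 < p)%R by exact: lt_le_trans p1.
have mono (r : R) (a b : \bar R) : (0 <= r)%R -> 0 <= a -> 0 <= b -> a <= b -> a `^ r <= b `^ r.
  by move=> r0 a0 b0; apply: gt0_ler_poweR => //; rewrite in_itv/= ?a0 ?b0 leey.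
have N0 : 0 <= C%:E * 'N[mu']_p%:E[g] by rewrite mule_ge0 ?lee_fin ?Lnorm_ge0.
have CE : (C `^ p)%:E * \int[mu']_x (`|g x| `^ p) = (C%:E * 'N[mu']_p%:E[g]) `^ p.
  by rewrite poweRM ?lee_fin ?Lnorm_ge0// poweR_Lnorm ?gt_eqF// poweR_EFin.
split => H.
  rewrite CE -poweR_Lnorm ?gt_eqF//; apply: mono => //; [exact: ltW|exact: Lnorm_ge0].
have pK (a : \bar R) : 0 <= a -> (a `^ p) `^ p^-1 = a.
  by move=> a0; rewrite -poweRrM mulfV ?gt_eqF// poweRe1.
rewrite -(pK 'N[mu]_p%:E[f]) ?Lnorm_ge0// -[leRHS]pK//.
apply: mono; rewrite ?invr_ge0 ?(ltW p0) ?poweR_ge0//.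
by rewrite poweR_Lnorm ?gt_eqF// -CE.
Qed.

End LnormComparison.

(** * Integration over the warped product *)

Section ProductSections.
Local Open Scope ereal_scope.
Context {R : realType}.
Context d1 d2 (T1 : measurableType d1) (T2 : measurableType d2).
Variables (m1 : {sigma_finite_measure set T1 -> \bar R})
          (m2 : {sigma_finite_measure set T2 -> \bar R}).

Lemma integral_eq0_ae d (T : measurableType d) (m : {measure set T -> \bar R})
    (F : T -> \bar R) : measurable_fun setT F -> (forall x, 0 <= F x) ->
  \int[m]_x F x = 0 -> {ae m, forall x, F x = 0}.
Proof.
move=> mF F0 iF0; have /(ae_eq_integral_abs m measurableT mF) : \int[m]_x `|F x| = 0.
  by under eq_integral do rewrite gee0_abs//.
by have AE := ae_filter_ringOfSetsType m; apply: filterS => x; exact.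
Qed.

Lemma integral_lty_ae d (T : measurableType d) (m : {measure set T -> \bar R})
    (F : T -> \bar R) : measurable_fun setT F -> (forall x, 0 <= F x) ->
  \int[m]_x F x < +oo -> {ae m, forall x, F x < +oo}.
Proof.
move=> mF F0 iFoo.
have intF : m.-integrable setT F.
  by apply/integrableP; split => //; under eq_integral do rewrite gee0_abs//.
have AE := ae_filter_ringOfSetsType m.
apply: filterS (integrable_ae measurableT intF) => x /(_ Logic.I).
by rewrite ge0_fin_numE.
Qed.

Lemma tonelli_ae1 (F : T1 * T2 -> \bar R) : measurable_fun setT F -> (forall z, 0 <= F z) ->
  \int[(m1 \x m2)%E]_z F z < +oo -> {ae m1, forall x, \int[m2]_y F (x, y) < +oo}.
Proof.
move=> mF F0; rewrite fubini_tonelli1// => H.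
apply: integral_lty_ae H; first exact: measurable_fun_fubini_tonelli_F.
by move=> x; exact: integral_ge0.
Qed.

Lemma tonelli_ae2 (F : T1 * T2 -> \bar R) : measurable_fun setT F -> (forall z, 0 <= F z) ->
  \int[(m1 \x m2)%E]_z F z < +oo -> {ae m2, forall y, \int[m1]_x F (x, y) < +oo}.
Proof.
move=> mF F0; rewrite fubini_tonelli2// => H.
apply: integral_lty_ae H; first exact: measurable_fun_fubini_tonelli_G.
by move=> x; exact: integral_ge0.
Qed.

(** Tonelli for the indicator of M. *)
Lemma null_sections (M : set (T1 * T2)) : measurable M -> (m1 \x m2)%E M = 0 ->
  {ae m1, forall x, m2 (xsection M x) = 0} /\ {ae m2, forall y, m1 (ysection M y) = 0}.
Proof.
move=> mM M0.
have mI : measurable_fun setT (EFin \o \1_M : T1 * T2 -> \bar R).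
  exact/measurable_EFinP/measurable_indic.
have I0 (z : T1 * T2) : 0 <= (EFin \o \1_M) z :> \bar R by rewrite lee_fin.
have iI : \int[(m1 \x m2)%E]_z (EFin \o \1_M) z = 0 by rewrite integral_indic// setIT.
split.
  have := iI; rewrite fubini_tonelli1// indic_fubini_tonelli_FE// => /integral_eq0_ae; apply.
  - exact: measurable_fun_xsection.
  - by move=> x /=.
have := iI; rewrite fubini_tonelli2// indic_fubini_tonelli_GE// => /integral_eq0_ae; apply.
- exact: measurable_fun_ysection.
- by move=> x /=.
Qed.

End ProductSections.

Section WarpedMeasure.
Local Open Scope ereal_scope.
Context {R : realType} {X Y : pmetricType R}.
Variables (muX : {outer_measure set X -> \bar R})
  (muY : {outer_measure set Y -> \bar R}) (N : R * R -> R) (phi : X -> R).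
Hypotheses (mmsX : metric_measure_space (@mdist R X) muX)
  (mmsY : metric_measure_space (@mdist R Y) muY)
  (lenX : length_space (@mdist R X)) (lenY : length_space (@mdist R Y)).
Hypotheses (normN : is_norm N) (unitN : unitary N) (incrN : coordinate_increasing N).
Hypotheses (phi_ge0 : forall x, (0 <= phi x)%R) (phi_cont : continuous phi).
Hypothesis phi_ae : {ae cmeasure muX, forall x, (0 < phi x)%R}.
Local Notation dX := (@mdist R X).
Local Notation dY := (@mdist R Y).
Local Notation P := (@warped_proj R X Y N phi).
Local Notation wd := (@warped_dist R X Y N phi).
Local Notation Z := (@warped_product R X Y N phi).
Local Notation nu := (prod_outer muX muY).
Local Notation mZ := (@warped_measure R X Y N phi muX muY).
Local Notation TX := (caratheodory_type muX).
Local Notation TY := (caratheodory_type muY).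
Local Notation TZ := (caratheodory_type mZ).
Variables (m1 : {sigma_finite_measure set TX -> \bar R})
          (m2 : {sigma_finite_measure set TY -> \bar R}).
Hypotheses (m1E : forall A, m1 A = muX A) (m2E : forall B, m2 B = muY B).

Let wdD := warped_dist_triangle lenX lenY normN unitN incrN phi_ge0.

(** A set that is open for the product of the two metrics is a countable union
of products of balls, by separability. *)
Lemma measurable_prod_open (V : set (TX * TY)) :
  (forall z, V z -> exists2 r, (0 < r)%R &
    forall w : X * Y, (dX z.1 w.1 < r)%R -> (dY z.2 w.2 < r)%R -> V w) -> measurable V.
Proof.
move=> oV.
have [qX qXd] := separable_sequence mmsX; have [qY qYd] := separable_sequence mmsY.
pose Q i j n : set (TX * TY) := dball dX (qX i) n.+1%:R^-1 `*` dball dY (qY j) n.+1%:R^-1.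
pose F i j n : set (TX * TY) := if `[< Q i j n `<=` V >] then Q i j n else set0.
have mF i j n : measurable (F i j n).
  rewrite /F; case: ifP => _; last exact: measurable0.
  apply: measurableX.
    by apply: (caratheodory_dball (@metric_triangle R X) mmsX).
  by apply: (caratheodory_dball (@metric_triangle R Y) mmsY).
rewrite (_ : V = \bigcup_i \bigcup_j \bigcup_n F i j n).
  apply: bigcup_measurable => i _; apply: bigcup_measurable => j _.
  by apply: bigcup_measurable => n _; exact: mF.
apply/seteqP; split => [z Vz|z [i _ [j _ [n _]]]]; last first.
  by rewrite /F; case: ifP => // /asboolP; exact.
have [r r0 rV] := oV z Vz.
pose n := Num.truncn (2 / r)%R.
have n0 : (0 < n.+1%:R^-1 :> R)%R by rewrite invr_gt0.
have nr : (n.+1%:R^-1 < r / 2 :> R)%R.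
  rewrite -[ltRHS]invrK ltf_pV2 ?posrE ?invr_gt0 ?divr_gt0//.
  by rewrite invf_div truncnS_gt.
have [i zi] := qXd z.1 _ n0; have [j zj] := qYd z.2 _ n0.
exists i => //; exists j => //; exists n => //.
rewrite /F ifT; first by split; rewrite /dball/= metric_sym.
apply/asboolP => w [wi wj]; apply: rV; rewrite (splitr r).
  apply: (le_lt_trans (metric_triangle _ (qX i) _)).
  by apply: ltrD; [exact: lt_trans zi nr|exact: lt_trans wi nr].
apply: (le_lt_trans (metric_triangle _ (qY j) _)).
by apply: ltrD; [exact: lt_trans zj nr|exact: lt_trans wj nr].
Qed.

(** By [warped_dist_le], P is continuous for the product topology. *)
Lemma measurable_preimage_dopen U : dopen wd U -> measurable (P @^-1` U : set (TX * TY)).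
Proof.
move=> oU; apply: measurable_prod_open => -[x y] /oU[r r0 rU].
have p0 : (0 < phi x + 2 :> R)%R by rewrite ltr_wpDl.
exists (r / (phi x + 2))%R; first by rewrite divr_gt0.
move=> [x' y'] /=; rewrite !ltr_pdivlMr// => xx' yy'; apply: rU; rewrite /dball/=.
apply: (le_lt_trans (warped_dist_le lenX lenY normN unitN incrN phi_ge0 phi_cont x x' x y y')).
rewrite mdistxx add0r.
have := mdist_ge0 x x'; have := mdist_ge0 y y'.
move: xx' yy'; move: (dX x x') (dY y y') (phi x) (phi_ge0 x) => a b f f0.
nra.
Qed.

(** P, with the product and Borel sigma-algebras. *)
Definition proj_borel : TX * TY -> borel_type wd := P.

Lemma measurable_proj_borel : measurable_fun setT proj_borel.
Proof. by apply: measurable_to_borel_type => U oU; exact: measurable_preimage_dopen. Qed.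

Let Z0 : set (X * Y) := [set z | phi z.1 = 0%R].

(** Since phi is positive almost everywhere; so P is injective off a null
set. *)
Let nuZ0 : nu Z0 = 0.
Proof.
have [M [mM M0 sub]] := phi_ae.
apply/eqP; rewrite eq_le outer_measure_ge0 andbT.
apply: le_trans (_ : nu (M `*` setT) <= _).
  apply: le_outer_measure => -[x y]; rewrite /Z0/= => p0; split => //=; apply: sub => /=.
  by rewrite p0 ltxx.
apply: le_trans (prod_outer_rectangle_le _ _) _ => //.
  exact: (@measurableT _ TY).
by rewrite [X in X * _]M0 mul0e.
Qed.

(** Being measurable for the pushforward only tests A against saturated sets.
Off the null set Z0 the projection is injective, so that every set W is, up to
a null set, the preimage of its image. *)
Lemma caratheodory_preimage_proj (A : set Z) :
  mZ.-caratheodory A -> nu.-caratheodory (P @^-1` A).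
Proof.
move=> cA; apply: le_caratheodory_measurable => W.
pose W' := W `\` Z0.
have W'E (B : set Z) : P @^-1` ((P @` W') `&` B) = W' `&` P @^-1` B.
  apply/seteqP; split => z /=; last by move=> [W'z Bz]; split => //; exists z.
  move=> [[w W'w Pwz] Bz]; split => //.
  have [_ +] := warped_proj_eq normN unitN incrN phi_ge0 phi_cont Pwz.
  move=> <-//; rewrite lt0r phi_ge0 andbT; apply/eqP => p0.
  by case: W'w => _; apply.
have drop (B : set (X * Y)) : nu (W `&` B) <= nu (W' `&` B).
  rewrite -[leRHS]adde0 -nuZ0; apply: le_trans (outer_measureU2 _ _ _).
  apply: le_outer_measure => z [Wz Bz].
  by have [z0|z0] := pselect (Z0 z); [right|left].
apply: (le_trans (leeD (drop _) (drop _))).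
have := cA (P @` W'); rewrite /warped_measure /= /pushforward_outer !W'E => <-.
rewrite -[P @` W']setIT W'E; apply: le_outer_measure => z [[]].
by [].
Qed.

Lemma caratheodory_of_preimage_proj (A : set Z) :
  nu.-caratheodory (P @^-1` A) -> mZ.-caratheodory A.
Proof. by move=> cA W; exact: (cA (P @^-1` W)). Qed.

Lemma caratheodory_borel (B : set Z) : <<s dopen wd >> B -> mZ.-caratheodory B.
Proof.
move=> mB; apply: caratheodory_of_preimage_proj.
apply: measurable_caratheodory_prod.
have := measurable_proj_borel measurableT; move=> /(_ B mB).
by rewrite setTI.
Qed.

Lemma borel_measurable_function (g : Z -> \bar R) :
  measurable_fun [set: borel_type wd] g -> measurable_function mZ g.
Proof.
move=> mg _ V mV; rewrite setTI; apply: caratheodory_borel.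
by have := mg measurableT _ mV; rewrite setTI.
Qed.

(** P, with the two Caratheodory sigma-algebras. *)
Definition proj_caratheodory : caratheodory_type nu -> TZ := P.

Lemma measurable_proj_caratheodory : measurable_fun setT proj_caratheodory.
Proof. by move=> _ A mA; rewrite setTI; exact: caratheodory_preimage_proj. Qed.

(** Change of variables from the warped product to the Caratheodory product,
then replacement by an equivalent product measurable function. *)
Lemma integral_warped (f : Z -> \bar R) (f0 : TX * TY -> \bar R) :
  measurable_function mZ f -> (forall Q, 0 <= f Q) ->
  measurable_fun setT f0 -> (forall z, 0 <= f0 z) ->
  product_equivalent m1 m2 (f \o P) f0 ->
  \int[cmeasure mZ]_Q f Q = \int[(m1 \x m2)%E]_z f0 z.
Proof.
move=> mf f_ge0 mf0 f0_ge0 [M [mM M0 fM]].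
transitivity (\int[cmeasure nu]_z f (P z)).
  rewrite -[RHS](ge0_integral_pushforward measurable_proj_caratheodory (cmeasure nu) measurableT mf)//.
rewrite -(integral_prod_outer m1E m2E mf0 f0_ge0).
have mfP : measurable_fun setT (f \o proj_caratheodory).
  exact: (measurableT_comp mf measurable_proj_caratheodory).
have mf0' : measurable_fun setT (f0 \o @prod_id R X Y muX muY).
  move=> _ V mV; rewrite setTI; apply: measurable_caratheodory_prod.
  by have := mf0 measurableT V mV; rewrite setTI.
apply: (ge0_ae_eq_integral measurableT mfP mf0').
- by move=> z _; exact: f_ge0.
- by move=> z _; exact: f0_ge0.
exists M; split; first exact: measurable_caratheodory_prod.
  by have := prod_outerE m1E m2E mM; rewrite M0.
by move=> z /= /not_implyP[_]; apply: contra_notP => /fM.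
Qed.

End WarpedMeasure.

(** * Modifications on null sets and by constants *)

Section ExtendedReals.
Local Open Scope ereal_scope.
Context {R : realType}.

(** The triangle inequality and (s + t)^p <= 2^p max(s, t)^p. The intermediate
value v may be infinite, in which case the right-hand side is +oo. *)
Lemma poweR_dist_le (p a c : R) (v : \bar R) : (1 <= p)%R ->
  (`|c - a| `^ p)%:E <= (2 `^ p)%:E * (`|v - a%:E| `^ p + `|v - c%:E| `^ p).
Proof.
move=> p1; have p0 : (0 < p)%R by exact: lt_le_trans p1.
have two0 : (0 < 2 `^ p :> R)%R by rewrite powR_gt0.
have infty (x : \bar R) : 0 <= x -> (2 `^ p)%:E * (+oo + x) = +oo.
  by move=> x0; rewrite addye ?gt_eqF ?(lt_le_trans _ x0)// gt0_muley// lte_fin.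
case: v => [v| |].
- rewrite -!EFinB !poweR_EFin -EFinD -EFinM lee_fin.
  pose s : R := Num.max `|v - a|%R `|v - c|%R.
  have s0 : (0 <= s)%R by rewrite le_max normr_ge0.
  have cas : (`|c - a| <= 2 * s)%R.
    have H1 : (`|v - a| <= s)%R by rewrite le_max lexx.
    have H2 : (`|v - c| <= s)%R by rewrite le_max lexx orbT.
    have := ler_distD v c a; rewrite (distrC c v); lra.
  apply: (@le_trans _ _ ((2 * s) `^ p)%R).
    by apply: ge0_ler_powR; rewrite ?nnegrE ?mulr_ge0// ltW.
  rewrite powRM// ler_wpM2l ?(ltW two0)// /s /Num.max.
  by case: ifP => _; rewrite ?lerDl ?lerDr powR_ge0.
- have E (b : R) : `|+oo - b%:E| `^ p = +oo by rewrite (_ : `|_| = +oo)// poweRyr ?gt_eqF.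
  by rewrite !E infty ?leey.
- have E (b : R) : `|-oo - b%:E| `^ p = +oo by rewrite (_ : `|_| = +oo)// poweRyr ?gt_eqF.
  by rewrite !E infty ?leey.
Qed.

(** Also valid for infinite values, where the convention |oo - oo| = +oo is
preserved by the addition of a real number. *)
Lemma abse_sub_addr (a b : \bar R) (c : R) :
  `|(a + c%:E) - (b + c%:E)| = `|a - b|.
Proof.
case: a b => [a| |] [b| |] //=.
by rewrite opprD addrACA subrr addr0.
Qed.

End ExtendedReals.

Section FunctionSpaces.
Local Open Scope ereal_scope.
Context {R : realType} {T : pointedType}.
Variables (d : T -> T -> R) (mu : {outer_measure set T -> \bar R}).
Implicit Types (u g : T -> \bar R) (p c : R).

Lemma ae_eq_null (f f0 : T -> \bar R) (M : set T) : mu M = 0 ->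
  (forall x, ~ M x -> f x = f0 x) -> forall D : set T, ae_eq (cmeasure mu) D f0 f.
Proof.
move=> M0 fM D; exists M; split => //; first exact: caratheodory_null.
by move=> x /= /not_implyP[_]; apply: contra_notP => /fM.
Qed.

Lemma measurable_function_restrict (A : set T) u : mu.-caratheodory A ->
  measurable_function mu u -> measurable_function mu (u \_ A).
Proof.
move=> cA mf; have mA : measurable (A : set (caratheodory_type mu)) := cA.
apply: (proj1 (measurable_restrictT (u : caratheodory_type mu -> \bar R) mA)).
exact: measurable_funTS.
Qed.

Lemma measurable_function_dist_powR p c u : measurable_function mu u ->
  measurable_function mu (fun x => `|u x - c%:E| `^ p).
Proof.
move=> mf; apply: (measurableT_comp (measurable_poweR p)).
apply: measurableT_comp => //.
by apply: emeasurable_funB => //; exact: measurable_cst.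
Qed.

Lemma measurable_function_null u v (M : set T) : mu M = 0 ->
  (forall x, ~ M x -> u x = v x) -> measurable_function mu v -> measurable_function mu u.
Proof.
move=> M0 uv; apply: ae_measurable_fun; last exact: (ae_eq_null M0 uv).
exact: measure_is_complete_caratheodory.
Qed.

(** Integrability of a slice of u is deduced from that of a product measurable
version v, through an integrable bound h for v on A. *)
Lemma integrable_null u v h (M A : set T) : mu M = 0 ->
  (forall x, ~ M x -> u x = v x) -> measurable_function mu v -> mu.-caratheodory A ->
  measurable_function mu h -> (forall x, 0 <= h x) -> (forall x, A x -> `|v x| <= h x) ->
  \int[cmeasure mu]_x h x < +oo -> (cmeasure mu).-integrable A u.
Proof.
move=> M0 uv mv cA mh h0 vh hfin.
have mu_ := measurable_function_null M0 uv mv.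
apply/integrableP; split; first exact: measurable_funTS.
apply: le_lt_trans hfin.
rewrite integral_mkcond; apply: ae_ge0_le_integral => //.
- by move=> x _; apply: erestrict_ge0 => *; exact: abse_ge0.
- by apply: measurable_function_restrict => //; exact: measurableT_comp.
- exists M; split => //; first exact: caratheodory_null.
  move=> x /= /not_implyP[_]; apply: contra_notP => /uv; rewrite /= patchE.
  by case: ifPn => [/set_mem/vh + ux|//]; rewrite ux.
Qed.

Lemma integral_dist_powR_null p c u v (M A : set T) : mu M = 0 ->
  (forall x, ~ M x -> u x = v x) -> measurable_function mu v -> mu.-caratheodory A ->
  \int[cmeasure mu]_(x in A) (`|u x - c%:E| `^ p) =
  \int[cmeasure mu]_(x in A) (`|v x - c%:E| `^ p).
Proof.
move=> M0 uv mv cA.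
have mu_ := measurable_function_null M0 uv mv.
have mA : measurable (A : set (caratheodory_type mu)) := cA.
apply: (ge0_ae_eq_integral mA).
- by apply: measurable_funTS; exact: measurable_function_dist_powR.
- by apply: measurable_funTS; exact: measurable_function_dist_powR.
- by move=> *; exact: poweR_ge0.
- by move=> *; exact: poweR_ge0.
- by apply: (ae_eq_null M0) => x /uv ->.
Qed.

Lemma upper_gradient_addr u g c : upper_gradient d u g ->
  upper_gradient d (u \+ cst c%:E) g.
Proof.
move=> [mg g0 ug]; split => // k a b ack ncst.
by rewrite /= abse_sub_addr; exact: ug.
Qed.

Lemma D1_addr p u c : (forall x r, (0 < r)%R -> mu.-caratheodory (dball d x r)) ->
  (forall x r, (0 < r)%R -> mu (dball d x r) < +oo) ->
  D1 d mu p u -> D1 d mu p (u \+ cst c%:E).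
Proof.
move=> cball ballfin [mu_ intu [g ug gfin]]; split.
- by apply: emeasurable_funD => //; exact: measurable_cst.
- move=> x r r0; apply: integrableD; [exact: cball|exact: intu|].
  apply/integrableP; split; first exact: measurable_cst.
  rewrite integral_cst; last exact: cball.
  by rewrite lte_mul_pinfty ?ballfin// abse_fin_num.
- by exists g => //; exact: upper_gradient_addr.
Qed.

End FunctionSpaces.

(** * Gluing the constants of the horizontal slices *)

Section WarpedSobolevPoincare.
Local Open Scope ereal_scope.
Context {R : realType} {X Y : pmetricType R}.
Variables (muX : {outer_measure set X -> \bar R})
  (muY : {outer_measure set Y -> \bar R}) (N : R * R -> R) (p CX : R) (phi : X -> R).
Hypotheses (mmsX : metric_measure_space (@mdist R X) muX)
  (mmsY : metric_measure_space (@mdist R Y) muY)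
  (lenX : length_space (@mdist R X)) (lenY : length_space (@mdist R Y)).
Hypotheses (normN : is_norm N) (unitN : unitary N) (incrN : coordinate_increasing N).
Hypothesis p_ge1 : (1 <= p)%R.
Hypotheses (phi_ge0 : forall x, (0 <= phi x)%R) (phi_cont : continuous phi).
Hypothesis phi_ae : {ae cmeasure muX, forall x, (0 < phi x)%R}.
Local Notation dX := (@mdist R X).
Local Notation dY := (@mdist R Y).
Local Notation P := (@warped_proj R X Y N phi).
Local Notation wd := (@warped_dist R X Y N phi).
Local Notation Z := (@warped_product R X Y N phi).
Local Notation nu := (prod_outer muX muY).
Local Notation mZ := (@warped_measure R X Y N phi muX muY).
Local Notation TX := (caratheodory_type muX).
Local Notation TY := (caratheodory_type muY).
Variables (m1 : {sigma_finite_measure set TX -> \bar R})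
          (m2 : {sigma_finite_measure set TY -> \bar R}).
Hypotheses (m1E : forall A, m1 A = muX A) (m2E : forall B, m2 B = muY B).

Let p0 : (0 < p)%R. Proof. exact: lt_le_trans p_ge1. Qed.

Let im1 D f : \int[m1]_(x in D) f x = \int[cmeasure muX]_(x in D) f x.
Proof. by apply: eq_measure_integral => A _ _; exact: m1E. Qed.

Let im2 D f : \int[m2]_(y in D) f y = \int[cmeasure muY]_(y in D) f y.
Proof. by apply: eq_measure_integral => A _ _; exact: m2E. Qed.

Let aeX (Q : X -> Prop) : {ae m1, forall x, Q x} -> {ae cmeasure muX, forall x, Q x}.
Proof. by move=> [M [mM M0 sub]]; exists M; split => //; exact: etrans (esym (m1E M)) M0. Qed.

Let aeY (Q : Y -> Prop) : {ae m2, forall y, Q y} -> {ae cmeasure muY, forall y, Q y}.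
Proof. by move=> [M [mM M0 sub]]; exists M; split => //; exact: etrans (esym (m2E M)) M0. Qed.

Let AEX : Filter (almost_everywhere (cmeasure muX)) := ae_filter_ringOfSetsType _.
Let AEY : Filter (almost_everywhere (cmeasure muY)) := ae_filter_ringOfSetsType _.

Variables (u g : Z -> \bar R).
Hypotheses (mu_ : measurable_function mZ u) (intu : integrable_over_balls wd mZ u)
  (ug : upper_gradient wd u g) (gfin : finite_Lnorm mZ p g).

Let wdD := warped_dist_triangle lenX lenY normN unitN incrN phi_ge0.

Let G : TX * TY -> \bar R := g \o P.

Let g_ge0 Q : 0 <= g Q. Proof. by have [_ + _] := ug; exact. Qed.

Let mG : measurable_fun setT G.
Proof.
have [mg _ _] := ug.
exact: (measurableT_comp mg (measurable_proj_borel mmsX mmsY lenX lenY normN unitN incrN phi_ge0 phi_cont)).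
Qed.

Let Gp : TX * TY -> \bar R := fun z => `|G z| `^ p.

Let mGp : measurable_fun setT Gp.
Proof. by apply: (measurableT_comp (measurable_poweR p)); exact: measurableT_comp. Qed.

Let Gp_ge0 z : 0 <= Gp z. Proof. exact: poweR_ge0. Qed.

Let mgZ : measurable_function mZ g.
Proof.
have [mg _ _] := ug.
exact: (borel_measurable_function mmsX mmsY lenX lenY normN unitN incrN phi_ge0 phi_cont mg).
Qed.

Let integral_Gp : \int[cmeasure mZ]_Q (`|g Q| `^ p) = \int[(m1 \x m2)%E]_z Gp z.
Proof.
apply: (integral_warped normN unitN incrN phi_ge0 phi_cont phi_ae m1E m2E) => //.
- by apply: (measurableT_comp (measurable_poweR p)); exact: measurableT_comp.
- by move=> Q; exact: poweR_ge0.
- by exists set0; split => //; rewrite measure0.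
Qed.

Let Gp_fin : \int[(m1 \x m2)%E]_z Gp z < +oo.
Proof. by rewrite -integral_Gp; apply/Lnorm_lty. Qed.

(* A product measurable version of u o P: the slices of u itself are only
   known to be measurable through it. *)
Variable u0 : TX * TY -> \bar R.
Hypothesis mu0 : measurable_fun setT u0.
Variable M : set (TX * TY).
Hypotheses (mM : measurable M) (M0 : (m1 \x m2)%E M = 0)
  (uM : forall z, ~ M z -> u (P z) = u0 z).

(** Products of balls exhausting the product; they replace balls of the warped
product, whose slices need not be balls. *)
Let rect n : set (TX * TY) := dball dX point n%:R `*` dball dY point n%:R.

Let mrect n : measurable (rect n).
Proof.
apply: measurableX.
  exact: (caratheodory_dball (@metric_triangle R X) mmsX).
exact: (caratheodory_dball (@metric_triangle R Y) mmsY).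
Qed.

Let u0r n : TX * TY -> \bar R := (abse \o u0) \_ (rect n).

Let mu0r n : measurable_fun setT (u0r n).
Proof.
apply/(measurable_restrictT _ (mrect n)).
by apply: measurable_funTS; exact: measurableT_comp.
Qed.

Let u0r_ge0 n z : 0 <= u0r n z. Proof. by apply: erestrict_ge0 => *; exact: abse_ge0. Qed.

(** The rectangle is contained in the preimage of a ball of the warped
product, over which u is integrable. *)
Let u0r_fin n : \int[(m1 \x m2)%E]_z u0r n z < +oo.
Proof.
pose r : R := (phi point * n%:R + n%:R + 1)%R.
have r0 : (0 < r)%R by rewrite ltr_wpDl// addr_ge0// mulr_ge0.
pose B := dball wd (P (point, point)) r.
have oB : dopen wd B by exact: dopen_dball.
have mB : measurable (P @^-1` B : set (TX * TY)).
  exact: (measurable_preimage_dopen mmsX mmsY lenX lenY normN unitN incrN phi_ge0 phi_cont).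
have cB : mZ.-caratheodory B.
  apply: (caratheodory_borel mmsX mmsY lenX lenY normN unitN incrN phi_ge0 phi_cont).
  exact: sub_sigma_algebra.
have /integrableP[_ uB] := intu (P (point, point)) r0.
have rectB : rect n `<=` P @^-1` B.
  move=> [x y] [/= xn yn]; rewrite /B /dball/=.
  apply: (le_lt_trans (warped_dist_le lenX lenY normN unitN incrN phi_ge0 phi_cont point x point point y)).
  rewrite mdistxx add0r /r ltr_pwDr// lerD//; last exact: ltW.
  by rewrite ler_wpM2l// ltW.
apply: (@le_lt_trans _ _ (\int[(m1 \x m2)%E]_z ((abse \o u0) \_ (P @^-1` B)) z)).
  apply: ge0_le_integral => //.
  - apply/(measurable_restrictT _ mB).
    by apply: measurable_funTS; exact: measurableT_comp.
  - move=> z _; rewrite /u0r !patchE; case: ifPn => [/set_mem/rectB zB|_].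
      by rewrite mem_set.
    by case: ifP => // _; exact: abse_ge0.
have <- : \int[cmeasure mZ]_Q ((abse \o u) \_ B) Q = \int[(m1 \x m2)%E]_z ((abse \o u0) \_ (P @^-1` B)) z; last first.
  by rewrite -integral_mkcond.
apply: (integral_warped normN unitN incrN phi_ge0 phi_cont phi_ae m1E m2E).
- by apply: measurable_function_restrict => //; exact: measurableT_comp.
- by move=> Q; apply: erestrict_ge0 => *; exact: abse_ge0.
- apply/(measurable_restrictT _ mB).
  by apply: measurable_funTS; exact: measurableT_comp.
- by move=> z; apply: erestrict_ge0 => *; exact: abse_ge0.
- exists M; split => // z /uM uz /=; rewrite !patchE /=.
  by have -> : (P z \in B) = (z \in P @^-1` B) by []; rewrite uz.
Qed.

Let rect_ball (x : X) (y : Y) r : (0 < r)%R ->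
  exists n, (forall x', dball dX x r x' -> rect n (x', y)) /\
            (forall y', dball dY y r y' -> rect n (x, y')).
Proof.
move=> r0; exists (Num.truncn (dX point x + dY point y + r)%R).+1.
have := truncnS_gt (dX point x + dY point y + r)%R.
set n := _%:R => tn.
have [a0 b0] := (mdist_ge0 point x, mdist_ge0 point y).
split=> z; rewrite /rect /dball /= => xz; split.
- by have := metric_triangle point x z; lra.
- by move: tn; rewrite -/n; lra.
- by move: tn; rewrite -/n; lra.
- by have := metric_triangle point y z; lra.
Qed.

(** The slice at height y sees the equality of u and u0 almost everywhere, u
is integrable over its balls, and g is p-integrable on it; Tonelli gives this
for almost every y. *)
Definition horizontal_slice_regular y := [/\ muX (ysection M y) = 0,
  forall n, \int[cmeasure muX]_x u0r n (x, y) < +oo &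
  \int[cmeasure muX]_x Gp (x, y) < +oo].

Definition vertical_slice_regular x := [/\ muY (xsection M x) = 0,
  forall n, \int[cmeasure muY]_y u0r n (x, y) < +oo & (0 < phi x)%R].

Lemma ae_horizontal_slice_regular : {ae cmeasure muY, forall y, horizontal_slice_regular y}.
Proof.
have [_ sM] := null_sections mM M0.
have H1 : {ae cmeasure muY, forall y, muX (ysection M y) = 0}.
  by apply: filterS (aeY sM) => y; rewrite -m1E.
have H2 : {ae cmeasure muY, forall y n, \int[cmeasure muX]_x u0r n (x, y) < +oo}.
  apply: ae_foralln => n; apply: aeY.
  have AE := ae_filter_ringOfSetsType m2.
  by apply: filterS (tonelli_ae2 (mu0r n) (u0r_ge0 n) (u0r_fin n)) => y; rewrite im1.
have H3 : {ae cmeasure muY, forall y, \int[cmeasure muX]_x Gp (x, y) < +oo}.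
  by apply: filterS (aeY (tonelli_ae2 mGp Gp_ge0 Gp_fin)) => y; rewrite im1.
by apply: filterS3 H1 H2 H3 => y.
Qed.

Lemma ae_vertical_slice_regular : {ae cmeasure muX, forall x, vertical_slice_regular x}.
Proof.
have [sM _] := null_sections mM M0.
have H1 : {ae cmeasure muX, forall x, muY (xsection M x) = 0}.
  by apply: filterS (aeX sM) => y; rewrite -m2E.
have H2 : {ae cmeasure muX, forall x n, \int[cmeasure muY]_y u0r n (x, y) < +oo}.
  apply: ae_foralln => n; apply: aeX.
  have AE := ae_filter_ringOfSetsType m1.
  by apply: filterS (tonelli_ae1 (mu0r n) (u0r_ge0 n) (u0r_fin n)) => y; rewrite im2.
by apply: filterS3 H1 H2 phi_ae => x.
Qed.

Hypothesis spX : sobolev_poincare dX muX p p CX.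

Let CX_gt0 : (0 < CX)%R. Proof. by have [] := spX. Qed.

(** The inequality on X, applied to the slice of u with the slice of g as
upper gradient. *)
Lemma horizontal_sobolev_poincare y : horizontal_slice_regular y -> exists c : R,
  \int[cmeasure muX]_x (`|u0 (x, y) - c%:E| `^ p) <=
  (CX `^ p)%:E * \int[cmeasure muX]_x Gp (x, y).
Proof.
move=> [My uy gy]; have [_ sp] := spX.
have uv x : ~ ysection M y x -> u (P (x, y)) = u0 (x, y).
  by move=> Mxy; apply: uM => xyM; apply: Mxy; rewrite /ysection/= inE.
have mv : measurable_function muX (fun x => u0 (x, y)) := measurable_fun_pair1 y mu0.
have ugy : upper_gradient dX (fun x => u (P (x, y))) (fun x => g (P (x, y))).
  exact: upper_gradient_horizontal ug.
have D1y : D1 dX muX p (fun x => u (P (x, y))).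
  split; first exact: (measurable_function_null My uv mv).
    move=> x r r0; have [n [rn _]] := rect_ball x y r0.
    apply: (integrable_null My uv mv (h := fun x => u0r n (x, y))) => //.
    - exact: (caratheodory_dball (@metric_triangle R X) mmsX).
    - exact: (measurable_fun_pair1 y (mu0r n)).
    - by move=> x' /rn xn; rewrite /u0r patchE mem_set.
  by exists (fun x => g (P (x, y))) => //; apply/Lnorm_lty.
have [c] := sp _ _ D1y ugy (proj2 (Lnorm_lty _ _ p_ge1) gy).
move=> /(Lnorm_le_integral _ _ _ _ p_ge1 (ltW CX_gt0)) H; exists c.
by rewrite -(integral_dist_powR_null p c My uv mv (@measurableT _ TX)); exact: H.
Qed.

Let cball y r : muY.-caratheodory (dball dY y r).
Proof. exact: (caratheodory_dball (@metric_triangle R Y) mmsY). Qed.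

(** The weak local inequality on Y, applied to the slice of u with the upper
gradient phi x * g; the average is that of u0, which depends measurably on
x. *)
Lemma vertical_poincare y0 : inf_weak_local_poincare dY muY p p ->
  exists C r, [/\ (0 < C)%R, (0 < r)%R & forall x, vertical_slice_regular x ->
    \int[cmeasure muY]_(y in dball dY y0 r)
      (`|u0 (x, y) - (average muY (fun y => u0 (x, y)) (dball dY y0 r))%:E| `^ p) <=
    (C `^ p)%:E * ((phi x `^ p)%:E * \int[cmeasure muY]_y Gp (x, y))].
Proof.
move=> /(_ y0)[C [r [C0 r0 wp]]]; exists C, r; split => // x [Mx ux phix].
set B := dball dY y0 r in wp *.
have mB : measurable (B : set TY) := @cball y0 r.
have uv y : ~ xsection M x y -> u (P (x, y)) = u0 (x, y).
  by move=> Mxy; apply: uM => xyM; apply: Mxy; rewrite /xsection/= inE.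
have mv : measurable_function muY (fun y => u0 (x, y)) := measurable_fun_pair2 x mu0.
have mux := measurable_function_null Mx uv mv.
have iux : integrable_over_balls dY muY (fun y => u (P (x, y))).
  move=> y s s0; have [n [_ sn]] := rect_ball x y s0.
  apply: (integrable_null Mx uv mv (h := fun y => u0r n (x, y))) => //.
  - exact: (measurable_fun_pair2 x (mu0r n)).
  - by move=> y' /sn yn; rewrite /u0r patchE mem_set.
have ugx : upper_gradient dY (fun y => u (P (x, y))) (fun y => (phi x)%:E * g (P (x, y))).
  exact: upper_gradient_vertical ug.
have := wp _ _ mux iux ugx; rewrite /=.
have -> : average muY (fun y => u (P (x, y))) B = average muY (fun y => u0 (x, y)) B.
  congr (fine _ / _)%R; apply: ae_eq_integral => //; [exact: measurable_funTS..|].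
  exact/ae_eq_sym/(ae_eq_null Mx uv).
move: (average _ _ _) => a /(Lnorm_le_integral _ _ _ _ p_ge1 (ltW C0)) H.
rewrite -(integral_dist_powR_null p a Mx uv mv mB).
have -> : \int[cmeasure muY]_(y in B) (`|u (P (x, y)) - a%:E| `^ p) =
   \int[cmeasure muY]_y (`|((fun y => u (P (x, y)) - a%:E) \_ B) y| `^ p).
  rewrite integral_mkcond; apply: eq_integral => y _; rewrite !patchE.
  by case: ifP => // _; rewrite abse0 poweR0r// gt_eqF.
apply: le_trans H _; rewrite lee_wpmul2l ?lee_fin ?powR_ge0//.
rewrite -ge0_integralZl_EFin ?powR_ge0//; last exact: measurable_fun_pair2.
apply: ge0_le_integral => //.
- by move=> y _; exact: poweR_ge0.
- apply: (measurableT_comp (measurable_poweR p)); apply: measurableT_comp => //.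
  by apply: measurable_funeM; exact: (measurable_fun_pair2 x mG).
- by apply: measurable_funeM; exact: (measurable_fun_pair2 x mGp).
- move=> y _; rewrite abseM poweRM// ?abse_ge0//.
  by rewrite gee0_abs ?lee_fin// poweR_EFin.
Qed.

(** The integrals over the ball of the positive and negative parts of u0
depend measurably on x, by Tonelli. *)
Lemma measurable_average y0 r :
  measurable_fun setT (fun x : TX => average muY (fun y => u0 (x, y)) (dball dY y0 r)).
Proof.
set B := dball dY y0 r.
have mB : measurable (B : set TY) := @cball y0 r.
have mS : measurable (setT `*` B : set (TX * TY)) by exact: measurableX.
apply: measurable_funM; last exact: measurable_cst.
apply: (measurableT_comp (fine_measurable measurableT)).
have split_average (x : TX) : \int[cmeasure muY]_(y in (B : set TY)) u0 (x, y) =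
   fubini_F m2 (u0^\+ \_ (setT `*` B)) x - fubini_F m2 (u0^\- \_ (setT `*` B)) x.
  rewrite integralE /fubini_F !im2 !(integral_mkcond (B : set TY)).
  congr (_ - _); apply: eq_integral => y _; rewrite !patchE in_setX in_setT /=.
    by case: ifP => // _; rewrite [LHS]funeposE [RHS]funeposE.
  by case: ifP => // _; rewrite [LHS]funenegE [RHS]funenegE.
rewrite (_ : (fun x => _) = (fubini_F m2 (u0^\+ \_ (setT `*` B)) \- fubini_F m2 (u0^\- \_ (setT `*` B)))).
  apply: emeasurable_funB; apply: measurable_fun_fubini_tonelli_F.
  - by apply/(measurable_restrictT _ mS); apply: measurable_funTS; exact: measurable_funepos.
  - by move=> z; apply: erestrict_ge0.
  - by apply/(measurable_restrictT _ mS); apply: measurable_funTS; exact: measurable_funeneg.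
  - by move=> z; apply: erestrict_ge0.
by apply/funext => x; exact: split_average.
Qed.

(* The weight phi^-p on E, through the properties that the comparison uses. *)
Variables (w : X -> \bar R) (W : R).
Hypotheses (mw : measurable_fun (setT : set TX) w) (w_ge0 : forall x, 0 <= w x)
  (w_int : \int[cmeasure muX]_x w x = +oo) (W_ge0 : (0 <= W)%R)
  (w_le : {ae cmeasure muX, forall x, w x <= W%:E})
  (w_phi : forall x, (0 < phi x)%R -> w x * (phi x `^ p)%:E <= 1).

(** By the triangle inequality w |b - a|^p is integrable; as w is not, b =
a. *)
Lemma weighted_constant_unique (A : X -> R) a b : measurable_fun (setT : set TX) A ->
  \int[cmeasure muX]_x (w x * (`|A x - a| `^ p)%:E) < +oo ->
  \int[cmeasure muX]_x (w x * (`|A x - b| `^ p)%:E) < +oo -> a = b.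
Proof.
move=> mA wa wb; apply/eqP; apply: contraPT isT => ab _.
have mwA c : measurable_fun (setT : set TX) (fun x => w x * (`|A x - c| `^ p)%:E).
  apply: emeasurable_funM => //; apply/measurable_EFinP.
  apply: (measurableT_comp (measurable_powR p)); apply: measurableT_comp => //.
  exact: measurable_funB.
have wA0 c x : 0 <= w x * (`|A x - c| `^ p)%:E by rewrite mule_ge0// lee_fin powR_ge0.
have ab0 : (0 < `|b - a| `^ p)%R.
  by rewrite powR_gt0// normr_gt0 subr_eq0 eq_sym.
have : \int[cmeasure muX]_x ((`|b - a| `^ p)%:E * w x) <=
       \int[cmeasure muX]_x ((2 `^ p)%:E * (w x * (`|A x - a| `^ p)%:E + w x * (`|A x - b| `^ p)%:E)).
  apply: ge0_le_integral => //.
  - by move=> x _; rewrite mule_ge0// lee_fin powR_ge0.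
  - exact: measurable_funeM.
  - by apply: measurable_funeM; exact: emeasurable_funD.
  - move=> x _; rewrite -ge0_muleDr ?lee_fin ?powR_ge0// muleCA muleC.
    by rewrite lee_wpmul2l// (poweR_dist_le a b (A x)%:E p_ge1).
rewrite ge0_integralZl_EFin ?powR_ge0// w_int gt0_muley ?lte_fin// leye_eq => /eqP.
rewrite ge0_integralZl_EFin ?powR_ge0//; last 2 first.
  by move=> x _; rewrite adde_ge0.
  exact: emeasurable_funD.
rewrite ge0_integralD// => oo.
suff : (2 `^ p)%:E * (\int[cmeasure muX]_x (w x * (`|A x - a| `^ p)%:E)
    + \int[cmeasure muX]_x (w x * (`|A x - b| `^ p)%:E)) < +oo by rewrite oo ltxx.
apply: lte_mul_pinfty; [by rewrite lee_fin powR_ge0|by []|].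
apply: lte_add_pinfty; [exact: wa|exact: wb].
Qed.

Section HorizontalConstants.
Variable c : Y -> R.
Hypothesis cP : forall y, horizontal_slice_regular y ->
  \int[cmeasure muX]_x (`|u0 (x, y) - (c y)%:E| `^ p) <=
  (CX `^ p)%:E * \int[cmeasure muX]_x Gp (x, y).

(** The function H, which is w |u0 - A|^p over the ball, has a finite integral
because w cancels the factor phi^p of [vertical_poincare]. So for almost every
y in the ball, A is close to c y in the weighted sense of
[weighted_constant_unique]. *)
Lemma constants_locally_ae_constant y0 : inf_weak_local_poincare dY muY p p ->
  exists r k, (0 < r)%R /\ muY (dball dY y0 r `&` [set y | c y <> k]) = 0.
Proof.
move=> /(vertical_poincare y0)[C [r [C0 r0 vp]]].
set B := dball dY y0 r in vp *.
pose A x := average muY (fun y => u0 (x, y)) B.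
have mA : measurable_fun (setT : set TX) A := @measurable_average y0 r.
have mB : measurable (B : set TY) := @cball y0 r.
have mS : measurable (setT `*` B : set (TX * TY)) by exact: measurableX.
pose V (z : TX * TY) := `|u0 z - (A z.1)%:E| `^ p.
have mV : measurable_fun setT V.
  apply: (measurableT_comp (measurable_poweR p)); apply: measurableT_comp => //.
  apply: emeasurable_funB => //; apply/measurable_EFinP.
  exact: (measurableT_comp mA measurable_fst).
have V_ge0 z : 0 <= V z by exact: poweR_ge0.
pose H (z : TX * TY) := w z.1 * (V \_ (setT `*` B)) z.
have mH : measurable_fun setT H.
  apply: emeasurable_funM; first exact: (measurableT_comp mw measurable_fst).
  by apply/(measurable_restrictT _ mS); exact: measurable_funTS.
have H_ge0 z : 0 <= H z by rewrite mule_ge0// erestrict_ge0.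
have H_fin : \int[(m1 \x m2)%E]_z H z < +oo.
  apply: (@le_lt_trans _ _ ((C `^ p)%:E * \int[(m1 \x m2)%E]_z Gp z)); last first.
    by rewrite lte_mul_pinfty ?lee_fin ?powR_ge0.
  rewrite !fubini_tonelli1// !im1 -ge0_integralZl_EFin ?powR_ge0//; last 2 first.
    by move=> x _; exact: integral_ge0.
    exact: measurable_fun_fubini_tonelli_F.
  apply: ae_ge0_le_integral => //.
  - by move=> x _; exact: integral_ge0.
  - exact: measurable_fun_fubini_tonelli_F.
  - by move=> x _; rewrite mule_ge0 ?lee_fin ?powR_ge0//; exact: integral_ge0.
  - by apply: measurable_funeM; exact: measurable_fun_fubini_tonelli_F.
  apply: filterS ae_vertical_slice_regular => x gx _; have [_ _ phix] := gx.
  rewrite /fubini_F !im2 /H /=.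
  rewrite ge0_integralZl//; last 2 first.
    by apply: (measurable_fun_pair2 x); apply/(measurable_restrictT _ mS); exact: measurable_funTS.
    by move=> y _; exact: erestrict_ge0.
  have -> : \int[cmeasure muY]_y (V \_ (setT `*` B)) (x, y) = \int[cmeasure muY]_(y in B) V (x, y).
    by rewrite [RHS]integral_mkcond; apply: eq_integral => y _; rewrite !patchE in_setX in_setT.
  apply: le_trans (lee_wpmul2l (w_ge0 x) (vp x gx)) _.
  rewrite muleCA lee_wpmul2l ?lee_fin ?powR_ge0// muleA -[leRHS]mul1e.
  by rewrite lee_wpmul2r ?integral_ge0// w_phi.
have Hy : {ae cmeasure muY, forall y, \int[cmeasure muX]_x H (x, y) < +oo}.
  by apply: filterS (aeY (tonelli_ae2 mH H_ge0 H_fin)) => y; rewrite im1.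
pose S y := B y -> \int[cmeasure muX]_x (w x * (`|A x - c y| `^ p)%:E) < +oo.
have aeS : {ae cmeasure muY, forall y, S y}.
  apply: filterS2 Hy ae_horizontal_slice_regular => y Hy gy By.
  have [_ _ Gy] := gy.
  have mUc : measurable_fun (setT : set TX) (fun x => `|u0 (x, y) - (c y)%:E| `^ p).
    by apply: measurable_function_dist_powR; exact: measurable_fun_pair1.
  apply: (@le_lt_trans _ _ (\int[cmeasure muX]_x
    ((2 `^ p)%:E * (H (x, y) + W%:E * `|u0 (x, y) - (c y)%:E| `^ p)))).
    apply: ae_ge0_le_integral => //.
    - by move=> x _; rewrite mule_ge0// lee_fin powR_ge0.
    - apply: emeasurable_funM => //; apply/measurable_EFinP.
      apply: (measurableT_comp (measurable_powR p)); apply: measurableT_comp => //.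
      exact: measurable_funB.
    - by move=> x _; rewrite mule_ge0 ?lee_fin ?powR_ge0// adde_ge0// mule_ge0 ?lee_fin ?poweR_ge0.
    - apply: measurable_funeM; apply: emeasurable_funD; last exact: measurable_funeM.
      exact: measurable_fun_pair1.
    - have AE := ae_filter_ringOfSetsType (cmeasure muX).
      apply: filterS w_le => x wx _.
      apply: le_trans (lee_wpmul2l (w_ge0 x) (poweR_dist_le _ _ (u0 (x, y)) p_ge1)) _.
      rewrite muleCA lee_wpmul2l ?lee_fin ?powR_ge0//.
      rewrite ge0_muleDr ?poweR_ge0// addeC leeD//.
        by rewrite /H /= patchE mem_set.
      by rewrite lee_wpmul2r// poweR_ge0.
  rewrite ge0_integralZl_EFin ?powR_ge0//; last 2 first.
    by move=> x _; rewrite adde_ge0// mule_ge0 ?lee_fin ?poweR_ge0.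
    apply: emeasurable_funD; last exact: measurable_funeM.
    exact: measurable_fun_pair1.
  rewrite lte_mul_pinfty ?lee_fin ?powR_ge0// ge0_integralD//; last 3 first.
    exact: measurable_fun_pair1.
    by move=> x _; rewrite mule_ge0 ?lee_fin ?poweR_ge0.
    exact: measurable_funeM.
  rewrite lte_add_pinfty// ge0_integralZl_EFin//; last by move=> *; exact: poweR_ge0.
  rewrite lte_mul_pinfty ?lee_fin// (le_lt_trans (cP gy))//.
  by rewrite lte_mul_pinfty ?lee_fin ?powR_ge0.
(* A single point of the ball satisfying S provides the constant. *)
have [[y [By Sy]]|noS] := pselect (exists y, B y /\ S y); last first.
  exists r, 0%R; split => //; apply/eqP; rewrite eq_le outer_measure_ge0 andbT.
  move/ae_cmeasureP : aeS => <-; apply: le_outer_measure => y [By _] /= Sy.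
  by apply: noS; exists y.
exists r, (c y); split => //; apply/eqP; rewrite eq_le outer_measure_ge0 andbT.
move/ae_cmeasureP : aeS => <-; apply: le_outer_measure => y' [By'] /= cyy' Sy'.
by apply: cyy'; exact: (weighted_constant_unique mA (Sy' By') (Sy By)).
Qed.

(** Once c is the constant k almost everywhere, the horizontal inequalities
are integrated in y. *)
Lemma horizontal_constants_glue k : muY [set y | c y <> k] = 0 ->
  'N[cmeasure mZ]_p%:E[u \- cst k%:E] <= CX%:E * 'N[cmeasure mZ]_p%:E[g].
Proof.
move=> ck; apply/(Lnorm_le_integral _ _ _ _ p_ge1 (ltW CX_gt0)).
pose U (z : TX * TY) := `|u0 z - k%:E| `^ p.
have mU : measurable_fun setT U.
  apply: (measurableT_comp (measurable_poweR p)); apply: measurableT_comp => //.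
  exact: emeasurable_funB.
have U_ge0 z : 0 <= U z by exact: poweR_ge0.
have -> : \int[cmeasure mZ]_Q (`|(u \- cst k%:E) Q| `^ p) = \int[(m1 \x m2)%E]_z U z.
  apply: (integral_warped normN unitN incrN phi_ge0 phi_cont phi_ae m1E m2E) => //.
  - exact: measurable_function_dist_powR.
  - by move=> Q; exact: poweR_ge0.
  - by exists M; split => // z /uM uz; rewrite /= uz.
rewrite integral_Gp !fubini_tonelli2// !im2 -ge0_integralZl_EFin ?powR_ge0//; last 2 first.
  by move=> y _; exact: integral_ge0.
  exact: measurable_fun_fubini_tonelli_G.
apply: ae_ge0_le_integral => //.
- by move=> y _; exact: integral_ge0.
- exact: measurable_fun_fubini_tonelli_G.
- by move=> y _; rewrite mule_ge0 ?lee_fin ?powR_ge0//; exact: integral_ge0.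
- by apply: measurable_funeM; exact: measurable_fun_fubini_tonelli_G.
have ck_ae : {ae cmeasure muY, forall y, c y = k}.
  apply/ae_cmeasureP; exact: ck.
have AE := ae_filter_ringOfSetsType (cmeasure muY).
apply: filterS2 ck_ae ae_horizontal_slice_regular => y cy /cP + _.
by rewrite /fubini_G !im1 cy.
Qed.

End HorizontalConstants.

Lemma exists_warped_constant : inf_weak_local_poincare dY muY p p -> exists k : R,
  'N[cmeasure mZ]_p%:E[u \- cst k%:E] <= CX%:E * 'N[cmeasure mZ]_p%:E[g].
Proof.
move=> wpY.
have /choice[c cP] : forall y, exists c : R, horizontal_slice_regular y ->
    \int[cmeasure muX]_x (`|u0 (x, y) - c%:E| `^ p) <=
    (CX `^ p)%:E * \int[cmeasure muX]_x Gp (x, y).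
  move=> y; have [gy|ngy] := pselect (horizontal_slice_regular y); last by exists 0%R.
  by have [c cy] := horizontal_sobolev_poincare gy; exists c.
have [k ck] := locally_ae_constant (@metric_sym R Y) (@metric_triangle R Y) mmsY lenY
  (fun y0 => constants_locally_ae_constant cP y0 wpY).
by exists k; exact: (horizontal_constants_glue cP ck).
Qed.

End WarpedSobolevPoincare.

(** * The Sobolev--Poincare property of the warped product *)

Section WarpedBalls.
Local Open Scope ereal_scope.
Context {R : realType} {X Y : pmetricType R}.
Variables (muX : {outer_measure set X -> \bar R})
  (muY : {outer_measure set Y -> \bar R}) (N : R * R -> R) (phi : X -> R).
Hypotheses (mmsX : metric_measure_space (@mdist R X) muX)
  (mmsY : metric_measure_space (@mdist R Y) muY)
  (lenX : length_space (@mdist R X)) (lenY : length_space (@mdist R Y)).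
Hypotheses (normN : is_norm N) (unitN : unitary N) (incrN : coordinate_increasing N).
Hypotheses (phi_ge0 : forall x, (0 <= phi x)%R) (phi_cont : continuous phi).
Local Notation P := (@warped_proj R X Y N phi).
Local Notation wd := (@warped_dist R X Y N phi).
Local Notation mZ := (@warped_measure R X Y N phi muX muY).

Lemma caratheodory_warped_ball Q r : mZ.-caratheodory (dball wd Q r).
Proof.
apply: (caratheodory_borel mmsX mmsY lenX lenY normN unitN incrN phi_ge0 phi_cont).
apply: sub_sigma_algebra; apply: dopen_dball.
exact: (warped_dist_triangle lenX lenY normN unitN incrN phi_ge0).
Qed.

(** A ball projects into a ball of X. Its second coordinates range over a ball
of Y if phi >= K > 0, and otherwise over Y, which then has finite measure. *)
Lemma warped_ball_fin Q r : (0 < r)%R ->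
  (exists2 K : R, (0 < K)%R & forall x, (K <= phi x)%R) \/ muY setT < +oo ->
  mZ (dball wd Q r) < +oo.
Proof.
move=> r0 phi_cond; have [[x y] ->] := warped_proj_surj Q.
have Xfin : muX (dball (@mdist R X) x r) < +oo by exact: dball_fin.
have [D [cD Dfin sub]] : exists D : set Y, [/\ muY.-caratheodory D, muY D < +oo &
    P @^-1` dball wd (P (x, y)) r `<=` dball (@mdist R X) x r `*` D].
  have fstB (z : X * Y) : dball wd (P (x, y)) r (P z) -> dball (@mdist R X) x r z.1.
    apply: le_lt_trans.
    exact: (warped_dist_ge_fst lenX lenY normN unitN incrN phi_ge0 phi_cont (x, y) z).
  case: phi_cond => [[K K0 Kphi]|Yfin]; last first.
    by exists setT; split => //; [exact: (@measurableT _ (caratheodory_type muY))|move=> z /fstB].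
  exists (dball (@mdist R Y) y (r / K)); split.
  - exact: (caratheodory_dball (@metric_triangle R Y) mmsY).
  - exact: dball_fin.
  - move=> z Bz; split; first exact: fstB.
    rewrite /dball/= ltr_pdivlMr// mulrC; apply: le_lt_trans Bz.
    exact: (warped_dist_ge_snd lenX lenY normN unitN incrN phi_ge0 phi_cont (x, y) z K0 Kphi).
apply: le_lt_trans (le_outer_measure (prod_outer muX muY) _ _ sub) _.
apply: le_lt_trans (prod_outer_rectangle_le _ cD) _.
  exact: (caratheodory_dball (@metric_triangle R X) mmsX).
by rewrite lte_mul_pinfty ?outer_measure_ge0// ge0_fin_numE ?outer_measure_ge0.
Qed.

End WarpedBalls.

Section Constants.
Local Open Scope ereal_scope.
Context {R : realType} {T : pointedType}.
Variables (d : T -> T -> R) (mu : {outer_measure set T -> \bar R}) (p C : R).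
Hypotheses (cball : forall x r, mu.-caratheodory (dball d x r))
  (ballfin : forall x r, (0 < r)%R -> mu (dball d x r) < +oo).

(** By the inequality, u - c has a finite p-norm, and the addition of a
constant does not change the upper gradients. *)
Lemma D1_N1_plus_constants : (1 <= p)%R -> sobolev_poincare d mu p p C ->
  D1 d mu p = N1_plus_constants d mu p.
Proof.
move=> p1 [C0 sp].
apply/seteqP; split=> [u D1u|_ [v [D1v _] [c ->]]]; last exact: D1_addr.
have [mu_ intu [g ug gfin]] := D1u; have [c uc] := sp u g D1u ug gfin.
exists (u \+ cst (- c)%:E); last first.
  by exists c; apply/funext => x /=; rewrite EFinN subeK.
split; first exact: D1_addr.
apply/Lnorm_lty => //; apply: le_lt_trans uc _.
by rewrite lte_mul_pinfty// lee_fin ltW.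
Qed.

End Constants.

Section Weight.
Local Open Scope ereal_scope.
Context {R : realType} {X : pmetricType R}.
Variables (muX : {outer_measure set X -> \bar R}) (p : R) (phi : X -> R) (E : set X).
Hypothesis cE : muX.-caratheodory E.
Local Notation w := (inv_pow phi p \_ E).

Lemma inv_pow_ge0 x : 0 <= inv_pow phi p x.
Proof. by rewrite /inv_pow inve_ge0 lee_fin powR_ge0. Qed.

Lemma restrict_inv_pow_ge0 x : 0 <= w x.
Proof. by apply: erestrict_ge0 => *; exact: inv_pow_ge0. Qed.

Lemma measurable_restrict_inv_pow :
  measurable_fun (E : set (caratheodory_type muX)) (inv_pow phi p) ->
  measurable_fun [set: caratheodory_type muX] w.
Proof.
move=> mE; have mE' : measurable (E : set (caratheodory_type muX)) := cE.
exact: (proj1 (measurable_restrictT (inv_pow phi p : caratheodory_type muX -> _) mE')).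
Qed.

Lemma integral_restrict_inv_pow :
  measurable_fun (E : set (caratheodory_type muX)) (inv_pow phi p) ->
  ~ (cmeasure muX).-integrable E (inv_pow phi p) -> \int[cmeasure muX]_x w x = +oo.
Proof.
move=> mE nint; rewrite -integral_mkcond; apply/eqP; rewrite -leye_eq leNgt.
apply/negP => fin; apply: nint; apply/integrableP; split => //.
by under eq_integral do rewrite gee0_abs ?inv_pow_ge0//.
Qed.

(** The essential supremum is a bound almost everywhere; it is replaced by a
nonnegative real one. *)
Lemma restrict_inv_pow_bounded : 0 < muX setT -> 'N[cmeasure muX]_(+oo)[w] < +oo ->
  exists2 W : R, (0 <= W)%R & {ae cmeasure muX, forall x, w x <= W%:E}.
Proof.
rewrite unlock => mu0; rewrite ifT//.
set s := ess_sup _ _ => s_fin.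
have AE := ae_filter_ringOfSetsType (cmeasure muX).
have ws : {ae cmeasure muX, forall x, w x <= s}.
  apply: filterS (ess_sup_ge (cmeasure muX) (abse \o w)) => x /=.
  by rewrite gee0_abs ?restrict_inv_pow_ge0.
case: s ws s_fin => [s ws _|//|ws _].
  exists (Num.max 0%R s); first by rewrite le_max lexx.
  by apply: filterS ws => x /le_trans; apply; rewrite lee_fin le_max lexx orbT.
by exists 0%R => //; apply: filterS ws => x /le_trans; apply; exact: leNye.
Qed.

Lemma restrict_inv_pow_mul x : (0 < phi x)%R -> w x * (phi x `^ p)%:E <= 1.
Proof.
move=> phix; rewrite patchE; case: ifP => _; last by rewrite mul0e lee_fin.
have phip : (0 < phi x `^ p)%R by exact: powR_gt0.
by rewrite /inv_pow inver gt_eqF// -EFinM mulVf// gt_eqF.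
Qed.

End Weight.

Theorem theorem5p1 (R : realType) (X Y : pmetricType R)
  (muX : {outer_measure set X -> \bar R})
  (muY : {outer_measure set Y -> \bar R})
  (N : R * R -> R) (p CX : R) (phi : X -> R)
  (mmsX : metric_measure_space (@mdist R X) muX)
  (mmsY : metric_measure_space (@mdist R Y) muY)
  (lenX : length_space (@mdist R X))
  (lenY : length_space (@mdist R Y))
  (normN : is_norm N) (unitN : unitary N) (incrN : coordinate_increasing N)
  (p_ge1 : 1 <= p)
  (phi_ge0 : forall x, 0 <= phi x) (phi_cont : continuous phi)
  (phi_cond :
    0 < inf (range phi) \/
    ((muY [set: Y] < +oo)%E /\ {ae cmeasure muX, forall x, 0 < phi x}))
  (spX : sobolev_poincare (@mdist R X) muX p p CX)
  (muX_infty : muX [set: X] = +oo%E)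
  (wpY : inf_weak_local_poincare (@mdist R Y) muY p p)
  (exE : exists E : set X,
    [/\ muX.-caratheodory E,
        (0 < muX E)%E,
        measurable_fun (E : set (caratheodory_type muX)) (inv_pow phi p) /\
          ('N[cmeasure muX]_(+oo)[inv_pow phi p \_ E] < +oo)%E &
        ~ (cmeasure muX).-integrable E (inv_pow phi p)]) :
  let d := @warped_dist R X Y N phi in
  let mu := @warped_measure R X Y N phi muX muY in
  sobolev_poincare d mu p p CX /\ D1 d mu p = N1_plus_constants d mu p.
Proof.
move=> d mu.
have inf_phi : 0 < inf (range phi) -> forall x, inf (range phi) <= phi x.
  by move=> _ x; apply: ge_inf; [exists 0 => _ [z _ <-]|exists x].
have phi_ae : {ae cmeasure muX, forall x, 0 < phi x}.
  case: phi_cond => [K0|[]//].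
  by apply: aeW => x; exact: lt_le_trans K0 (inf_phi K0 x).
have ballfin Q r : 0 < r -> (mu (dball d Q r) < +oo)%E.
  move=> r0; apply: warped_ball_fin => //; case: phi_cond => [K0|[]]; last by right.
  by left; exists (inf (range phi)) => //; exact: inf_phi.
suff sp : sobolev_poincare d mu p p CX.
  split => //; apply: D1_N1_plus_constants sp => //.
  by move=> Q r; exact: caratheodory_warped_ball.
split; first by have [] := spX.
move=> u g [mu_ intu _] ug gfin.
pose m1 := as_sigma_finite_measure (sigma_finite_cmeasure (@metric_triangle R X) mmsX).
pose m2 := as_sigma_finite_measure (sigma_finite_cmeasure (@metric_triangle R Y) mmsY).
have [u0 mu0 [M [mM M0 uM]]] : exists2 u0 : caratheodory_type muX * caratheodory_type muY -> \bar R,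
    measurable_fun setT u0 & product_equivalent m1 m2 (u \o @warped_proj R X Y N phi) u0.
  apply: measurable_fun_product_equivalent => //.
  exact: (measurableT_comp mu_ (measurable_proj_caratheodory normN unitN incrN phi_ge0 phi_cont phi_ae)).
have [E [cE E0 [mE bE] nE]] := exE.
have muX0 : (0 < muX setT)%E by rewrite muX_infty.
have [W W0 wW] := restrict_inv_pow_bounded muX0 bE.
exact: (@exists_warped_constant R X Y muX muY N p CX phi mmsX mmsY lenX lenY normN unitN
  incrN p_ge1 phi_ge0 phi_cont phi_ae m1 m2 (fun=> erefl) (fun=> erefl) u g mu_ intu ug gfin
  u0 mu0 M mM M0 uM spX _ W (measurable_restrict_inv_pow cE mE)
  (@restrict_inv_pow_ge0 _ _ p phi E) (integral_restrict_inv_pow mE nE) W0 wW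
  (@restrict_inv_pow_mul _ _ p phi E) wpY).
Qed.
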